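(* Let $(E,M,\rho,[\cdot,\cdot]_E)$ be a convenient Lie algebroid, $E^\flat$ a weak subbundle of the dual bundle $E'$, and $D\subset E^{\mathfrak p}=E\oplus E^\flat$ a partial almost Dirac structure on $E$. Let $\rho^{\mathfrak p}:E^{\mathfrak p}\to TM$ be given by $\rho^{\mathfrak p}(r,\alpha)=\rho(r)$, let $\rho^D$ be the restriction of $\rho^{\mathfrak p}$ to $D$, and let $[\cdot,\cdot]_D$ be the restriction of the Courant bracket $[\cdot,\cdot]_C$ to local sections of $D$. Then $D$ is a partial Dirac structure on $E$ if and only if $\rho^D$ is an anchor such that $(D,M,\rho^D,[\cdot,\cdot]_D)$ is a convenient Lie algebroid.
   Context: All spaces, manifolds and bundles are convenient (in the sense of Kriegl-Michor). $M$ is a convenient manifold with kinematic tangent bundle $TM$; $\pi:E\to M$ is a convenient vector bundle, $E'$ its dual bundle (fibrewise bounded dual), and $E^\flat\subset E'$ a weak subbundle: a convenient vector bundle which is a vector subbundle of $E'$ such that the inclusion is an injective convenient bundle morphism. An anchor is a convenient vector bundle morphism to $TM$. $E_U$ is the restriction of $E$ to an open set $U\subset M$ and $\Gamma(E_U)$ its space of smooth sections. A convenient Lie algebroid $(E,M,\rho,[\cdot,\cdot]_E)$ consists of an anchor $\rho:E\to TM$ and, for every open $U\subset M$, a Lie bracket on $\Gamma(E_U)$, compatible with restrictions to open sets, depending only on the $1$-jets of sections, satisfying the Leibniz rule $[r,fs]_E=f[r,s]_E+df(\rho(r))s$, and such that $\rho$ induces Lie algebra morphisms into vector fields. The canonical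 pairing is $\langle\alpha,u\rangle=\alpha(u)$, and on $E^{\mathfrak p}$ one sets $\langle\langle(u,\alpha),(v,\beta)\rangle\rangle=\langle\alpha,v\rangle+\langle\beta,u\rangle$. For a weak closed subbundle $D\subset E^{\mathfrak p}$, $D_x^\perp=\{(v,\beta)\in E_x^{\mathfrak p}:\langle\langle(u,\alpha),(v,\beta)\rangle\rangle=0\ \forall (u,\alpha)\in D_x\}$. $D$ is a partial almost Dirac structure on $E$ if $D_x=D_x^\perp$ for all $x\in M$. For $r,s\in\Gamma(E_U)$, $\alpha,\beta\in\Gamma(E^\flat_U)$: $(L_{\rho(s)}\alpha)(v)=\rho(s)(\alpha(v))-\alpha([s,v]_E)$, $i_s\alpha=\alpha(s)$, and $d$ is the exterior differential of the Lie algebroid $E$ (for a function, $df(v)=\rho(v)f$). The Courant bracket is $$[(r,\alpha),(s,\beta)]_C=\left([r,s]_E,\ L_{\rho(r)}\beta-L_{\rho(s)}\alpha+\tfrac12 d(i_s\alpha-i_r\beta)\right).$$ (In the paper it is a bracket on $\Gamma(E^{\mathfrak p}_U)$; that it takes values in $\Gamma(E_U^{\mathfrak p})$ is established there.) A partial almost Dirac structure $D$ is a partial Dirac structure if it is involutive: for every open $U\subset M$, $\Gamma(D_U)$ is stable under $[\cdot,\cdot]_C$. *)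

(* Defs.v *)
From HB Require Import structures.
From mathcomp Require Import all_boot all_order all_algebra.
From mathcomp Require Import all_classical interval_inference reals topology normedtype convex.

Set Implicit Arguments.
Unset Strict Implicit.
Unset Printing Implicit Defensive.

Import Order.TTheory GRing.Theory Num.Theory.
Import numFieldNormedType.Exports.

Local Open Scope classical_set_scope.
Local Open Scope ring_scope.

(* Only closure under binary unions is needed: it makes the neighbourhoods of
   the topology of uniform convergence on the members of the family directed. *)
Record bornology (U : Type) := Bornology {
  bset : set (set U);
  bset0 : bset set0;
  bsetU : setU_closed bset }.

Section Dual.
Local Open Scope convex_scope.
Context (R : realType) (U : lmodType R) (B : bornology U).

Definition bdual_pred : {pred U -> R^o} := fun f =>
  `[< linear f /\
      forall A, bset B A -> exists C : R, forall x, A x -> `|f x| <= C >].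

Record bdual := Bdual { bdual_fun :> U -> R^o; _ : bdual_fun \in bdual_pred }.

HB.instance Definition _ := [isSub for bdual_fun].
HB.instance Definition _ := [Choice of bdual by <:].

Lemma bdual_predP (f : U -> R^o) : f \in bdual_pred <-> linear f /\
  forall A, bset B A -> exists C : R, forall x, A x -> `|f x| <= C.
Proof. by split=> [/asboolP|?]; [|apply/asboolP]. Qed.

Lemma bdual_submod_closed : submod_closed bdual_pred.
Proof.
split.
  apply/bdual_predP; split=> [a u v|A _]; first by rewrite /= scaler0 addr0.
  by exists 0 => x _; rewrite normr0.
move=> a f g /bdual_predP[lf bf] /bdual_predP[lg bg]; apply/bdual_predP; split.
  move=> b u v; rewrite !fctE /= lf lg !scalerDr !scalerA [b * a]mulrC.
  by rewrite !addrA; congr (_ + _); rewrite -!addrA; congr (_ + _); rewrite addrC.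
move=> A BA; have [C Cf] := bf A BA; have [D Dg] := bg A BA.
exists (`|a| * C + D) => x Ax; rewrite (le_trans (ler_normD _ _))// lerD ?Dg//.
by rewrite normrM ler_wpM2l// Cf.
Qed.

HB.instance Definition _ :=
  GRing.isSubmodClosed.Build R (U -> R^o) bdual_pred bdual_submod_closed.
HB.instance Definition _ := [SubChoice_isSubLmodule of bdual by <:].

Definition bdual_ball (f : bdual) (A : set U) (e : R) : set bdual :=
  [set g | forall x, A x -> `|f x - g x| <= e].

Definition bdual_nbhs (f : bdual) : set_system bdual :=
  [set P | exists A e, [/\ bset B A, 0 < e & bdual_ball f A e `<=` P]].

HB.instance Definition _ := hasNbhs.Build bdual bdual_nbhs.

Let bdual_nbhs_filter (f : bdual) : ProperFilter (nbhs f).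
Proof.
split.
  by move=> [A [e [_ e0]]] /(_ f); apply => x _; rewrite subrr normr0 ltW.
split.
- by exists set0, 1; split=> //; exact: bset0.
- move=> P Q [A [e [BA e0 eP]]] [A' [e' [BA' e'0 eQ]]].
  exists (A `|` A'), (Num.min e e'); split; first exact: bsetU.
    by rewrite lt_min e0.
  move=> g fg; split.
    by apply: eP => x Ax; have := fg x (or_introl Ax); rewrite le_min => /andP[].
  by apply: eQ => x Ax; have := fg x (or_intror Ax); rewrite le_min => /andP[].
- move=> P Q PQ [A [e [BA e0 eP]]]; exists A, e; split=> //.
  exact: subset_trans PQ.
Qed.

Let bdual_nbhs_singleton (f : bdual) (P : set bdual) : nbhs f P -> P f.
Proof.
by move=> [A [e [_ e0]]]; apply => x _; rewrite subrr normr0 ltW.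
Qed.

Let bdual_nbhs_nbhs (f : bdual) (P : set bdual) : nbhs f P -> nbhs f (nbhs^~ P).
Proof.
move=> [A [e [BA e0 eP]]]; exists A, (e / 2); split=> //; first exact: divr_gt0.
move=> g fg; exists A, (e / 2); split=> //; first exact: divr_gt0.
move=> h gh; apply: eP => x Ax.
rewrite -[f x - h x](subrKA (g x)) (splitr e).
by rewrite (le_trans (ler_normD _ _))// lerD ?fg ?gh.
Qed.

HB.instance Definition _ := Nbhs_isNbhsTopological.Build bdual
  bdual_nbhs_filter bdual_nbhs_singleton bdual_nbhs_nbhs.

Lemma bdual_addE (f g : bdual) x : (f + g) x = f x + g x.
Proof. by []. Qed.

Lemma bdual_scaleE a (f : bdual) x : (a *: f) x = a * f x.
Proof. by []. Qed.

Let bdual_add_continuous : continuous (fun x : bdual * bdual => x.1 + x.2).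
Proof.
move=> [/= f g] P [A [e [BA e0 eP]]].
have e20 : 0 < e / 2 by exact: divr_gt0.
exists (bdual_ball f A (e / 2), bdual_ball g A (e / 2)).
  by split; exists A, (e / 2); split.
move=> [f' g'] /= [ff' gg']; apply: eP => x Ax.
rewrite !bdual_addE opprD addrACA (splitr e).
by rewrite (le_trans (ler_normD _ _))// lerD ?ff' ?gg'.
Qed.

Let bdual_scale_continuous : continuous (fun z : R^o * bdual => z.1 *: z.2).
Proof.
move=> [/= a f] P [A [e [BA e0 eP]]].
have [C fC] : exists C : R, forall x, A x -> `|f x| <= C.
  by case: f {eP} => f /= /bdual_predP[_]; exact.
pose C' := `|C| + 1; have C'0 : 0 < C' by rewrite ltr_pwDr.
pose a' := `|a| + 1; have a'0 : 0 < a' by rewrite ltr_pwDr.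
pose d1 := Num.min 1 (e / 2 / C'); pose d2 := e / 2 / a'.
have d10 : 0 < d1 by rewrite lt_min ltr01 !divr_gt0.
have d20 : 0 < d2 by rewrite !divr_gt0.
exists (ball (a : R^o) d1, bdual_ball f A d2).
  by split; [exact: nbhsx_ballx|exists A, d2; split].
move=> [b g] /= [ab fg]; apply: eP => x Ax; rewrite !bdual_scaleE.
have {}ab : `|a - b| < d1 by rewrite -ball_normE in ab.
have -> : a * f x - b * g x = (a - b) * f x + b * (f x - g x).
  by rewrite mulrBl mulrBr addrA subrK.
rewrite (splitr e) (le_trans (ler_normD _ _))// !normrM lerD//.
  rewrite (@le_trans _ _ (d1 * C'))//.
    rewrite ler_pM// ?ltW//.
    by rewrite (le_lt_trans (fC x Ax))// (le_lt_trans (ler_norm C))// ltrDl.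
  by rewrite -ler_pdivlMr// ge_min lexx orbT.
have b1 : `|b| <= a'.
  rewrite -[b](subrK a) (le_trans (ler_normD _ _))// addrC lerD2l.
  by rewrite distrC ltW// (lt_le_trans ab)// ge_min lexx.
by rewrite (le_trans (ler_pM _ _ b1 (fg x Ax)))// mulrC divfK ?gt_eqF.
Qed.

Let bdual_locally_convex : exists2 S : set_system bdual,
  (forall b, b \in S -> convex_set b) & basis S.
Proof.
pose O f A (e : R) : set bdual :=
  [set g | exists2 e', e' < e & bdual_ball f A e' g].
exists [set P | exists f A e, [/\ bset B A, 0 < e & P = O f A e]].
  move=> P; rewrite inE => -[f [A [e [BA e0 ->]]]].
  apply/convex_setW => g h; rewrite !inE => -[e1 e1e fg] [e2 e2e fh] l l0 l1.
  rewrite inE; exists (Num.max e1 e2); first by rewrite gt_max e1e.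
  move=> x Ax.
  have -> : (g <| l |> h : bdual) x = l%:num * g x + (1 - l%:num) * h x by [].
  have -> : f x - (l%:num * g x + (1 - l%:num) * h x) =
      l%:num * (f x - g x) + (1 - l%:num) * (f x - h x).
    rewrite !mulrBr !mulrBl !mul1r opprD opprB; rewrite addrACA.
    by rewrite [l%:num * f x + _]addrC subrK.
  have l0' : 0 <= l%:num := ltW l0.
  have l1' : 0 <= 1 - l%:num by rewrite subr_ge0 ltW.
  rewrite (le_trans (ler_normD _ _))// !normrM (ger0_norm l0') (ger0_norm l1').
  set m := Num.max e1 e2.
  have -> : m = l%:num * m + (1 - l%:num) * m.
    by rewrite -mulrDl addrC subrK mul1r.
  rewrite lerD// ler_wpM2l//.
    by rewrite (le_trans (fg x Ax))// le_max lexx.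
  by rewrite (le_trans (fh x Ax))// le_max lexx orbT.
split.
  move=> P [f [A [e [BA e0 ->]]]]; rewrite openE => g [e' e'e fg].
  have d0 : 0 < (e - e') / 2 by rewrite divr_gt0// subr_gt0.
  exists A, ((e - e') / 2); split=> // h gh; exists (e' + (e - e') / 2).
    by rewrite -ltrBrDl ltr_pdivrMr// ltr_pMr ?subr_gt0// ltr1n.
  move=> x Ax; rewrite -[f x - h x](subrKA (g x)).
  by rewrite (le_trans (ler_normD _ _))// lerD ?fg ?gh.
move=> f P [A [e [BA e0 eP]]]; exists (O f A e).
  split; first by exists f, A, e.
  by exists 0 => // x _; rewrite subrr normr0.
move=> g [e' e'e fg]; apply: eP => x Ax.
by rewrite (le_trans (fg x Ax))// ltW.
Qed.

HB.instance Definition _ := PreTopologicalLmod_isTvs.Build R bdual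
  bdual_add_continuous bdual_scale_continuous bdual_locally_convex.
HB.instance Definition _ :=
  PreTopologicalNmodule_isTopologicalNmodule.Build bdual bdual_add_continuous.
HB.instance Definition _ := TopologicalNmodule_isTopologicalLmodule.Build R
  bdual bdual_scale_continuous.
HB.instance Definition _ := Uniform_isTvs.Build R bdual bdual_locally_convex.

End Dual.

Section Calculus.
Context (R : realType).
Implicit Types V W : tvsType R.

Definition tvs_bounded V (A : set V) :=
  forall N, nbhs (0 : V) N -> \forall r \near +oo_R, A `<=` *:%R r @` N.

Lemma tvs_bounded0 V : tvs_bounded (set0 : set V).
Proof. by move=> N _; apply: nearW => r. Qed.

Lemma tvs_boundedU V : setU_closed (@tvs_bounded V).
Proof.
move=> A B bA bB N N0; have := bA N N0; have := bB N N0.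
by apply: filterS2 => r rB rA x [/rA|/rB].
Qed.

Definition tvs_bornology V := Bornology (@tvs_bounded0 V) (@tvs_boundedU V).

Definition dual V : tvsType R := bdual (tvs_bornology V).

(* Mackey completeness is the form of c^infty-completeness adopted here. *)
Definition mackey_cauchy V (u : nat -> V) :=
  exists (B : set V) (mu : nat -> nat -> R), [/\ tvs_bounded B,
    forall e, 0 < e -> exists N, forall n m, (N <= n)%N -> (N <= m)%N ->
      `|mu n m| < e &
    forall n m, exists2 b, B b & u n - u m = mu n m *: b].

Definition convenient V := hausdorff_space V /\
  forall u : nat -> V, mackey_cauchy u -> exists l : V, u n @[n --> \oo] --> l.

Definition smooth_curve V (c : R -> V) := exists d : nat -> R -> V, d 0%N = c /\
  forall n t, h^-1 *: (d n (t + h) - d n t) @[h --> (0 : R)^'] --> d n.+1 t.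

Definition cinfty_open V (U : set V) :=
  forall c : R -> V, smooth_curve c -> open (c @^-1` U).

Definition smooth_on V W (U : set V) (f : V -> W) :=
  forall c : R -> V, smooth_curve c -> (forall t, U (c t)) ->
  smooth_curve (f \o c).

(* The directional derivative [df(a)v]; the library's ['D_v f a] is restricted
   to normed modules. *)
Definition ddir V W (f : V -> W) (a v : V) : W :=
  xget 0 [set l | h^-1 *: (f (a + h *: v) - f a) @[h --> (0 : R)^'] --> l].

End Calculus.

Record premanifold (R : realType) := Premanifold {
  mpoint :> Type;
  mindex : Type;
  model : mindex -> tvsType R;
  mdom : mindex -> set mpoint;
  chart : forall i, mpoint -> model i;
  param : forall i, model i -> mpoint;
  chart_at : mpoint -> mindex }.
Arguments chart {R p}.
Arguments param {R p}.
Arguments model {R p}.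
Arguments mdom {R p}.
Arguments chart_at {R p}.

(* The natural topology of a convenient manifold, in which charts are
   homeomorphisms for the c^infty-topology of the model spaces. *)
Definition mopen (R : realType) (M : premanifold R) (U : set M) :=
  forall i, cinfty_open (chart i @` (U `&` mdom i)).

Record manifold (R : realType) := Manifold {
  premanifold_of :> premanifold R;
  model_convenient : forall i : mindex premanifold_of, convenient (model i);
  mdom_chart_at : forall x : premanifold_of, mdom (chart_at x) x;
  chartK : forall (i : mindex premanifold_of) x, mdom i x ->
    param i (chart i x) = x;
  chart_open : forall i j : mindex premanifold_of,
    cinfty_open (chart i @` (mdom i `&` mdom j));
  chart_smooth : forall i j : mindex premanifold_of,
    smooth_on (chart i @` (mdom i `&` mdom j)) (chart j \o param i);
  mhausdorff : forall x y : premanifold_of, x <> y ->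
    exists U V : set premanifold_of,
      [/\ mopen U, mopen V, U x, V y & U `&` V = set0] }.

Section Smooth.
Context (R : realType) (M : manifold R).

Definition msmooth (V : tvsType R) (U : set M) (f : M -> V) :=
  forall i, smooth_on (chart i @` (U `&` mdom i)) (f \o param i).

Definition msmooth2 (V W : tvsType R) (U : set M) (f : M -> V -> W) :=
  forall i, smooth_on ((chart i @` (U `&` mdom i)) `*` [set: V])
    (fun p => f (param i p.1) p.2).

End Smooth.

(* [untriv i x] is the inverse of [triv i x] for [x] in [vdom i]. The typical
   fibre may depend on the chart, as it does for the tangent bundle when the
   manifold is modelled on several spaces. *)
Record bundle_data (R : realType) (M : manifold R) := BundleData {
  fibre :> M -> lmodType R;
  vindex : Type;
  vfib : vindex -> tvsType R;
  vdom : vindex -> set M;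
  triv : forall i x, fibre x -> vfib i;
  untriv : forall i x, vfib i -> fibre x }.
Arguments vfib {R M}.
Arguments vdom {R M}.
Arguments triv {R M}.
Arguments untriv {R M}.

Section Bundles.
Context (R : realType) (M : manifold R).
Implicit Types E F G : bundle_data M.

Record is_vbundle E : Prop := IsVbundle {
  vfib_convenient : forall i, convenient (vfib E i);
  vdom_open : forall i, mopen (vdom E i);
  vdom_cover : forall x, exists i, vdom E i x;
  triv_linear : forall i x, vdom E i x -> linear (triv E i x);
  trivK : forall i x, vdom E i x -> cancel (triv E i x) (untriv E i x);
  untrivK : forall i x, vdom E i x -> cancel (untriv E i x) (triv E i x);
  triv_smooth : forall i j, msmooth2 (vdom E i `&` vdom E j)
    (fun x v => triv E j x (untriv E i x v)) }.

Definition is_morphism F G (f : forall x, F x -> G x) :=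
  (forall x, linear (f x)) /\
  forall i j, msmooth2 (vdom F i `&` vdom G j)
    (fun x v => triv G j x (f x (untriv F i x v))).

Definition is_weak_subbundle F G (f : forall x, F x -> G x) :=
  [/\ is_vbundle F, is_morphism f & forall x, injective (f x)].

(* A local section over [U] is represented by any global family of vectors that
   restricts to it; its values outside [U] are irrelevant. *)
Definition section E := forall x, E x.

Definition smooth_section E (U : set M) (s : section E) :=
  forall i, msmooth (U `&` vdom E i) (fun x => triv E i x (s x)).

Definition same_jet1 E (x : M) (s s' : section E) :=
  s x = s' x /\ forall i, vdom E i x -> forall v : model (chart_at x),
    let inchart (r : section E) y :=
      triv E i (param (chart_at x) y) (r (param (chart_at x) y)) in
    ddir (inchart s) (chart (chart_at x) x) v =
    ddir (inchart s') (chart (chart_at x) x) v.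

(* [T_x M] is identified with the model space of the chart [chart_at x]. *)
Definition tangent : bundle_data M := @BundleData R M
  (fun x => model (chart_at x) : lmodType R) (mindex M) model mdom
  (fun i x => ddir (chart i \o param (chart_at x)) (chart (chart_at x) x))
  (fun i x => ddir (chart (chart_at x) \o param i) (chart i x)).

Definition vder (f : M -> R^o) (x : M) (X : tangent x) : R :=
  ddir (f \o param (chart_at x)) (chart (chart_at x) x) X.

(* [Z] is the Lie bracket of [X] and [Y] on [U]: a kinematic tangent vector is
   determined by its action on locally defined smooth functions. *)
Definition is_vfield_bracket (U : set M) (X Y Z : section tangent) :=
  forall V (f : M -> R^o), mopen V -> V `<=` U -> msmooth V f ->
  forall x, V x -> vder f (Z x) =
    vder (fun y => vder f (Y y)) (X x) - vder (fun y => vder f (X y)) (Y x).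

Definition fibre_bounded E (x : M) (A : set (E x)) :=
  forall i, vdom E i x -> tvs_bounded (triv E i x @` A).

Lemma fibre_bounded0 E x : fibre_bounded (set0 : set (E x)).
Proof. by move=> i _; rewrite image_set0; exact: tvs_bounded0. Qed.

Lemma fibre_boundedU E x : setU_closed (@fibre_bounded E x).
Proof.
move=> A B bA bB i ix; rewrite image_setU.
by apply: tvs_boundedU; [exact: bA|exact: bB].
Qed.

Definition fibre_bornology E x :=
  Bornology (@fibre_bounded0 E x) (@fibre_boundedU E x).

(* In a vector bundle, transposition by [triv] or [untriv] over [vdom i] always
   yields a bounded linear functional, so that the default value [0] of
   [insubd] is not used there. *)
Definition dual_bundle E : bundle_data M := @BundleData R M
  (fun x => bdual (fibre_bornology E x) : lmodType R) (vindex E)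
  (fun i => dual (vfib E i)) (vdom E)
  (fun i x (a : bdual (fibre_bornology E x)) =>
     insubd (0 : bdual (tvs_bornology (vfib E i)))
       ((a : E x -> R^o) \o untriv E i x))
  (fun i x (l : bdual (tvs_bornology (vfib E i))) =>
     insubd (0 : bdual (fibre_bornology E x))
       ((l : vfib E i -> R^o) \o triv E i x)).

Definition whitney_sum E F : bundle_data M := @BundleData R M
  (fun x => (E x * F x)%type : lmodType R) (vindex E * vindex F)%type
  (fun i => (vfib E i.1 * vfib F i.2)%type : tvsType R)
  (fun i => vdom E i.1 `&` vdom F i.2)
  (fun i x p => (triv E i.1 x p.1, triv F i.2 x p.2))
  (fun i x p => (untriv E i.1 x p.1, untriv F i.2 x p.2)).

(* Closed fibres, for the c^infty-topology. *)
Definition is_weak_closed_subbundle F G (f : forall x, F x -> G x) :=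
  is_weak_subbundle f /\ forall x i, vdom G i x ->
    cinfty_open (~` (triv G i x @` range (f x))).

Definition is_anchor E (rho : forall x, E x -> tangent x) := is_morphism rho.

(* [br U r s] is the bracket of the local sections [r] and [s] over [U]. *)
Definition section_bracket E := set M -> section E -> section E -> section E.

Record is_lie_algebroid E (rho : forall x, E x -> tangent x)
    (br : section_bracket E) : Prop := IsLieAlgebroid {
  algebroid_vbundle : is_vbundle E;
  algebroid_anchor : is_anchor rho;
  bracket_smooth : forall U r s, mopen U ->
    smooth_section U r -> smooth_section U s -> smooth_section U (br U r s);
  bracket_linear : forall U a r r' s, mopen U ->
    smooth_section U r -> smooth_section U r' -> smooth_section U s ->
    forall x, U x ->
    br U (fun y => a *: r y + r' y) s x = a *: br U r s x + br U r' s x;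
  bracket_antisym : forall U r s, mopen U ->
    smooth_section U r -> smooth_section U s ->
    forall x, U x -> br U r s x = - br U s r x;
  bracket_jacobi : forall U r s t, mopen U ->
    smooth_section U r -> smooth_section U s -> smooth_section U t ->
    forall x, U x ->
    br U r (br U s t) x + br U s (br U t r) x + br U t (br U r s) x = 0;
  bracket_restrict : forall U V r s, mopen U -> mopen V -> V `<=` U ->
    smooth_section U r -> smooth_section U s ->
    forall x, V x -> br V r s x = br U r s x;
  bracket_jet1 : forall U r r' s s', mopen U ->
    smooth_section U r -> smooth_section U r' ->
    smooth_section U s -> smooth_section U s' ->
    forall x, U x -> same_jet1 x r r' -> same_jet1 x s s' ->
    br U r s x = br U r' s' x;
  bracket_leibniz : forall U (f : M -> R^o) r s, mopen U -> msmooth U f ->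
    smooth_section U r -> smooth_section U s ->
    forall x, U x -> br U r (fun y => f y *: s y) x =
      f x *: br U r s x + vder f (rho x (r x)) *: s x;
  bracket_anchor : forall U r s, mopen U ->
    smooth_section U r -> smooth_section U s ->
    is_vfield_bracket U (fun x => rho x (r x)) (fun x => rho x (s x))
      (fun x => rho x (br U r s x)) }.

Section Courant.
Context (E : bundle_data M) (rho : forall x, E x -> tangent x)
  (br : section_bracket E) (F : bundle_data M)
  (iota : forall x, F x -> dual_bundle E x).

Definition pairing (x : M) (a : F x) (u : E x) : R :=
  (iota a : bdual (fibre_bornology E x)) u.

Definition sym_pairing (x : M) (p q : whitney_sum E F x) : R :=
  pairing p.2 q.1 + pairing q.2 p.1.

Definition lie_derivative (V : set M) (s : section E) (a : section F)
    (v : section E) (x : M) : R :=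
  vder (fun y => pairing (a y) (v y)) (rho (s x)) -
  pairing (a x) (br V s v x).

(* [e] is the Courant bracket of [e1] and [e2] on [U]. The cotangent component
   of the bracket is given by its values on local sections [v] of [E], and [e]
   is thereby uniquely determined on [U]. *)
Definition is_courant_bracket (U : set M)
    (e1 e2 e : section (whitney_sum E F)) :=
  let r x := (e1 x).1 in let a x := (e1 x).2 in
  let s x := (e2 x).1 in let b x := (e2 x).2 in
  (forall x, U x -> (e x).1 = br U r s x) /\
  forall V v, mopen V -> V `<=` U -> smooth_section V v ->
  forall x, V x -> pairing (e x).2 (v x) =
    lie_derivative V r b v x - lie_derivative V s a v x +
    2^-1 * vder (fun y => pairing (a y) (s y) - pairing (b y) (r y))
             (rho (v x)).

Context (D : bundle_data M) (kappa : forall x, D x -> whitney_sum E F x).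

Definition orthogonal (x : M) : set (whitney_sum E F x) :=
  [set p | forall d : D x, sym_pairing (kappa d) p = 0].

Definition is_partial_almost_dirac :=
  is_weak_closed_subbundle kappa /\ forall x, range (@kappa x) = @orthogonal x.

Definition involutive := forall U e1 e2, mopen U ->
  smooth_section U e1 -> smooth_section U e2 ->
  exists2 e : section D, smooth_section U e &
    is_courant_bracket U (fun x => kappa (e1 x)) (fun x => kappa (e2 x))
      (fun x => kappa (e x)).

Definition is_partial_dirac := is_partial_almost_dirac /\ involutive.

Definition dirac_anchor (x : M) (d : D x) : tangent x := rho (kappa d).1.

Definition restricts_courant (brD : section_bracket D) :=
  forall U e1 e2, mopen U -> smooth_section U e1 -> smooth_section U e2 ->
  is_courant_bracket U (fun x => kappa (e1 x)) (fun x => kappa (e2 x))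
    (fun x => kappa (brD U e1 e2 x)).

End Courant.

End Bundles.

(* Main.v *)
Require Import Defs.
From mathcomp Require Import all_boot all_order all_algebra.
From mathcomp Require Import all_classical reals topology normedtype.
From mathcomp Require Import interval_inference convex sequences derive exp.
From mathcomp Require Import ring lra.

Set Implicit Arguments.
Unset Strict Implicit.
Unset Printing Implicit Defensive.

Import Order.TTheory GRing.Theory Num.Theory.
Import numFieldNormedType.Exports.

Local Open Scope classical_set_scope.
Local Open Scope ring_scope.

(** The Courant bracket of two sections of an involutive [D] is determined by
    its component in [E] and by the values of its component in the dual on local
    sections of [E], because [kappa] and [iota] are injective. Isotropy of [D]
    gives [<a,s> = - <b,r>], so the second component of [[(r,a),(s,b)]] is
    [L_r b - L_s a + d <a,s>]; the Leibniz rule is then immediate, and the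
    Jacobiator evaluated on [v] is the derivative along [v] of the cyclic sum of
    [<[e1,e2],e3>], which vanishes since [D] is both involutive and isotropic.

    The analytic content is that all the functions involved are smooth and that
    [df(rho u)] is linear in [u] and smooth along sections. The general chain
    rule of convenient calculus is avoided: the last two facts are read off the
    Leibniz rule of [E] itself. What remains is the calculus of smooth curves:
    evaluation of functionals, Hadamard's lemma (which shows that the bracket
    depends only on 1-jets), and the boundedness of linear maps preserving smooth
    curves (which makes the trivializations of the dual bundle meaningful). *)

(** * Continuous seminorms and derivatives of curves *)

(** Smoothness is tested on smooth curves defined on the whole line, so every analytic claim becomes
    one about curves [R -> V]. Higher derivatives are hardly ever computed: a class of curves stable
    under differentiation consists of smooth curves ([smooth_in_coind]), and a calculus rule mostly
    amounts to choosing such a class. Two obstacles shape the rest. Charts and trivializations are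
    local while test curves are global, whence the reparametrization of an interval by a
    diffeomorphism with the line. And the functionals in the dual are only assumed bounded, whence
    second order remainders where a continuous functional would need first order ones. On the
    algebraic side the algebroid structure is established for any smooth bracket restricting the
    Courant bracket. Involutivity supplies such a bracket by independent choices on each open set,
    and it is uniqueness that makes these choices coherent. *)

Section Seminorms.
Context (R : realType).
Implicit Types V W : tvsType R.

(* [csn] stands for continuous seminorm. *)
Definition csn V (p : V -> R) :=
  [/\ forall x y, p (x + y) <= p x + p y,
      forall a x, p (a *: x) = `|a| * p x &
      nbhs (0 : V) [set x | p x < 1]].

Section Basics.
Context V (p : V -> R) (hp : csn p).

Lemma csnD x y : p (x + y) <= p x + p y. Proof. by case: hp. Qed.
Lemma csnZ a x : p (a *: x) = `|a| * p x. Proof. by case: hp. Qed.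
Lemma csn0 : p 0 = 0. Proof. by rewrite -(scale0r (0 : V)) csnZ normr0 mul0r. Qed.
Lemma csnN x : p (- x) = p x.
Proof. by rewrite -scaleN1r csnZ normrN1 mul1r. Qed.
Lemma csn_ge0 x : 0 <= p x.
Proof. by have := csnD x (- x); rewrite subrr csn0 csnN; lra. Qed.
Lemma csnBC x y : p (x - y) = p (y - x).
Proof. by rewrite -csnN opprB. Qed.
Lemma csn_tri z x y : p (x - y) <= p (x - z) + p (z - y).
Proof. by rewrite -[x - y](subrKA z) csnD. Qed.

Lemma csn_nbhs (l : V) e : 0 < e -> nbhs l [set x | p (x - l) < e].
Proof.
move=> e0; have [_ _ N0] := hp.
have := @nbhsB _ V _ 0 l (nbhs0Z (lt0r_neq0 e0) N0); rewrite addr0.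
apply: filterS => _ [_ [x /= px] <-] <-.
by rewrite /= addrAC subrr add0r csnZ gtr0_norm// gtr_pMr.
Qed.
End Basics.

Lemma csnM V (p : V -> R) c : csn p -> 0 < c -> csn (fun x => c * p x).
Proof.
move=> hp c0; split.
- by move=> x y; rewrite -mulrDr ler_pM2l// csnD.
- by move=> a x; rewrite (csnZ hp) mulrCA.
- have := @csn_nbhs _ _ hp 0 c^-1; rewrite invr_gt0 => /(_ c0).
  by apply: filterS => x /=; rewrite subr0 -ltr_pdivlMl// mulr1.
Qed.

(** A convex basic neighbourhood intersected with its reflection is symmetric and still convex; the
    gauge of such a set is a seminorm. *)
Lemma convex_nbhs V (N : set V) : nbhs 0 N -> exists K : set V,
  [/\ nbhs 0 K, K `<=` N, K 0, forall x, K x -> K (- x) &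
      forall x y (l : R), K x -> K y -> 0 <= l <= 1 -> K (l *: x + (1 - l) *: y)].
Proof.
move=> N0; have [B Bc [Bo Bb]] := @locally_convex R V.
have [b [Bb' b0] bN] := Bb 0 N N0.
have cb : forall x y (l : R), b x -> b y -> 0 <= l <= 1 -> b (l *: x + (1 - l) *: y).
  move=> x y l bx byy /andP[l0 l1].
  exact: set_mem (Bc b (mem_set Bb') x y (Itv01 l0 l1) (mem_set bx) (mem_set byy)).
have nb : nbhs 0 b by apply: open_nbhs_nbhs; split => //; exact: Bo.
exists (b `&` [set x | b (- x)]); split.
- apply: filterI => //; have := @nbhs0N _ V _ nb.
  by apply: filterS => _ [x bx <-]; rewrite /= opprK.
- by move=> x [/bN].
- by split => //=; rewrite oppr0.
- by move=> x [/= bx bNx]; split => //=; rewrite opprK.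
- move=> x y l [/= bx bNx] [/= byy bNy] hl; split=> /=; first exact: cb.
  by rewrite opprD -!scalerN; exact: cb.
Qed.

(** The seminorm is the Minkowski gauge of an absolutely convex neighbourhood [K] inside [N]: [S x]
    collects the scales [r] for which [x] lies in [r K], it is nonempty by continuity of scaling at
    [(0, x)], and [p x] is its infimum. *)
Lemma csn_exists V (N : set V) : nbhs 0 N ->
  exists2 p, csn p & forall x, p x < 1 -> N x.
Proof.
move=> /convex_nbhs[K [K0 KN K00 KO Kc]].
pose S (x : V) : set R := [set r | 0 < r /\ K (r^-1 *: x)].
have Kz x a : K x -> 0 <= a <= 1 -> K (a *: x).
  by move=> Kx ha; have := Kc x 0 a Kx K00 ha; rewrite scaler0 addr0.
have Sup x r r' : S x r -> r <= r' -> S x r'.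
  move=> [r0 Kr] rr'; have r'0 : 0 < r' by exact: lt_le_trans rr'.
  split => //; have -> : r'^-1 *: x = (r / r') *: (r^-1 *: x).
    by rewrite scalerA mulrAC divff ?gt_eqF// mul1r.
  apply: Kz => //; apply/andP; split; first by rewrite divr_ge0 ?ltW.
  by rewrite ler_pdivrMr// mul1r.
have Sex x : exists r, S x r.
  have := @scale_continuous R V (0, x) K; rewrite /= scale0r => /(_ K0).
  move=> [[/= A B] [A0 Bx] AB].
  have [/= e /= e0 Ae] := A0.
  exists (2 / e); split; first by rewrite divr_gt0.
  apply: (AB ((2 / e)^-1, x)); split => /=; last exact: nbhs_singleton.
  apply: Ae => /=; rewrite sub0r normrN gtr0_norm ?invf_div ?divr_gt0//.
  by rewrite ltr_pdivrMr// ltr_pMr// ltr1n.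
have Slb x : has_inf (S x).
  by split; [exact: Sex|exists 0 => r [/ltW]].
pose p x := inf (S x).
have pS x r : p x < r -> S x r.
  move=> pr; have [s Ss sr] := inf_lt (Sex x) pr.
  exact: Sup Ss (ltW sr).
have Sp x r : S x r -> p x <= r.
  by move=> Sr; apply: ge_inf => //; case: (Slb x).
have p0 x : 0 <= p x by apply: lb_le_inf => [|r [/ltW]].
exists p; last first.
  by move=> x /pS[_]; rewrite invr1 scale1r => /KN.
(* One inequality is enough: applied to [a^-1] and [a *: x] it gives the other one. *)
have pz a x : 0 < `|a| -> p (a *: x) <= `|a| * p x.
  move=> a0; apply/ler_addgt0Pr => e e0; apply: Sp.
  have [r0 Kr] : S x (p x + e / `|a|) by apply: pS; rewrite ltrDl divr_gt0.
  have -> : `|a| * p x + e = `|a| * (p x + e / `|a|).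
    by rewrite mulrDr mulrCA divff ?gt_eqF// mulr1.
  split; first exact: mulr_gt0.
  move: (p x + _) r0 Kr => r r0 Kr.
  rewrite invfM scalerA mulrAC mulrC -scalerA.
  have [a_0|a_0] := ltP 0 a.
    by rewrite gtr0_norm// mulVf ?gt_eqF// scale1r.
  have a_n : a < 0 by rewrite lt_neqAle a_0 andbT -normr_gt0.
  by rewrite ltr0_norm// invrN mulNr mulVf ?lt_eqF// scaleN1r scalerN; exact: KO.
split.
- move=> x y; apply/ler_addgt0Pr => e e0; apply: Sp.
  have e20 : 0 < e / 2 by rewrite divr_gt0.
  have [r0 Kr] : S x (p x + e / 2) by apply: pS; rewrite ltrDl.
  have [s0 Ks] : S y (p y + e / 2) by apply: pS; rewrite ltrDl.
  have -> : p x + p y + e = (p x + e / 2) + (p y + e / 2) by lra.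
  set r := p x + _ in r0 Kr *; set s := p y + _ in s0 Ks *.
  have rs0 : 0 < r + s by exact: addr_gt0.
  split => //; have -> : (r + s)^-1 *: (x + y) =
     (r / (r + s)) *: (r^-1 *: x) + (1 - r / (r + s)) *: (s^-1 *: y).
    have -> : 1 - r / (r + s) = s / (r + s).
      by rewrite -[X in X - _](divff (lt0r_neq0 rs0)) -mulrBl addrAC subrr add0r.
    by rewrite !scalerA scalerDr; congr (_ *: _ + _ *: _); field; rewrite !gt_eqF.
  apply: Kc => //; apply/andP; split; first by rewrite divr_ge0 ?ltW.
  by rewrite ler_pdivrMr// mul1r lerDl ltW.
- move=> a x; have [->|a0] := eqVneq a 0.
    rewrite scale0r normr0 mul0r; apply/le_anti; rewrite p0 andbT.
    apply/ler_addgt0Pr => e e0; rewrite add0r; apply: Sp; split => //.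
    by rewrite scaler0.
  apply/le_anti; rewrite pz ?normr_gt0//=.
  have := @pz a^-1 (a *: x); rewrite normfV invr_gt0 normr_gt0 => /(_ a0).
  by rewrite scalerA mulVf// scale1r ler_pdivlMl ?normr_gt0.
- have h : 2^-1 != 0 :> R by rewrite invr_eq0.
  apply: filterS (nbhs0Z h K0) => _ [x Kx <-] /=.
  apply: (@le_lt_trans _ _ 2^-1); last by lra.
  by apply: Sp; split => //; rewrite invrK scalerA divff// scale1r.
Qed.

Lemma csn_cvgP V T (F : set_system T) (FF : Filter F) (f : T -> V) (l : V) :
  f @ F --> l <-> forall p, csn p -> forall e : R, 0 < e ->
    F [set t | p (f t - l) < e].
Proof.
split=> [fl p hp e e0|H N].
  by have := fl _ (csn_nbhs hp l e0).
rewrite nbhs_filterE => Nl; have := @nbhsB _ V _ l (- l) Nl; rewrite addNr.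
move=> /csn_exists[p hp pN].
have := H p hp 1 ltr01; apply: (@filterS _ F) => t /= /pN[x Nx].
by rewrite addrC => /addIr <-.
Qed.

Lemma csn_eq0 V (x : V) : hausdorff_space V ->
  (forall p, csn p -> p x = 0) -> x = 0.
Proof.
move=> hV H; apply/esym/hV => A B A0 Bx.
have := @nbhsB _ V _ x (- x) Bx; rewrite addNr.
move=> /(filterI A0) /csn_exists[p hp pN].
have [|Ax [y By]] := pN 0; first by rewrite (csn0 hp).
rewrite addrC => /eqP; rewrite subr_eq0 => /eqP xy.
have [q hq qB] := csn_exists A0.
exists x; split; last exact: nbhs_singleton.
by apply: qB; rewrite H.
Qed.

Lemma csn_boundedP V (A : set V) : tvs_bounded A <->
  forall p, csn p -> exists C, forall x, A x -> p x <= C.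
Proof.
split=> [bA p hp|H N N0].
  have [_ _ p1] := hp; have [C [Cr HC]] := bA _ p1.
  pose D := Num.max 1 (C + 1); exists D => x Ax.
  have CD : C < D by rewrite lt_max ltrDl ltr01 orbT.
  have D0 : 0 < D by rewrite lt_max ltr01.
  have [y /= py <-] := HC _ CD x Ax.
  by rewrite (csnZ hp) gtr0_norm// ger_pMr// ltW.
have [p hp pN] := csn_exists N0; have [C HC] := H p hp.
exists (Num.max 1 (C + 1)); split; first exact: num_real.
move=> r; rewrite gt_max => /andP[r1 rC] x Ax.
have r0 : 0 < r by exact: lt_trans r1.
exists (r^-1 *: x); last by rewrite scalerA divff ?gt_eqF// scale1r.
apply: pN; rewrite (csnZ hp) gtr0_norm ?invr_gt0// ltr_pdivrMl// mulr1.
by rewrite (le_lt_trans (HC x Ax))// (lt_trans _ rC)// ltrDl.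
Qed.

(** The difference quotient is multiplied out by [h], so that [h = 0] is allowed and remainders can
    be added and estimated without division; [deriv_atP] is the link with the limit. *)
Definition deriv_at V (c : R -> V) (t : R) (l : V) :=
  forall p, csn p -> forall e : R, 0 < e -> exists2 d : R, 0 < d &
    forall h, `|h| < d -> p (c (t + h) - c t - h *: l) <= e * `|h|.

Lemma deriv_atP V (c : R -> V) (t : R) (l : V) :
  h^-1 *: (c (t + h) - c t) @[h --> (0 : R)^'] --> l <-> deriv_at c t l.
Proof.
rewrite csn_cvgP; split=> H p hp e e0.
  have [d /= d0 Hd] := H p hp e e0; exists d => // h hd.
  have [->|h0] := eqVneq h 0.
    by rewrite addr0 subrr scale0r subrr (csn0 hp) normr0 mulr0.
  have /= := Hd h; rewrite sub0r normrN => /(_ hd h0) /ltW.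
  rewrite -(ler_pM2r (_ : 0 < `|h|)) ?normr_gt0// mulrC -(csnZ hp).
  by rewrite scalerBr scalerA divff// scale1r.
have [d d0 Hd] := H p hp (e / 2) (divr_gt0 e0 (ltr0Sn _ 1)).
exists d => // h /=; rewrite sub0r normrN => /Hd Hh h0.
rewrite -(ltr_pM2r (_ : 0 < `|h|)) ?normr_gt0// mulrC -(csnZ hp).
rewrite scalerBr scalerA divff// scale1r; apply: (le_lt_trans Hh).
by rewrite ltr_pM2r ?normr_gt0// ltr_pdivrMr// ltr_pMr// ltr1n.
Qed.

Section DerivBasics.
Context V.
Implicit Types (c : R -> V) (l : V).

Lemma deriv_at_unique c t l l' : hausdorff_space V ->
  deriv_at c t l -> deriv_at c t l' -> l = l'.
Proof.
move=> hV H H'; apply/eqP; rewrite -subr_eq0; apply/eqP/csn_eq0 => // p hp.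
apply/le_anti; rewrite csn_ge0// andbT; apply/ler_addgt0Pr => e e0; rewrite add0r.
have e20 : 0 < e / 2 by rewrite divr_gt0.
have [d d0 Hd] := H p hp _ e20; have [d' d'0 Hd'] := H' p hp _ e20.
pose m := Num.min d d'; have m0 : 0 < m by rewrite lt_min d0.
have h0 : 0 < m / 2 by rewrite divr_gt0.
have hm : `|m / 2| < m by rewrite gtr0_norm//; lra.
have /Hd h1 : `|m / 2| < d by apply: lt_le_trans hm _; rewrite ge_min lexx.
have /Hd' h2 : `|m / 2| < d' by apply: lt_le_trans hm _; rewrite ge_min lexx orbT.
rewrite -(ler_pM2l h0) -[X in X * p _]gtr0_norm// -(csnZ hp) scalerBr.
have := csn_tri hp (c (t + m / 2) - c t) (m / 2 *: l) (m / 2 *: l').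
by move: h1 h2; rewrite (csnBC hp _ (c (t + m / 2) - c t)) !gtr0_norm//; lra.
Qed.

Lemma deriv_at_near c c' t l : (exists2 e : R, 0 < e & forall h, `|h| < e ->
  c (t + h) = c' (t + h)) -> deriv_at c t l -> deriv_at c' t l.
Proof.
move=> [r r0 cc'] H p hp e e0; have [d d0 Hd] := H p hp e e0.
exists (Num.min d r); first by rewrite lt_min d0.
move=> h; rewrite lt_min => /andP[/Hd Hh /cc' <-].
by have := cc' 0; rewrite normr0 => /(_ r0); rewrite !addr0 => <-.
Qed.

Lemma deriv_at_cst l t : deriv_at (fun=> l) t 0.
Proof.
move=> p hp e e0; exists 1 => // h _.
by rewrite subrr sub0r scaler0 oppr0 (csn0 hp) mulr_ge0// ltW.
Qed.

Lemma deriv_atD c c' t l l' : deriv_at c t l -> deriv_at c' t l' ->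
  deriv_at (fun s => c s + c' s) t (l + l').
Proof.
move=> H H' p hp e e0; have e20 : 0 < e / 2 by rewrite divr_gt0.
have [d d0 Hd] := H p hp _ e20; have [d' d'0 Hd'] := H' p hp _ e20.
exists (Num.min d d'); first by rewrite lt_min d0.
move=> h; rewrite lt_min => /andP[/Hd h1 /Hd' h2].
rewrite scalerDr !opprD (addrACA (c _)) (addrACA (_ - _)).
by rewrite (le_trans (csnD hp _ _))// [e]splitr mulrDl lerD.
Qed.

Lemma deriv_at_bounded_op W (T : V -> W) c t l :
  (forall v w, T (v - w) = T v - T w) -> (forall a v, T (a *: v) = a *: T v) ->
  (forall q, csn q -> exists2 p, csn p & forall v, q (T v) <= p v) ->
  deriv_at c t l -> deriv_at (T \o c) t (T l).
Proof.
move=> TB TZ Tc H q hq e e0; have [p hp qp] := Tc q hq.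
have [d d0 Hd] := H p hp e e0; exists d => // h hd.
by rewrite /= -TB -TZ -TB (le_trans (qp _))// Hd.
Qed.

Lemma deriv_atZ a c t l : deriv_at c t l -> deriv_at (fun s => a *: c s) t (a *: l).
Proof.
apply: (@deriv_at_bounded_op V (fun v => a *: v)).
- by move=> v w; rewrite scalerBr.
- by move=> b v; rewrite !scalerA mulrC.
move=> q hq; exists (fun v => (`|a| + 1) * q v); first by apply: csnM; rewrite ?ltr_pwDr.
by move=> v; rewrite (csnZ hq) ler_wpM2r ?csn_ge0// lerDl.
Qed.

Lemma deriv_at_continuous c t l p : deriv_at c t l -> csn p ->
  forall e : R, 0 < e -> exists2 d : R, 0 < d & forall h, `|h| < d -> p (c (t + h) - c t) <= e.
Proof.
move=> H hp e e0; have [d d0 Hd] := H p hp 1 ltr01.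
pose C := 1 + p l; have C0 : 0 < C by rewrite ltr_pwDl ?csn_ge0.
exists (Num.min d (e / C)); first by rewrite lt_min d0 divr_gt0.
move=> h; rewrite lt_min => /andP[/Hd h1 h2].
have := csnD hp (c (t + h) - c t - h *: l) (h *: l).
rewrite subrK (csnZ hp) => h3; apply: (le_trans h3).
have : `|h| * C <= e by rewrite -ler_pdivlMr// ltW.
by rewrite /C mulrDr mulr1 => ?; lra.
Qed.

End DerivBasics.

End Seminorms.

(** * Smooth curves *)

Section SmoothCurves.
Context (R : realType).
Implicit Types V W Z : tvsType R.

Lemma csn_norm : csn (fun x : R^o => `|x| : R).
Proof.
split; [exact: ler_normD|by move=> a x; rewrite normrM|].
by exists 1 => //= x /=; rewrite sub0r normrN.
Qed.

Lemma csn_real (p : R^o -> R) : csn p -> forall x : R^o, p x = `|x| * p 1.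
Proof. by move=> hp x; rewrite -(csnZ hp) [x *: 1]mulr1. Qed.

Lemma deriv_at_real (c : R -> R^o) t (l : R^o) :
  (forall e : R, 0 < e -> exists2 d : R, 0 < d &
    forall h, `|h| < d -> `|c (t + h) - c t - h * l| <= e * `|h|) ->
  deriv_at c t l.
Proof.
move=> H p hp e e0; pose C := p 1 + 1.
have C0 : 0 < C by rewrite ltr_wpDl ?csn_ge0.
have [d d0 Hd] := H (e / C) (divr_gt0 e0 C0); exists d => // h /Hd h1.
rewrite (csn_real hp) (le_trans (_ : _ <= e / C * `|h| * C))//; last first.
  by rewrite mulrAC divfK ?gt_eqF.
by apply: ler_pM => //; rewrite ?csn_ge0// /C lerDl.
Qed.

Lemma deriv_at_id t : deriv_at (id : R -> R^o) t (1 : R^o).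
Proof.
apply: deriv_at_real => e e0; exists 1 => // h _.
by rewrite mulr1 [t + h]addrC addrK subrr normr0 mulr_ge0// ltW.
Qed.

(** Continuous induction. With the slope enlarged to [C + e], the supremum [m] of the times where
    the estimate holds is again such a time, and differentiability at [m] carries the estimate
    beyond [m] as long as [m < b]; then [e] tends to 0. *)
Lemma csn_mvt V (p : V -> R) (g g' : R -> V) a b C : csn p -> a <= b ->
  (forall t, a <= t <= b -> deriv_at g t (g' t)) ->
  (forall t, a <= t <= b -> p (g' t) <= C) -> p (g b - g a) <= C * (b - a).
Proof.
move=> hp ab dg bg.
have C0 : 0 <= C by rewrite (le_trans _ (bg a _)) ?csn_ge0// lexx.
suff H e : 0 < e -> p (g b - g a) <= (C + e) * (b - a).
  apply/ler_addgt0Pr => e e0; have D0 : 0 < b - a + 1 by lra.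
  apply: (le_trans (H _ (divr_gt0 e0 D0))).
  rewrite mulrDl lerD2l mulrAC ler_pdivrMr// ler_pM2l//; lra.
move=> e0; pose S := [set t | a <= t <= b /\ p (g t - g a) <= (C + e) * (t - a)].
have Sa : S a by split; [rewrite lexx|rewrite !subrr (csn0 hp) mulr0].
have supS : has_sup S by split; [exists a|exists b => t [/andP[]]].
pose m := sup S.
have am : a <= m by apply: ub_le_sup => //; case: supS.
have mb : m <= b by apply: ge_sup; [exists a|move=> t [/andP[]]].
have mab : a <= m <= b by rewrite am.
have [d d0 Hd] := dg m mab p hp e e0.
have loc h : `|h| < d -> p (g (m + h) - g m) <= (C + e) * `|h|.
  move=> /Hd h1; have := csnD hp (g (m + h) - g m - h *: g' m) (h *: g' m).
  rewrite subrK (csnZ hp) => /le_trans; apply.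
  by rewrite mulrDl addrC lerD// mulrC ler_wpM2r// bg.
have [s [/andP[as_ sb] Ss] sm] := sup_adherent d0 supS.
have {}sm : m - d < s by [].
have sm' : s <= m by apply: ub_le_sup; [by case: supS|split; rewrite ?as_].
have Sm : p (g m - g a) <= (C + e) * (m - a).
  have := loc (s - m); rewrite ler0_norm ?subr_le0// opprB => h1.
  have {}h1 := h1 ltac:(lra); move: h1; rewrite [m + _]addrC subrK (csnBC hp) => h1.
  by have := csn_tri hp (g s) (g m) (g a); lra.
have [mb'|bm] := ltP m b; last by have <- : m = b by lra.
pose h := Num.min (d / 2) (b - m).
have h0 : 0 < h by rewrite lt_min divr_gt0//= subr_gt0.
have hd : h < d by rewrite gt_min ltr_pdivrMr// ltr_pMr// ltr1n.
have hb : h <= b - m by rewrite ge_min lexx orbT.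
have := loc h; rewrite gtr0_norm// => /(_ hd) h1.
have : S (m + h).
  split; first by apply/andP; split; lra.
  by have := csn_tri hp (g m) (g (m + h)) (g a); lra.
by move=> /(ub_le_sup (proj2 supS)); rewrite -/m => ?; lra.
Qed.

Lemma csn_mvt_norm V (p : V -> R) (g g' : R -> V) t h C : csn p ->
  (forall s, `|s - t| <= `|h| -> deriv_at g s (g' s)) ->
  (forall s, `|s - t| <= `|h| -> p (g' s) <= C) ->
  p (g (t + h) - g t) <= C * `|h|.
Proof.
move=> hp dg bg; have [h0|/ltW h0] := leP 0 h.
  rewrite ger0_norm// -[X in _ * X](addrK t) [h + t]addrC.
  by apply: (csn_mvt hp) => [|s hs|s hs];
    rewrite ?lerDl//; [apply: dg|apply: bg]; rewrite [`|h|]ger0_norm// ler_norml; lra.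
rewrite ler0_norm// (csnBC hp) (_ : - h = t - (t + h)); last by lra.
by apply: (csn_mvt hp) => [|s hs|s hs];
  rewrite ?gerDl//; [apply: dg|apply: bg]; rewrite [`|h|]ler0_norm// ler_norml; lra.
Qed.

Lemma csn_locally_bounded V (p : V -> R) (g g' : R -> V) a b : csn p ->
  (forall t, deriv_at g t (g' t)) ->
  exists C, forall t, a <= t <= b -> p (g t) <= C.
Proof.
move=> hp dg; have [ab|ba] := leP a b; last by exists 0 => t ?; lra.
have [|c _ Hc] := @EVT_max R (p \o g) a b ab.
  apply: continuous_subspaceT => t; apply/cvgrPdist_le => e e0.
  have [d d0 Hd] := deriv_at_continuous (dg t) hp e0.
  exists d => // s /= ts; have := Hd (s - t); rewrite distrC => /(_ ts).
  rewrite [t + _]addrC subrK => h1; apply: le_trans h1.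
  have := csnD hp (g s - g t) (g t); have := csnD hp (g t - g s) (g s).
  by rewrite !subrK (csnBC hp (g t)) ler_norml; lra.
by exists (p (g c)) => t tab; apply: Hc; rewrite in_itv.
Qed.

Definition smooth_in V (I : set R) (c : R -> V) := exists d : nat -> R -> V,
  d 0%N = c /\ forall n t, I t -> deriv_at (d n) t (d n.+1 t).

Lemma smooth_curveE V (c : R -> V) : smooth_curve c <-> smooth_in setT c.
Proof.
split=> -[d [d0 H]]; exists d; split => // n t; first by move=> _; apply/deriv_atP.
by apply/deriv_atP; exact: H.
Qed.

Lemma smooth_in_deriv V I (c : R -> V) : smooth_in I c ->
  exists2 c', smooth_in I c' & forall t, I t -> deriv_at c t (c' t).
Proof.
move=> [d [d0 H]]; exists (d 1%N); last by rewrite -d0; exact: H.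
by exists (fun n => d n.+1); split => // n t; exact: H.
Qed.

(** Coinduction for smoothness: a choice of derivative within [P] can be iterated, which produces
    the whole sequence of derivatives at once. *)
Lemma smooth_in_coind V I (P : set (R -> V)) :
  (forall c, P c -> exists2 c', P c' & forall t, I t -> deriv_at c t (c' t)) ->
  forall c, P c -> smooth_in I c.
Proof.
move=> H c Pc.
have [f Hf] : {f : (R -> V) -> (R -> V) & forall c, P c ->
    P (f c) /\ forall t, I t -> deriv_at c t (f c t)}.
  apply: (@choice _ _ (fun c c' => P c ->
    P c' /\ forall t, I t -> deriv_at c t (c' t))) => b.
  have [/H[b' Pb' db]|nPb] := pselect (P b); [by exists b'|by exists b].
exists (fun n => iter n f c); split => // n t It; apply: (Hf _ _).2 => //.
by elim: n => //= n IHn; exact: (Hf _ _).1.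
Qed.

(** Sums are all that the product rule creates; signs and scalar coefficients are absorbed by the
    classes [B] chosen below. *)
Inductive curve_span V (B : set (R -> V)) : (R -> V) -> Prop :=
| span_base b : B b -> curve_span B b
| span_add c c' : curve_span B c -> curve_span B c' -> curve_span B (fun t => c t + c' t).

Lemma smooth_span V I (B : set (R -> V)) :
  (forall b, B b -> exists2 b', curve_span B b' & forall t, I t -> deriv_at b t (b' t)) ->
  forall c, curve_span B c -> smooth_in I c.
Proof.
move=> H; apply: smooth_in_coind => c; elim=> {c} [b /H//|c d _ [c' Bc' dc] _ [d' Bd' dd]].
exists (fun t => c' t + d' t); first exact: span_add.
by move=> t It; apply: deriv_atD; [exact: dc|exact: dd].
Qed.

Lemma smooth_curve_deriv V (c : R -> V) : smooth_curve c ->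
  exists2 c', smooth_curve c' & forall t, deriv_at c t (c' t).
Proof.
move=> /smooth_curveE/smooth_in_deriv[c' /smooth_curveE sc' dc].
by exists c' => // t; exact: dc.
Qed.

Lemma smooth_curve_span V (B : set (R -> V)) :
  (forall b, B b -> exists2 b', curve_span B b' & forall t, deriv_at b t (b' t)) ->
  forall c, curve_span B c -> smooth_curve c.
Proof.
move=> H c Bc; apply/smooth_curveE; apply: smooth_span Bc => b /H[b' Bb' db].
by exists b'.
Qed.

Lemma smooth_curve_cst V (v : V) : smooth_curve (fun=> v).
Proof.
apply/smooth_curveE.
apply: (@smooth_in_coind _ _ [set c | exists v, c = fun=> v]); last by exists v.
by move=> _ [w ->]; exists (fun=> 0); [exists 0|move=> t _; exact: deriv_at_cst].
Qed.

Lemma smooth_curveD V (c d : R -> V) : smooth_curve c -> smooth_curve d ->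
  smooth_curve (fun t => c t + d t).
Proof.
move=> sc sd; apply: (@smooth_curve_span _ (@smooth_curve R V)).
  by move=> b /smooth_curve_deriv[b' sb' db]; exists b' => //; exact: span_base.
by apply: span_add; exact: span_base.
Qed.

(** The product rule makes the span of all curves [b c d] stable under differentiation. It is
    required along smooth curves only, the setting in which evaluation of functionals is shown to
    satisfy it. *)
Lemma smooth_curve_bilinear V W Z (b : V -> W -> Z) :
  (forall c c' d d' t, smooth_curve c -> smooth_curve c' ->
    smooth_curve d -> smooth_curve d' ->
    (forall t, deriv_at c t (c' t)) -> (forall t, deriv_at d t (d' t)) ->
    deriv_at (fun s => b (c s) (d s)) t (b (c' t) (d t) + b (c t) (d' t))) ->
  forall c d, smooth_curve c -> smooth_curve d ->
  smooth_curve (fun t => b (c t) (d t)).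
Proof.
move=> H c d sc sd; pose B := [set f : R -> Z | exists c d,
  [/\ smooth_curve c, smooth_curve d & f = fun t => b (c t) (d t)]].
apply: (@smooth_curve_span _ B); last by apply: span_base; exists c, d.
move=> _ [e [f [se sf ->]]].
have [e' se' de] := smooth_curve_deriv se; have [f' sf' df] := smooth_curve_deriv sf.
exists (fun t => b (e' t) (f t) + b (e t) (f' t)); last by move=> t; exact: H.
by apply: span_add; apply: span_base; [exists e', f|exists e, f'].
Qed.

Lemma deriv_at_scale V (f : R -> R^o) (f' : R^o) (c : R -> V) c' t :
  deriv_at f t f' -> deriv_at c t c' ->
  deriv_at (fun s => f s *: c s) t (f' *: c t + f t *: c').
Proof.
move=> df dc p hp e e0.
pose K := p (c t) + 1 + `|f'| + `|f t| + 1.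
have K0 : 0 < K.
  by rewrite /K; have := csn_ge0 hp (c t); have := normr_ge0 f'; have := normr_ge0 (f t); lra.
have eK0 : 0 < e / K by rewrite divr_gt0.
have [d1 d10 H1] := df _ csn_norm _ eK0.
have [d2 d20 H2] := dc _ hp _ eK0.
have [d3 d30 H3] := deriv_at_continuous dc hp eK0.
have [d4 d40 H4] := deriv_at_continuous dc hp ltr01.
exists (Num.min (Num.min d1 d2) (Num.min d3 d4)); first by rewrite !lt_min d10 d20 d30.
move=> h; rewrite !lt_min => /andP[/andP[/H1 h1 /H2 h2] /andP[/H3 h3 /H4 h4]].
have -> : f (t + h) *: c (t + h) - f t *: c t - h *: (f' *: c t + f t *: c') =
   (f (t + h) - f t - h *: f') *: c (t + h) + (h * f') *: (c (t + h) - c t) +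
   f t *: (c (t + h) - c t - h *: c').
  rewrite !(scalerBl, scalerBr) scalerDr !scalerA [f t * h]mulrC opprD.
  rewrite -[h *: f']/(h * f') subrKA -[_ - _ - (_ * _) *: c']addrA.
  by rewrite [_ - f t *: c (t + h) - _]addrAC subrKA addrACA.
apply: (le_trans (csnD hp _ _)); rewrite (csnZ hp).
apply: (@le_trans _ _ (`|h| * (e / K) * (p (c t) + 1 + `|f'| + `|f t|))); last first.
  have -> : e * `|h| = `|h| * (e / K) * K by rewrite -mulrA divfK ?gt_eqF// mulrC.
  by apply: ler_wpM2l; [rewrite mulr_ge0// ltW|rewrite /K lerDl].
rewrite [X in _ <= X]mulrDr lerD//; last first.
  by rewrite mulrC ler_wpM2r// mulrC.
apply: (le_trans (csnD hp _ _)); rewrite !(csnZ hp) mulrDr lerD//.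
  apply: ler_pM; rewrite ?(csn_ge0 hp)//; first by rewrite mulrC.
  by have := csnD hp (c (t + h) - c t) (c t); rewrite subrK; lra.
by rewrite normrM [`|h| * _ * _]mulrAC; apply: ler_wpM2l.
Qed.

Lemma smooth_curve_scale V (f : R -> R^o) (c : R -> V) :
  smooth_curve f -> smooth_curve c -> smooth_curve (fun t => f t *: c t).
Proof.
apply: (smooth_curve_bilinear (b := fun (a : R^o) v => a *: v)).
by move=> *; exact: deriv_at_scale.
Qed.

Lemma smooth_curveM (f g : R -> R^o) :
  smooth_curve f -> smooth_curve g -> smooth_curve (fun t => f t * g t : R^o).
Proof. exact: smooth_curve_scale. Qed.

Lemma smooth_curveZ V a (c : R -> V) :
  smooth_curve c -> smooth_curve (fun t => a *: c t).
Proof. by apply: smooth_curve_scale; exact: smooth_curve_cst. Qed.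

Lemma smooth_curveN V (c : R -> V) : smooth_curve c -> smooth_curve (fun t => - c t).
Proof.
by move=> /(smooth_curveZ (-1)); congr smooth_curve; apply/funext => t; rewrite scaleN1r.
Qed.

Lemma smooth_curveB V (c d : R -> V) : smooth_curve c -> smooth_curve d ->
  smooth_curve (fun t => c t - d t).
Proof. by move=> sc sd; apply: smooth_curveD => //; exact: smooth_curveN. Qed.

Lemma smooth_curve_id : smooth_curve (id : R -> R^o).
Proof.
apply: (@smooth_curve_span _ [set c : R -> R^o | c = id \/ exists v, c = fun=> v]).
  move=> _ [->|[v ->]].
    by exists (fun=> 1) => [|t]; [apply: span_base; right; exists 1|exact: deriv_at_id].
  by exists (fun=> 0) => [|t]; [apply: span_base; right; exists 0|exact: deriv_at_cst].
by apply: span_base; left.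
Qed.

Lemma deriv_at_comp V (c : R -> V) (phi : R -> R^o) t (k : R^o) l :
  deriv_at phi t k -> deriv_at c (phi t) l -> deriv_at (c \o phi) t (k *: l).
Proof.
move=> dphi dc p hp e e0.
pose K : R := `|k| + 1 + p l; have K0 : 0 < K.
  by rewrite /K; have := csn_ge0 hp l; have := normr_ge0 k; lra.
have eK0 : 0 < e / K by rewrite divr_gt0.
have [d1 d10 H1] := dphi _ csn_norm _ eK0.
have [d2 d20 H2] := dphi _ csn_norm _ ltr01.
have [d3 d30 H3] := dc _ hp _ eK0.
have d320 : 0 < d3 / 2 by rewrite divr_gt0.
have [d4 d40 H4] := deriv_at_continuous dphi csn_norm d320.
exists (Num.min (Num.min d1 d2) d4); first by rewrite !lt_min d10 d20.
move=> h; rewrite !lt_min => /andP[/andP[/H1 h1 /H2 h2] /H4 h4].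
pose m := phi (t + h) - phi t.
have hm : `|m| <= (`|k| + 1) * `|h|.
  have := ler_normD (m - h *: k) (h *: k); rewrite subrK => /le_trans; apply.
  by rewrite [h *: k]mulrC normrM; move: h2; rewrite -/m [h *: k]mulrC; lra.
have : `|m| < d3 by apply: le_lt_trans h4 _; rewrite ltr_pdivrMr// ltr_pMr// ltr1n.
move=> /H3; have -> : phi t + m = phi (t + h) by rewrite addrC subrK.
move=> h3; rewrite /=.
have -> : c (phi (t + h)) - c (phi t) - h *: (k *: l) =
  (c (phi (t + h)) - c (phi t) - m *: l) + (m - h *: k) *: l.
  by rewrite -[h *: k]/(h * k) (scalerBl m) subrKA scalerA.
apply: (le_trans (csnD hp _ _)); rewrite (csnZ hp).
apply: (@le_trans _ _ (e / K * (`|h| * K))); last by rewrite mulrCA divfK ?gt_eqF// mulrC.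
rewrite {2}/K mulrDr mulrDr lerD//.
  by apply: (le_trans h3); apply: ler_wpM2l; [exact: ltW|rewrite mulrC].
by rewrite mulrA ler_wpM2r ?csn_ge0.
Qed.

Lemma smooth_curve_comp V (c : R -> V) (phi : R -> R^o) :
  smooth_curve c -> smooth_curve phi -> smooth_curve (c \o phi).
Proof.
move=> sc sp; have [phi' sphi' dphi] := smooth_curve_deriv sp.
(* The scalar factor [f] is there to absorb the derivative of [phi] produced by the chain rule. *)
pose B := [set g : R -> V | exists (f : R -> R^o) c,
  [/\ smooth_curve f, smooth_curve c & g = fun t => f t *: c (phi t)]].
apply: (@smooth_curve_span _ B); last first.
  apply: span_base; exists (fun=> 1), c; split => //; first exact: smooth_curve_cst.
  by apply/funext => t; rewrite scale1r.
move=> _ [f [d [sf sd ->]]].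
have [f' sf' df] := smooth_curve_deriv sf; have [d' sd' dd] := smooth_curve_deriv sd.
exists (fun t => f' t *: d (phi t) + (f t * phi' t : R^o) *: d' (phi t)).
  by apply: span_add; apply: span_base; [exists f', d|exists (fun t => f t * phi' t), d'];
    split => //; exact: smooth_curveM.
move=> t; rewrite -scalerA; apply: deriv_at_scale => //.
exact: (@deriv_at_comp _ d).
Qed.

Lemma csn_pair V W (p : V * W -> R) : csn p ->
  csn (fun v => p (v, 0)) /\ csn (fun w => p (0, w)).
Proof.
move=> hp; have [A1 A2 A3] := hp; split; split.
- by move=> x y; have := A1 (x, 0) (y, 0); rewrite {1}/GRing.add/= {1}/add_pair/= addr0.
- by move=> a x; rewrite -A2 /GRing.scale/= /scale_pair/= scaler0.
- by have [[/= P Q] [P0 Q0] PQ] := A3; apply: filterS P0 => x Px;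
    apply: (PQ (x, 0)); split => //=; exact: nbhs_singleton.
- by move=> x y; have := A1 (0, x) (0, y); rewrite {1}/GRing.add/= {1}/add_pair/= addr0.
- by move=> a x; rewrite -A2 /GRing.scale/= /scale_pair/= scaler0.
- by have [[/= P Q] [P0 Q0] PQ] := A3; apply: filterS Q0 => x Px;
    apply: (PQ (0, x)); split => //=; exact: nbhs_singleton.
Qed.

Lemma deriv_at_pair V W (c : R -> V) (d : R -> W) t c' d' :
  deriv_at c t c' -> deriv_at d t d' ->
  deriv_at (fun s => (c s, d s) : (V * W)%type) t (c', d').
Proof.
move=> dc dd p hp e e0; have [p1 p2] := csn_pair hp.
have e20 : 0 < e / 2 by rewrite divr_gt0.
have [r r0 Hr] := dc _ p1 _ e20; have [s s0 Hs] := dd _ p2 _ e20.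
exists (Num.min r s); first by rewrite lt_min r0.
move=> h; rewrite lt_min => /andP[/Hr h1 /Hs h2].
set x := c (t + h) - _ - _ in h1; set y := d (t + h) - _ - _ in h2.
have -> : (c (t + h), d (t + h)) - (c t, d t) - h *: (c', d') =
  (x, 0) + (0, y) :> (V * W)%type by congr pair; rewrite /= ?addr0 ?add0r.
by rewrite (le_trans (csnD hp _ _))// [e]splitr mulrDl lerD.
Qed.

Lemma smooth_curve_pair V W (c : R -> V) (d : R -> W) :
  smooth_curve c -> smooth_curve d ->
  smooth_curve (fun s => (c s, d s) : (V * W)%type).
Proof.
move=> sc sd; pose P := [set f : R -> (V * W)%type | exists c d,
  [/\ smooth_curve c, smooth_curve d & f = fun t => (c t, d t)]].
apply/smooth_curveE; apply: (@smooth_in_coind _ _ P); last by exists c, d.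
move=> _ [a [b [/smooth_curve_deriv[a' sa' da] /smooth_curve_deriv[b' sb' db] ->]]].
exists (fun t => (a' t, b' t)); first by exists a', b'.
by move=> t _; exact: deriv_at_pair.
Qed.

Lemma smooth_curve_op V W (T : V -> W) c :
  (forall v w, T (v - w) = T v - T w) -> (forall a v, T (a *: v) = a *: T v) ->
  (forall q, csn q -> exists2 p, csn p & forall v, q (T v) <= p v) ->
  smooth_curve c -> smooth_curve (T \o c).
Proof.
move=> TB TZ Tc sc; apply/smooth_curveE.
apply: (@smooth_in_coind _ _ [set f | exists2 c, smooth_curve c & f = T \o c]); last by exists c.
move=> _ [d /smooth_curve_deriv[d' sd' dd] ->]; exists (T \o d'); first by exists d'.
by move=> t _; exact: deriv_at_bounded_op.
Qed.

Lemma smooth_curve_fst V W (c : R -> (V * W)%type) :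
  smooth_curve c -> smooth_curve (fun t => (c t).1).
Proof.
apply: (@smooth_curve_op _ _ (fst : (V * W)%type -> V)) => // q [q1 q2 q3].
exists (q \o fst) => //; split => [x y|a x|] /=; [exact: q1|exact: q2|].
by exists ([set x | q x < 1], setT) => [|x []//]; split => //; exact: filterT.
Qed.

Lemma smooth_curve_snd V W (c : R -> (V * W)%type) :
  smooth_curve c -> smooth_curve (fun t => (c t).2).
Proof.
apply: (@smooth_curve_op _ _ (snd : (V * W)%type -> W)) => // q [q1 q2 q3].
exists (q \o snd) => //; split => [x y|a x|] /=; [exact: q1|exact: q2|].
by exists (setT, [set x | q x < 1]) => [|x []//]; split => //; exact: filterT.
Qed.

End SmoothCurves.

(** * Evaluation of functionals and localization *)

Section LinearFunctions.
Context (R : pzRingType) (U W : lmodType R) (f : U -> W) (lf : linear f).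

Lemma linfun0 : f 0 = 0.
Proof.
by have := lf 1 0 0; rewrite !scale1r addr0 => /eqP; rewrite -subr_eq subrr eq_sym => /eqP.
Qed.
Lemma linfunZ a x : f (a *: x) = a *: f x.
Proof. by rewrite -[a *: x]addr0 lf linfun0 addr0. Qed.
Lemma linfunD x y : f (x + y) = f x + f y.
Proof. by rewrite -[x]scale1r lf !scale1r. Qed.
Lemma linfunN x : f (- x) = - f x.
Proof. by rewrite -scaleN1r linfunZ scaleN1r. Qed.
Lemma linfunB x y : f (x - y) = f x - f y.
Proof. by rewrite linfunD linfunN. Qed.
End LinearFunctions.

Section Functionals.
Context (R : realType).
Implicit Types V W : tvsType R.

(** The functional is only bounded, so a small remainder need not have a small image. The remainder
    [r h] is however of order [h ^+ 2] for every seminorm, so the vectors [h ^- 2 *: r h] form a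
    bounded set, [l] is bounded on it, and [l (r h)] is of order [h ^+ 2] as well. *)
Lemma deriv_at_bdual V (l : bdual (tvs_bornology V)) (v v' : R -> V) t :
  smooth_curve v' -> (forall s, deriv_at v s (v' s)) ->
  deriv_at (fun s => l (v s) : R^o) t (l (v' t)).
Proof.
move=> sv' dv; case: (l) => f /= /bdual_predP[lf bf].
have fZ a x : f (a *: x) = a * f x by exact: linfunZ lf a x.
have fB x y : f (x - y) = f x - f y by exact: linfunB lf x y.
pose r h := v (t + h) - v t - h *: v' t.
have rb p : csn p -> exists C, forall h, `|h| <= 1 -> p (r h) <= C * h ^+ 2.
  (* [v3] is the second derivative of [v]; the third one, [v4], serves to bound [v3] near [t]. *)
  move=> hp; have [v3 sv3 dv3] := smooth_curve_deriv sv'.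
  have [v4 _ dv4] := smooth_curve_deriv sv3.
  have [C HC] := csn_locally_bounded (t - 1) (t + 1) hp dv4.
  exists C => h h1.
  have H1 s : `|s - t| <= `|h| -> p (v' s - v' t) <= C * `|h|.
    move=> sh; have C0 : 0 <= C by apply: le_trans (HC t _); rewrite ?csn_ge0//; lra.
    apply: (@le_trans _ _ (C * `|s - t|)); last exact: ler_wpM2l.
    have := @csn_mvt_norm _ _ p v' v3 t (s - t) C hp; rewrite [t + _]addrC subrK.
    apply=> [u _|u hu]; first exact: dv3.
    apply: HC; have := le_trans hu (le_trans sh h1); rewrite ler_norml; lra.
  (* Second use of the mean value inequality: the derivative [v' s - v' t] of this curve has just
     been bounded by [C * |h|], and its increment is [r h]. *)
  have := @csn_mvt_norm _ _ p (fun s => v s - s *: v' t) (fun s => v' s - v' t) t h (C * `|h|) hp.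
  have -> : v (t + h) - (t + h) *: v' t - (v t - t *: v' t) = r h.
    by rewrite /r scalerDl !opprD opprK [- (t *: _) - _]addrC [_ + (- _ - _)]addrA addrACA addNr addr0 addrAC.
  rewrite -mulrA -normrM -expr2 ger0_norm ?sqr_ge0//; apply => // s _.
  apply: deriv_atD => //.
  have := deriv_atZ (-1) (deriv_at_scale (deriv_at_id s) (deriv_at_cst (v' t) s)).
  rewrite scaler0 addr0 scale1r scaleN1r; apply: deriv_at_near.
  by exists 1 => // k _; rewrite scaleN1r.
have [|L HL] := bf [set b | exists2 h, 0 < `|h| <= 1 & b = h ^- 2 *: r h].
  apply/csn_boundedP => p hp; have [C HC] := rb p hp; exists C => _ [h /andP[h0 h1] ->].
  have h2 : 0 < h ^+ 2 by rewrite exprn_even_gt0//= -normr_gt0.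
  by rewrite (csnZ hp) gtr0_norm ?invr_gt0// ler_pdivrMl// mulrC HC.
apply: deriv_at_real => e e0.
pose L' := `|L| + 1; have L0 : 0 < L' by rewrite ltr_wpDl.
exists (Num.min 1 (e / L')); first by rewrite lt_min ltr01 divr_gt0.
move=> h; rewrite lt_min => /andP[h1 h2].
have [->|h0] := eqVneq h 0; first by rewrite addr0 !subrr mul0r subrr normr0 mulr0.
have h0' : 0 < `|h| by rewrite normr_gt0.
rewrite -fZ -!fB -/(r h).
have h20 : h ^+ 2 != 0 by rewrite expf_neq0.
have := HL (h ^- 2 *: r h); rewrite fZ normrM normfV => HLh.
have {}HLh := HLh ltac:(by exists h => //; rewrite h0' ltW); move: HLh.
rewrite ler_pdivrMl ?normr_gt0// => /le_trans; apply.
rewrite normrX expr2 -mulrA [_ * L]mulrC mulrA [_ * L]mulrC ler_pM2r//.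
by move: h2; rewrite ltr_pdivlMr// /L' => h2; have := ler_norm L; nra.
Qed.

(** The topology of the dual is uniform convergence on bounded sets, so the difference quotients of
    [a] converge uniformly on [A]. *)
Lemma deriv_at_dual_unif V (a : R -> dual V) t a' A : deriv_at a t a' ->
  tvs_bounded A -> forall e : R, 0 < e -> exists2 d : R, 0 < d &
    forall h, `|h| < d -> forall x, A x ->
    `|(a (t + h) : bdual (tvs_bornology V)) x - (a t : bdual (tvs_bornology V)) x
      - h * (a' : bdual (tvs_bornology V)) x| <= e * `|h|.
Proof.
move=> /deriv_atP da bA e e0.
have [|d /= d0 Hd] := da (@bdual_ball R V (tvs_bornology V) a' A e).
  by exists A, e; split.
exists d => // h hd x Ax; have [->|h0] := eqVneq h 0.
  by rewrite addr0 subrr mul0r subrr normr0 mulr0.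
have := Hd h; rewrite /= sub0r normrN => /(_ hd h0 x Ax).
set y := (a (t + h) : bdual _) x; set z := (a t : bdual _) x.
rewrite -[X in `|_ - X|]/(h^-1 * (y - z)).
move: y z ((a' : bdual _) x) => y z w H.
have -> : y - z - h * w = - ((w - h^-1 * (y - z)) * h).
  by rewrite mulrBl mulrAC mulVf// mul1r opprB mulrC.
by rewrite normrN normrM ler_wpM2r.
Qed.

(** The difficulty is that functional and argument move together. The points [d (t + h)] with
    [|h| <= 1] form a bounded set, on which the difference quotients of [c] converge uniformly; what
    remains involves only the fixed functionals [c' t] and [c t], to which [deriv_at_bdual]
    applies. *)
Lemma smooth_curve_eval V (a : R -> dual V) (v : R -> V) :
  smooth_curve a -> smooth_curve v ->
  smooth_curve (fun t => (a t : bdual (tvs_bornology V)) (v t) : R^o).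
Proof.
apply: (smooth_curve_bilinear (b := fun (l : dual V) x =>
  (l : bdual (tvs_bornology V)) x : R^o)).
move=> c c' d d' t sc sc' sd sd' dc dd.
have [d'' sd'' dd'] := smooth_curve_deriv sd'.
pose A := [set x | exists2 h, `|h| <= 1 & x = d (t + h)].
have bA : tvs_bounded A.
  apply/csn_boundedP => p hp; have [C HC] := csn_locally_bounded (t - 1) (t + 1) hp dd.
  by exists C => _ [h h1 ->]; apply: HC; move: h1; rewrite ler_norml; lra.
apply: deriv_at_real => e e0; have e30 : 0 < e / 3 by rewrite divr_gt0.
have [r1 r10 H1] := deriv_at_dual_unif (dc t) bA e30.
have [r2 r20 H2] := deriv_at_continuous
  (@deriv_at_bdual V (c' t) d d' t sd' dd) (@csn_norm R) e30.
have [r3 r30 H3] := @deriv_at_bdual V (c t) d d' t sd' dd _ (@csn_norm R) _ e30.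
exists (Num.min (Num.min 1 r1) (Num.min r2 r3)); first by rewrite !lt_min ltr01 r10 r20.
move=> h; rewrite !lt_min => /andP[/andP[/ltW h1 /H1 hr1] /andP[/H2 hr2 /H3 hr3]].
have {}hr1 := hr1 (d (t + h)) ltac:(by exists h).
move: hr1 hr2 hr3; rewrite -[h *: _]/(h * _).
set x1 := (c _ : bdual _) (d _); set x2 := (c _ : bdual _) (d _).
set x3 := (c' _ : bdual _) (d _); set x4 := (c' _ : bdual _) (d _).
set x5 := (c _ : bdual _) (d _); set x6 := (c t : bdual _) (d' _).
move=> A1 A2 A3.
move: A1 A2 A3; move: x1 x2 x3 x4 x5 x6 => x1 x2 x3 x4 x5 x6 A1 A2 A3.
have -> : x1 - x5 - h * (x4 + x6) =
  (x1 - x2 - h * x3) + h * (x3 - x4) + (x2 - x5 - h * x6) by ring.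
apply: (le_trans (ler_normD _ _)); rewrite (_ : e * `|h| = e / 3 * `|h| + e / 3 * `|h| + e / 3 * `|h|); last by field.
rewrite lerD//; apply: (le_trans (ler_normD _ _)); rewrite lerD// normrM mulrC.
exact: ler_wpM2r.
Qed.

(** * Local nature of smoothness and reparametrization of intervals *)

Lemma smooth_in_eq V (I : set R) (c c' : R -> V) :
  (forall t, I t -> exists2 e : R, 0 < e & forall h, `|h| < e -> I (t + h)) ->
  (forall t, I t -> c t = c' t) -> smooth_in I c -> smooth_in I c'.
Proof.
move=> Io cc' [d [d0 H]]; exists (fun n => if n is m.+1 then d m.+1 else c'); split=> //.
move=> [|n] t It; last exact: H.
apply: deriv_at_near (H 0%N t It); have [e e0 He] := Io t It.
by exists e => // h /He /cc'; rewrite d0.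
Qed.

Lemma interval_open (t0 e t : R) : `|t - t0| < e ->
  exists2 d : R, 0 < d & forall h, `|h| < d -> `|t + h - t0| < e.
Proof.
move=> te; exists (e - `|t - t0|); first by rewrite subr_gt0.
by move=> h hd; have := ler_normD (t - t0) h; rewrite addrAC; lra.
Qed.

(** In a Hausdorff space derivatives are unique, so the local derivatives are restrictions of one
    global curve, which is again locally smooth. *)
Lemma smooth_curve_local V (c : R -> V) : hausdorff_space V ->
  (forall t0, exists2 e : R, 0 < e & smooth_in [set t | `|t - t0| < e] c) ->
  smooth_curve c.
Proof.
move=> hV H; apply/smooth_curveE; pose P (c : R -> V) :=
  forall t0, exists2 e : R, 0 < e & smooth_in [set t | `|t - t0| < e] c.
apply: (@smooth_in_coind _ _ _ P) H => {}c Pc.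
have dc t : {l | deriv_at c t l}.
  apply/cid; have [e e0 /smooth_in_deriv[c' _ dc']] := Pc t.
  by exists (c' t); apply: dc'; rewrite /= subrr normr0.
exists (fun t => sval (dc t)); last by move=> t _; exact: svalP (dc t).
move=> t0; have [e e0 /smooth_in_deriv[c' sc' dc']] := Pc t0.
exists e => //; apply: smooth_in_eq sc'; first by move=> t; exact: interval_open.
by move=> t te; apply: deriv_at_unique (dc' t te) _ => //; exact: svalP (dc t).
Qed.

Lemma is_derive_deriv_at (f : R -> R) (t l : R) :
  is_derive t (1 : R) f l -> deriv_at (f : R -> R^o) t (l : R^o).
Proof.
move=> [df <-]; apply/deriv_atP; rewrite -[X in _ --> X]/(lim _).
move: df => /cvgP; rewrite /derivable /derive.
under eq_fun => h do rewrite /= [h *: 1]mulr1 [h + t]addrC.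
by move=> H; exact: H.
Qed.

Lemma deriv_at_inv (x : R) : 0 < x ->
  deriv_at (fun y : R => y^-1 : R^o) x (- x ^- 2 : R^o).
Proof.
move=> x0.
have H := deriv_at_comp (deriv_atZ (-1) (is_derive_deriv_at (is_derive1_ln x0)))
  (is_derive_deriv_at (is_derive_expR _)).
apply: deriv_at_near (_ : deriv_at (expR \o (fun s => -1 *: ln s)) x _).
  exists x => // h hx; have xh : 0 < x + h by move: hx; rewrite ltr_norml; lra.
  by rewrite /= [_ *: _]mulN1r expRN lnK.
move: H; rewrite [- x ^- 2](_ : _ = -1 *: x^-1 *: expR (-1 *: ln x))//.
rewrite [-1 *: ln x]mulN1r expRN lnK// scaleN1r [- _ *: _]mulNr.
by rewrite expr2 invfM.
Qed.

Lemma smooth_curve_expR : smooth_curve (expR : R -> R^o).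
Proof.
apply/smooth_curveE; apply: (@smooth_in_coind _ _ _ [set expR : R -> R^o]) => // _ ->.
by exists expR => // t _; apply: is_derive_deriv_at; exact: is_derive_expR.
Qed.

Lemma smooth_curve_inv (f : R -> R^o) : smooth_curve f -> (forall t, 0 < f t) ->
  smooth_curve (fun t => (f t)^-1 : R^o).
Proof.
move=> sf f0; have [f' sf' df] := smooth_curve_deriv sf.
(* Differentiation raises the power of [1 / f], while [k] absorbs the factors [n] and [f']. *)
pose B := [set g : R -> R^o | exists (n : nat) (k : R -> R^o), smooth_curve k /\
  g = fun t => (f t)^-1 ^+ n * k t].
apply: (@smooth_curve_span _ _ B); last first.
  apply: span_base; exists 1%N, (fun=> 1); split; first exact: smooth_curve_cst.
  by apply/funext => t; rewrite expr1 mulr1.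
have dpow n t : deriv_at (fun t => (f t)^-1 ^+ n : R^o) t
    (- (n%:R * f' t) * (f t)^-1 ^+ n.+1 : R^o).
  elim: n => [|n IHn].
    by rewrite mul0r oppr0 mul0r; exact: deriv_at_cst.
  have := deriv_at_scale (deriv_at_comp (df t) (deriv_at_inv (f0 t))) IHn.
  set l := (X in deriv_at _ _ X); set l' := (X in _ -> deriv_at _ _ X).
  have -> : l = l'; last by apply: deriv_at_near; exists 1 => // h _; rewrite /= exprS.
  rewrite /l /l' /= /GRing.scale/=; rewrite -exprVn -natr1.
  move: (f t)^-1 => u; rewrite !exprS; ring.
move=> _ [n [k [sk ->]]]; have [k' sk' dk] := smooth_curve_deriv sk.
exists (fun t => (f t)^-1 ^+ n.+1 * (- (n%:R * f' t) * k t) + (f t)^-1 ^+ n * k' t).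
  apply: span_add; apply: span_base; last by exists n, k'.
  exists n.+1, (fun t => - (n%:R * f' t) * k t); split => //.
  apply: smooth_curveM => //; apply: smooth_curveN; apply: smooth_curveM => //.
  exact: smooth_curve_cst.
move=> t; have := deriv_at_scale (dpow n t) (dk t).
by rewrite [X in X + _]mulrAC [X in X + _]mulrC.
Qed.

(** Here [sigma s] is tanh(s/2), a diffeomorphism of the line onto the interval from -1 to 1, [psi]
    is its inverse, and [tau s], which equals 1 + cosh s, is the reciprocal of the derivative of
    [sigma]. The derivative of [psi] is thereby a globally smooth function of [psi], and [psi]
    itself is never differentiated twice. *)
Lemma smooth_diffeo : exists sigma psi tau : R -> R^o,
  [/\ smooth_curve sigma /\ smooth_curve tau,
      forall s, `|sigma s| < 1 /\ psi (sigma s) = s,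
      forall t, `|t| < 1 -> sigma (psi t) = t /\ deriv_at psi t (tau (psi t)),
      sigma 0 = 0 &
      forall s, 0 < tau s /\ deriv_at sigma s (tau s)^-1].
Proof.
exists (fun s => 1 - 2 / (1 + expR s)), (fun t => ln ((1 + t) / (1 - t))),
  (fun s => (expR (- s) + 2 + expR s) / 2).
have e0 (s : R) : 0 < expR s := expR_gt0 s.
have e1 (s : R) : 0 < 1 + expR s by rewrite ltr_pwDl.
have s1 : smooth_curve (fun s : R => 1 + expR s : R^o).
  by apply: smooth_curveD; [exact: smooth_curve_cst|exact: smooth_curve_expR].
have psiK (t : R) : `|t| < 1 -> expR (ln ((1 + t) / (1 - t))) = (1 + t) / (1 - t).
  by rewrite ltr_norml => t1; rewrite lnK// posrE divr_gt0//; lra.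
split.
- split.
    apply: smooth_curveB; first exact: smooth_curve_cst.
    by apply: smooth_curveM; [exact: smooth_curve_cst|exact: smooth_curve_inv].
  apply: smooth_curveM; last exact: smooth_curve_cst.
  apply: smooth_curveD; last exact: smooth_curve_expR.
  apply: smooth_curveD; last exact: smooth_curve_cst.
  apply: (@smooth_curve_comp _ _ expR (fun s => - s)); first exact: smooth_curve_expR.
  by apply: smooth_curveN; exact: smooth_curve_id.
- move=> s; split.
    rewrite ltr_norml; apply/andP; split.
      have : 2 / (1 + expR s) < 2 by rewrite ltr_pdivrMr//; have := e0 s; lra.
      lra.
    by rewrite gtrBl divr_gt0.
  rewrite -[RHS]expRK; congr ln; have := e0 s; have := e1 s.
  by move=> h1 h2; field; rewrite !gt_eqF//; lra.
- move=> t t1; move: (t1); rewrite ltr_norml => t1'; split.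
    by rewrite psiK//; field; rewrite !gt_eqF//; lra.
  rewrite expRN psiK//.
  have p1 : 0 < 1 + t by lra.
  have p2 : 0 < 1 + -1 *: (t : R^o) by rewrite [_ *: _]mulN1r; lra.
  have H1 := deriv_at_comp (deriv_atD (deriv_at_cst (1 : R^o) t) (deriv_at_id t))
     (is_derive_deriv_at (is_derive1_ln p1)).
  have H2 := deriv_at_comp (deriv_atD (deriv_at_cst (1 : R^o) t) (deriv_atZ (-1) (deriv_at_id t)))
     (is_derive_deriv_at (is_derive1_ln p2)).
  have := deriv_atD H1 (deriv_atZ (-1) H2).
  set l := (X in deriv_at _ _ X -> _); set l' := (X in _ -> deriv_at _ _ X).
  have -> : l = l'.
    rewrite /l /l' /GRing.scale/=; field; rewrite !gt_eqF//; lra.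
  apply: deriv_at_near.
  have t1'' : `|t - 0| < 1 by rewrite subr0.
  have [d d0 Hd] := interval_open t1''.
  exists d => // h /Hd; rewrite subr0 ltr_norml => th.
  rewrite /= [-1 *: ln _]mulN1r [-1 *: _]mulN1r ln_div// posrE; lra.
- by rewrite expR0 divff ?subrr// gt_eqF.
- move=> s; split.
    by rewrite divr_gt0// addr_gt0// addr_gt0//.
  have H1 := deriv_atD (deriv_at_cst (1 : R^o) s) (is_derive_deriv_at (is_derive_expR s)).
  have H2 := deriv_at_comp H1 (deriv_at_inv (e1 s)).
  have := deriv_atD (deriv_at_cst (1 : R^o) s) (deriv_atZ (-2) H2).
  set l := (X in deriv_at _ _ X -> _); set l' := (X in _ -> deriv_at _ _ X).
  have -> : l = l'.
    rewrite /l /l' /GRing.scale/= expRN; have := e0 s; have := e1 s.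
    by move: (expR s) => u u0 u1; field; rewrite !gt_eqF//; nra.
  by apply: deriv_at_near; exists 1 => // h _; rewrite /= [_ *: _]mulNr.
Qed.

(** Smooth maps are tested on curves defined on the whole line, so a curve on an interval is
    accessible only through [c \o phi]. With [phi] a diffeomorphism onto the interval, the curves
    [c] for which [c \o phi] is smooth form a class stable under differentiation on the interval. *)
Lemma smooth_in_reparam V (c : R -> V) (t0 e : R) : 0 < e ->
  (forall phi : R -> R^o, smooth_curve phi -> (forall s, `|phi s - t0| < e) ->
    smooth_curve (c \o phi)) ->
  smooth_in [set t | `|t - t0| < e] c.
Proof.
move=> e0 H; have [sigma [psi [tau [[ss st] sK psiK s0 ds]]]] := smooth_diffeo.
pose phi s : R^o := t0 + e * sigma s.
have sphi : smooth_curve phi.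
  apply: smooth_curveD; first exact: smooth_curve_cst.
  by apply: smooth_curveM => //; exact: smooth_curve_cst.
have phiP s : `|phi s - t0| < e.
  rewrite /phi addrC addKr normrM gtr0_norm//.
  by rewrite gtr_pMr//; have [] := sK s.
pose P (c : R -> V) := smooth_curve (c \o phi).
apply: (@smooth_in_coind _ _ _ P); last exact: H.
move=> {H}{}c Pc; have [G' sG' dG] := smooth_curve_deriv Pc.
pose theta t : R^o := e^-1 * (t - t0).
have thetaP t : `|t - t0| < e -> `|theta t| < 1.
  by rewrite /theta normrM gtr0_norm ?invr_gt0// mulrC ltr_pdivrMr// mul1r.
have psiphi s : psi (theta (phi s)) = s.
  rewrite /theta /phi [t0 + _]addrC addrK mulrA mulVf ?gt_eqF// mul1r.
  by have [] := sK s.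
have phipsi t : `|t - t0| < e -> phi (psi (theta t)) = t.
  move=> /thetaP /psiK[+ _]; rewrite /phi => ->.
  by rewrite /theta mulrA divff ?gt_eqF// mul1r addrC subrK.
(* Chain rule for [c] written as [(c \o phi) \o psi \o theta], where [psi \o theta] inverts [phi] on
   the interval. *)
exists (fun t => (e^-1 * tau (psi (theta t)) : R^o) *: G' (psi (theta t))).
  rewrite /P (_ : _ \o _ = fun s => (e^-1 * tau s : R^o) *: G' s); last first.
    by apply/funext => s; rewrite /= psiphi.
  apply: smooth_curve_scale => //; apply: smooth_curveM => //.
  exact: smooth_curve_cst.
move=> t /= te; have [_ dpsi] := psiK _ (thetaP _ te).
have dtheta : deriv_at theta t (e^-1 : R^o).
  have := deriv_atZ e^-1 (deriv_atD (deriv_at_id t) (deriv_at_cst (- t0 : R^o) t)).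
  by rewrite addr0 [_ *: 1]mulr1.
have := deriv_at_comp (deriv_at_comp dtheta dpsi) (dG _).
apply: deriv_at_near; have [d d0 Hd] := interval_open te.
by exists d => // h /Hd /phipsi /= ->.
Qed.

Lemma smooth_curve_localP V (c : R -> V) : hausdorff_space V ->
  (forall t0, exists2 e : R, 0 < e &
    forall phi : R -> R^o, smooth_curve phi -> (forall s, `|phi s - t0| < e) ->
      smooth_curve (c \o phi)) -> smooth_curve c.
Proof.
move=> hV H; apply: smooth_curve_local => // t0; have [e e0 He] := H t0.
by exists e => //; exact: smooth_in_reparam.
Qed.
End Functionals.

(** * Hadamard's lemma and bounded linear maps *)

Section Hadamard.
Context (R : realType).
Implicit Types V W : tvsType R.

Lemma deriv_at_exp (f : R -> R^o) t k n : deriv_at f t k ->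
  deriv_at (fun s => f s ^+ n : R^o) t (n%:R * f t ^+ n.-1 * k : R^o).
Proof.
move=> df; elim: n => [|n IHn]; first by rewrite !mul0r; exact: deriv_at_cst.
have := deriv_at_scale df IHn; congr deriv_at; rewrite /GRing.scale/=.
  by apply/funext => s; rewrite exprS.
by case: n {IHn} => [|n]; rewrite /= -natr1 ?exprS; ring.
Qed.

Lemma deriv_at_invf (x : R) : x != 0 ->
  deriv_at (fun y : R => y^-1 : R^o) x (- x ^- 2 : R^o).
Proof.
move=> x0; have [xp|xn] := ltP 0 x; first exact: deriv_at_inv.
have xm : 0 < -1 *: (x : R^o) by rewrite [_ *: _]mulN1r oppr_gt0 lt_neqAle x0.
have := deriv_atZ (-1) (deriv_at_comp (deriv_atZ (-1) (deriv_at_id x)) (deriv_at_inv xm)).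
congr deriv_at; first by apply/funext => y; rewrite /= [-1 *: y]mulN1r [_ *: _]mulN1r invrN opprK.
by rewrite /GRing.scale/=; field; rewrite x0 ?oppr_eq0 ?oner_neq0.
Qed.

Lemma deriv_at_monomial V (v : V) n t :
  deriv_at (fun s => (s ^+ n.+1 / n.+1`!%:R) *: v) t ((t ^+ n / n`!%:R) *: v).
Proof.
have := deriv_at_scale (deriv_atZ (n.+1`!%:R^-1) (deriv_at_exp n.+1 (deriv_at_id t))) (deriv_at_cst v t).
rewrite scaler0 addr0; congr deriv_at.
  by apply/funext => s; rewrite /= [_ *: (_ ^+ _)]mulrC.
congr (_ *: _); rewrite /= /GRing.scale/= mulr1 factS natrM.
have f0 : n`!%:R != 0 :> R by rewrite pnatr_eq0 -lt0n fact_gt0.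
have n0 : n.+1%:R != 0 :> R by rewrite pnatr_eq0.
by rewrite invfM mulrACA mulVf// mul1r mulrC.
Qed.

(** Two terms of the expansion are kept because the quotient by [h ^+ m] must be known at 0 together
    with its derivative there. The induction passes to the derivative of the curve and integrates
    the estimate by the mean value inequality. *)
Lemma taylor_peano V m (d : nat -> R -> V) :
  (forall n t, deriv_at (d n) t (d n.+1 t)) ->
  (forall j, (j < m)%N -> d j 0 = 0) ->
  forall p, csn p -> forall e : R, 0 < e -> exists2 r : R, 0 < r &
    forall h, `|h| < r ->
    p (d 0%N h - (h ^+ m / m`!%:R) *: d m 0 - (h ^+ m.+1 / m.+1`!%:R) *: d m.+1 0)
    <= e * `|h| ^+ m.+1.
Proof.
elim: m d => [|m IHm] d dd d0 p hp e e0.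
  have [r r0 Hr] := dd 0%N 0 p hp e e0; exists r => // h /Hr.
  by rewrite add0r expr0 !expr1 fact0 divr1 scale1r -[1`!]/1%N divr1.
have [r r0 Hr] := IHm (fun n => d n.+1) (fun n => dd n.+1) (fun j => d0 j.+1) p hp e e0.
exists r => // h hr.
pose g s := d 0%N s - (s ^+ m.+1 / m.+1`!%:R) *: d m.+1 0 -
  (s ^+ m.+2 / m.+2`!%:R) *: d m.+2 0.
have := @csn_mvt_norm _ _ p g (fun s => d 1%N s - (s ^+ m / m`!%:R) *: d m.+1 0 -
  (s ^+ m.+1 / m.+1`!%:R) *: d m.+2 0) 0 h (e * `|h| ^+ m.+1) hp.
have -> : g (0 + h) - g 0 = g h.
  by rewrite add0r {2}/g d0// ![0 ^+ _]expr0n/= !mul0r !scale0r !subr0.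
rewrite -mulrA -exprSr; apply=> s; rewrite subr0 => sh.
  rewrite /g; apply: deriv_atD.
    apply: deriv_atD => //; rewrite -scaleN1r.
    have := deriv_atZ (-1) (deriv_at_monomial (d m.+1 0) m s).
    by congr deriv_at; apply/funext => u; rewrite scaleN1r.
  rewrite -scaleN1r; have := deriv_atZ (-1) (deriv_at_monomial (d m.+2 0) m.+1 s).
  by congr deriv_at; apply/funext => u; rewrite scaleN1r.
have := Hr s (le_lt_trans sh hr) => /le_trans; apply.
by rewrite ler_wpM2l ?(ltW e0)// lerXn2r// nnegrE.
Qed.

(** The stable class consists of all quotients of [d 0] by [t ^+ m], where [d 0] vanishes to order
    [m] at 0, extended to [t = 0] by the Taylor coefficient. Derivatives come from the quotient rule
    away from 0 and from [taylor_peano] at 0; the claim is the case [m = 1]. *)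
Lemma hadamard V (g : R -> V) : smooth_curve g -> g 0 = 0 ->
  exists2 delta, smooth_curve delta & forall t, g t = t *: delta t.
Proof.
move=> /smooth_curveE[d0 [d00 dd0]] g0.
pose F m (d : nat -> R -> V) t := if t == 0 then m`!%:R^-1 *: d m 0
  else t^-1 ^+ m *: d 0%N t.
pose P f := exists m d, [/\ forall n t, deriv_at (d n) t (d n.+1 t),
  forall j, (j < m)%N -> d j 0 = 0 & f = F m d].
exists (F 1%N d0); last first.
  move=> t; rewrite /F; case: eqP => [->|/eqP t0]; first by rewrite scale0r.
  by rewrite expr1 scalerA divff// scale1r d00.
apply/smooth_curveE; apply: (@smooth_in_coind _ _ _ P); last first.
  exists 1%N, d0; split => //; first by move=> n t; exact: dd0.
  by case=> // _; rewrite d00.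
move=> _ [m [d [dd d_0 ->]]].
(* The quotient rule gives the new numerator [t *: d 1 t - m *: d 0 t] over [t ^+ m.+1], and [d' n]
   is the [n]-th derivative of this numerator. At 0 it equals [n - m] times [d n 0], which is zero
   for all [n <= m]. *)
pose d' n t := t *: d n.+1 t + (n%:R - m%:R) *: d n t.
have dd' n t : deriv_at (d' n) t (d' n.+1 t).
  have := deriv_atD (deriv_at_scale (deriv_at_id t) (dd n.+1 t)) (deriv_atZ (n%:R - m%:R) (dd n t)).
  congr deriv_at; rewrite /d' scale1r [d n.+1 t + _]addrC -addrA; congr (_ + _).
  by rewrite -natr1 addrAC [in RHS]scalerDl scale1r addrC.
exists (F m.+1 d').
  exists m.+1, d'; split => // j; rewrite ltnS leq_eqVlt /d' scale0r add0r.
  by case/predU1P => [->|/d_0 ->]; rewrite ?subrr ?scale0r ?scaler0.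
move=> t _; rewrite {2}/F; case: eqP => [->|/eqP t0]; last first.
  have H := deriv_at_scale (deriv_at_exp m (deriv_at_invf t0)) (dd 0%N t).
  apply: deriv_at_near; last first.
    move: H; congr deriv_at; rewrite /d' sub0r scalerDr !scalerA addrC; congr (_ *: _ + _ *: _).
      by rewrite exprSr -mulrA mulVf// mulr1.
    case: (m) => [|k]; first by rewrite !mul0r oppr0 mulr0.
    by rewrite /= -[t ^- 2]exprVn; move: t^-1 => u; rewrite !exprS; ring.
  exists `|t|; first by rewrite normr_gt0.
  move=> h ht; rewrite /F; case: eqP => // /eqP.
  by rewrite addrC addr_eq0 => /eqP hN; move: ht; rewrite hN normrN ltxx.
move=> p hp e e0; have [r r0 Hr] := taylor_peano dd d_0 hp e0.
exists r => // h /Hr; rewrite add0r.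
have -> : F m d 0 = m`!%:R^-1 *: d m 0 by rewrite /F eqxx.
have -> : d' m.+1 0 = d m.+1 0.
  by rewrite /d' scale0r add0r -natr1 addrAC subrr add0r scale1r.
rewrite {1}/F; case: eqP => [->|/eqP h0].
  by move=> _; rewrite subrr scale0r subrr normr0 mulr0 (csn0 hp).
set x := d m 0; set y := d m.+1 0; set z := d 0%N h.
have h0' : 0 < `|h| by rewrite normr_gt0.
have -> : h^-1 ^+ m *: z - m`!%:R^-1 *: x - h *: (m.+1`!%:R^-1 *: y) =
  h^-1 ^+ m *: (z - (h ^+ m / m`!%:R) *: x - (h ^+ m.+1 / m.+1`!%:R) *: y).
  rewrite !scalerBr !scalerA; congr (_ - _ *: _ - _ *: _).
    by rewrite mulrA exprVn mulVf ?mul1r// expf_neq0.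
  by rewrite exprS exprVn [h * h ^+ _]mulrC !mulrA mulVf ?mul1r// expf_neq0.
rewrite (csnZ hp) normrX normfV => H.
by rewrite exprVn ler_pdivrMl ?exprn_gt0// mulrCA [`|h| ^+ _ * _]mulrC -exprS.
Qed.

(** * Flat functions and smooth curves through prescribed points *)

Definition flat n (t : R) : R^o :=
  if 0 < t then t^-1 ^+ n * expR (- t^-1) else 0.

(** The exponential of [1/t] dominates its Taylor term of order [n + 2]; the two powers beyond [n]
    leave the factor [t ^+ 2], which forces a zero derivative at the origin. *)
Lemma flat_bound n t : `|flat n t| <= (n.+2)`!%:R * t ^+ 2.
Proof.
rewrite /flat; case: ltP => t0; last by rewrite normr0 mulr_ge0// sqr_ge0.
have ti : 0 < t^-1 by rewrite invr_gt0.
rewrite ger0_norm; last by apply: mulr_ge0; [apply: exprn_ge0; exact: ltW|exact: expR_ge0].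
rewrite expRN ler_pdivrMr ?expR_gt0//.
have := expR_ge1Dxn n.+1 (ltW ti); move: (expR _) => E H.
have f0 : 0 < n.+2`!%:R :> R by rewrite ltr0n fact_gt0.
have {}H : t^-1 ^+ n.+2 <= n.+2`!%:R * E.
  by rewrite mulrC -ler_pdivrMr//; lra.
rewrite -mulrA mulrCA -ler_pdivrMl ?exprn_gt0//.
by apply: le_trans H; rewrite -exprVn -exprD.
Qed.

(** This closure property is why the powers of [1/t] are part of the family: the derivatives of
    [flat 0] stay in its linear span. *)
Lemma deriv_at_flat n t :
  deriv_at (flat n) t (- n%:R *: flat n.+1 t + flat n.+2 t).
Proof.
have [t0|t0] := ltP 0 t.
  have tn : t != 0 by rewrite gt_eqF.
  have H1 := deriv_at_exp n (deriv_at_invf tn).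
  have H2 := deriv_at_comp (deriv_atZ (-1) (deriv_at_invf tn))
    (is_derive_deriv_at (is_derive_expR _)).
  apply: deriv_at_near (_ : deriv_at (fun s => s^-1 ^+ n * expR (-1 *: (s^-1 : R^o)) : R^o) t _).
    exists t => // h; rewrite ltr_norml => th; rewrite /flat ifT; last by lra.
    by rewrite [-1 *: _]mulN1r.
  have := deriv_at_scale H1 H2; congr deriv_at.
  rewrite /flat t0 /GRing.scale/= !mulN1r -[t ^- 2]exprVn.
  move: (expR _) => E; move: t^-1 => u; by case: (n) => [|k]; rewrite ?exprS /=; ring.
have f0 k s : s <= 0 -> flat k s = 0 by rewrite /flat leNgt => /negbTE ->.
rewrite !f0// scaler0 addr0.
apply: deriv_at_real => e e0.
have K0 : 0 < (n.+2)`!%:R :> R by rewrite ltr0n fact_gt0.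
exists (e / (n.+2)`!%:R); first by rewrite divr_gt0.
move=> h; rewrite ltr_pdivlMr// => hr; rewrite [flat n t]f0// subr0 mulr0 subr0.
have [th|th] := leP (t + h) 0; first by rewrite f0// normr0 mulr_ge0// ltW.
apply: (le_trans (flat_bound _ _)); apply: (@le_trans _ _ ((n.+2)`!%:R * h ^+ 2)).
  by rewrite ler_pM2l// lerXn2r ?nnegrE//; lra.
rewrite -real_normK ?num_real// expr2 mulrA ler_wpM2r// mulrC; lra.
Qed.

Definition flat_span := curve_span [set f : R -> R^o | exists a n, f = fun t => a * flat n t].

Lemma flat_span_le0 f t : flat_span f -> t <= 0 -> f t = 0.
Proof.
move=> + t0; elim=> {f} [_ [a [n ->]]|f g _ + _ +]; last by move=> -> ->; rewrite addr0.
by rewrite /flat ltNge t0 mulr0.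
Qed.

Lemma flat_span_bound f : flat_span f -> exists2 C, 0 <= C & forall t, `|f t| <= C * t ^+ 2.
Proof.
elim=> {f} [_ [a [n ->]]|f g _ [C C0 HC] _ [D D0 HD]].
  exists (`|a| * (n.+2)`!%:R) => [|t]; first by rewrite mulr_ge0.
  by rewrite normrM -mulrA ler_wpM2l// flat_bound.
exists (C + D) => [|t]; first exact: addr_ge0.
by rewrite mulrDl (le_trans (ler_normD _ _))// lerD.
Qed.

Lemma flat_spanN f : flat_span f -> flat_span (fun t => - f t).
Proof.
elim=> {f} [_ [a [n ->]]|f g _ Hf _ Hg].
  apply: span_base; exists (- a), n; by apply/funext => t; rewrite mulNr.
have := span_add Hf Hg; congr (curve_span _ _).
by apply/funext => t; rewrite opprD.
Qed.

Lemma flat_span_deriv f : flat_span f ->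
  exists2 f', flat_span f' & forall t, deriv_at f t (f' t).
Proof.
elim=> {f} [_ [a [n ->]]|f g _ [f' sf df] _ [g' sg dg]].
  exists (fun t => (a * - n%:R) * flat n.+1 t + a * flat n.+2 t).
    by apply: span_add; apply: span_base; [exists (a * - n%:R), n.+1|exists a, n.+2].
  move=> t; have := deriv_atZ a (deriv_at_flat n t); congr deriv_at.
  by rewrite scalerDr scalerA.
by exists (fun t => f' t + g' t) => [|t]; [exact: span_add|exact: deriv_atD].
Qed.

(* The curve passes through the point [mu n *: a n] at the midpoint [tau n] of
   the interval from [(n + 2)^-1] to [(n + 1)^-1], on which it runs along the
   line spanned by [a n]. *)
Lemma special_curve : exists mu tau : nat -> R,
  (forall n, 0 < mu n /\ 0 <= tau n <= 1) /\
  forall V (a : nat -> V), (forall p, csn p -> exists C, forall n, p (a n) <= C) ->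
  exists2 c, smooth_curve c & forall n, c (tau n) = mu n *: a n.
Proof.
pose l n : R := n.+2%:R^-1; pose r n : R := n.+1%:R^-1.
have lr n : l n < r n by rewrite ltf_pV2 ?posrE// ltr_nat.
have l0 n : 0 < l n by rewrite invr_gt0.
have r1 n : r n <= 1 by rewrite invf_le1// ler1n.
have disj n m t : l n < t < r n -> l m < t < r m -> n = m.
  wlog nm : n m / (n <= m)%N.
    move=> H A B; have [/H|/ltnW/H K] := leqP n m; first exact.
    by apply/esym; exact: K.
  move=> /andP[lt _] /andP[_ tr]; apply/eqP; rewrite eqn_leq nm/=.
  by have := lt_trans lt tr; rewrite ltf_pV2 ?posrE// ltr_nat !ltnS.
pose tau n := (l n + r n) / 2.
have tauP n : l n < tau n < r n by have := lr n; rewrite /tau; lra.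
(* For [t] in none of the intervals [N t] is the default 0. This is harmless: [t] is then outside
   the interval of index 0 too, and one factor of [S] vanishes there by [S0]. *)
pose N t := xget 0%N [set n | l n < t < r n].
have NP n t : l n < t < r n -> N t = n.
  move=> nt; have /= := @xgetPex _ 0%N [set n | l n < t < r n] (ex_intro _ n nt).
  by move=> H; exact: disj H nt.
have F0 : flat_span (flat 0).
  by apply: span_base; exists 1, 0%N; apply/funext => t; rewrite mul1r.
have flat_gt0 t : 0 < t -> 0 < flat 0 t.
  by move=> t0; rewrite /flat t0 expr0 mul1r expR_gt0.
exists (fun n => flat 0 (tau n - l n) * flat 0 (r n - tau n)), tau; split.
  move=> n; have /andP[h1 h2] := tauP n; have := l0 n; have := r1 n.
  by split; [rewrite mulr_gt0// flat_gt0// subr_gt0|lra].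
move=> V a aB.
pose S f g t : V := (f (t - l (N t)) * g (r (N t) - t)) *: a (N t).
pose B := [set c : R -> V | exists f g, [/\ flat_span f, flat_span g & c = S f g]].
have S0 f g t : flat_span f -> flat_span g ->
    ~~ (l (N t) < t < r (N t)) -> S f g t = 0.
  move=> sf sg; rewrite negb_and -!leNgt /S => /orP[h|h].
    by rewrite (flat_span_le0 sf) ?subr_le0// mul0r scale0r.
  by rewrite (flat_span_le0 sg) ?subr_le0// mulr0 scale0r.
exists (S (flat 0) (flat 0)); last by move=> n; rewrite /S (NP n).
apply: (@smooth_curve_span _ _ B); last by apply: span_base; exists (flat 0), (flat 0).
move=> _ [f [g [sf sg ->]]].
have [f' sf' df] := flat_span_deriv sf; have [g' sg' dg] := flat_span_deriv sg.
exists (fun t => S f' g t + S (fun t => - f t) g' t).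
  apply: span_add; apply: span_base; first by exists f', g.
  by exists (fun t => - f t), g'; split => //; exact: flat_spanN.
move=> t; have [tN|tN] := boolP (l (N t) < t < r (N t)).
  have [n nt] : exists n, n = N t by exists (N t).
  rewrite -nt in tN; have /andP[t1 t2] := tN.
  have H1 := deriv_at_comp (deriv_atD (deriv_at_id t) (deriv_at_cst (- l n : R^o) t)) (df _).
  have H2 := deriv_at_comp (deriv_atD (deriv_at_cst (r n : R^o) t) (deriv_atZ (-1) (deriv_at_id t))) (dg _).
  have := deriv_at_scale (deriv_at_scale H1 H2) (deriv_at_cst (a n) t).
  rewrite scaler0 addr0; set v := (X in deriv_at _ _ X -> _).
  have -> : v = S f' g t + S (fun t => - f t) g' t.
    rewrite /v /S -nt -scalerDl /=; congr (_ *: _); rewrite [-1 *: _]mulN1r.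
    by rewrite addr0 add0r scale1r /GRing.scale/=; ring.
  apply: deriv_at_near; exists (Num.min (t - l n) (r n - t)).
    by rewrite lt_min !subr_gt0 t1.
  move=> h; rewrite lt_min !ltr_norml => /andP[h1 h2].
  rewrite /S (NP n); last by apply/andP; split; lra.
  by rewrite /= [-1 *: _]mulN1r.
rewrite [X in deriv_at _ _ (X + _)]S0// [X in deriv_at _ _ (_ + X)]S0 ?addr0//; last exact: flat_spanN.
have [C C0 HC] := flat_span_bound sf; have [D D0 HD] := flat_span_bound sg.
(* At a point [t] outside the intervals the derivative must be 0. If [t + h] lies in an interval,
   [t] is on one side of it: the distance from [t + h] to that end is at most [|h|] and the distance
   to the other end at most 1, so the two quadratic bounds multiply to one in [h ^+ 2]. It is
   uniform in the interval because the vectors [a n] are bounded. *)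
have key h p K : csn p -> 0 <= K -> (forall n, p (a n) <= K) ->
    p (S f g (t + h)) <= C * D * h ^+ 2 * K.
  move=> hp K0 HK; have [sN|sN] := boolP (l (N (t + h)) < t + h < r (N (t + h))); last first.
    by rewrite S0// (csn0 hp) mulr_ge0// mulr_ge0 ?sqr_ge0// mulr_ge0.
  rewrite /S (csnZ hp); apply: ler_pM; rewrite ?(csn_ge0 hp)//.
  have [n nt] : exists n, n = N (t + h) by exists (N (t + h)).
  rewrite -nt in sN *.
  have tn : t <= l n \/ r n <= t.
    have [|/= ?] := leP t (l n); first by left.
    have [|/= ?] := leP (r n) t; first by right.
    by move: tN; rewrite (NP n) ?negb_and -?leNgt; [case/orP; lra|lra].
  rewrite normrM; apply: (@le_trans _ _ ((C * (t + h - l n) ^+ 2) * (D * (r n - (t + h)) ^+ 2))).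
    by rewrite ler_pM.
  rewrite [X in X <= _]mulrACA ler_wpM2l ?mulr_ge0//.
  have /andP[s1 s2] := sN; have := r1 n; have := l0 n => ln rn.
  rewrite -exprMn -[h ^+ 2]real_normK ?num_real// lerXn2r ?nnegrE//.
    by rewrite mulr_ge0// subr_ge0 ltW.
  case: tn => tn.
    rewrite ger0_norm; last by lra.
    rewrite -[X in _ <= X]mulr1; apply: ler_pM; lra.
  rewrite ler0_norm; last by lra.
  rewrite -[X in _ <= X]mul1r; apply: ler_pM; lra.
move=> p hp e e0; have [K0 HK0] := aB p hp.
have K0' : 0 <= K0 by apply: le_trans (HK0 0%N); exact: csn_ge0.
pose E := C * D * K0 + 1; have E0 : 0 < E by rewrite ltr_wpDl// !mulr_ge0.
exists (e / E); first by rewrite divr_gt0.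
move=> h; rewrite ltr_pdivlMr// => hE; rewrite scaler0 subr0 [S f g t]S0// subr0.
apply: (le_trans (key h p K0 hp K0' HK0)).
rewrite -real_normK ?num_real// expr2 mulrA mulrAC ler_wpM2r//.
by rewrite mulrAC mulrC; move: hE; rewrite /E mulrDr mulr1; have := normr_ge0 h; lra.
Qed.

(** Since [mu] and [tau] are fixed before the vectors, an unbounded image of [A] allows [a n] in [A]
    with [p (T (a n))] above [n / mu n]. The image under [T] of the smooth curve through the points
    [mu n *: a n] is then unbounded on [[0, 1]], although it is smooth. *)
Lemma smooth_linear_bounded V W (T : V -> W) : linear T ->
  (forall c, smooth_curve c -> smooth_curve (T \o c)) ->
  forall A, tvs_bounded A -> tvs_bounded (T @` A).
Proof.
move=> lT sT A /csn_boundedP bA; apply/csn_boundedP => p hp; apply: contrapT => unb.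
have [mu [tau [mt sc]]] := special_curve.
have ex n : {x | A x /\ n%:R / mu n < p (T x)}.
  apply/cid; apply: contrapT => H; apply: unb; exists (n%:R / mu n) => _ [x Ax <-].
  by rewrite leNgt; apply/negP => xp; apply: H; exists x.
pose a n := sval (ex n).
have [c sc' cE] : exists2 c, smooth_curve c & forall n, c (tau n) = mu n *: a n.
  apply: sc => q hq; have [C HC] := bA q hq; exists C => n; apply: HC.
  by rewrite /a; case: (ex n) => x [].
have [c' _ dc] := smooth_curve_deriv (sT _ sc').
have [C HC] := csn_locally_bounded 0 1 hp dc.
have [m Cm] : exists m : nat, C < m%:R.
  by exists (Num.truncn C).+1; exact: truncnS_gt.
have [mu0 taum] := mt m.
have := HC _ taum; rewrite /= cE (linfunZ lT) (csnZ hp) gtr0_norm//.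
have : m%:R / mu m < p (T (a m)) by rewrite /a; case: (ex m) => x [].
by rewrite ltr_pdivrMr// mulrC; lra.
Qed.
End Hadamard.

(** * Smoothness along plots *)

Section Plots.
Context (R : realType) (M : manifold R).
Implicit Types (U V : set M) (W Z : tvsType R) (g : R -> M) (phi : R -> R^o).

(** Smooth curves inside a single chart: smoothness on [M] is defined chart by chart, so these are
    enough to test it, and charts disappear from later arguments. *)
Definition plot g := exists (i : mindex M) (c : R -> model i),
  [/\ smooth_curve c, forall t, (chart i @` mdom i) (c t) & g = param i \o c].

Lemma chart_imageP U i y :
  (chart i @` (U `&` mdom i)) y <-> (chart i @` mdom i) y /\ U (param i y).
Proof.
split=> [[x [Ux ix] <-]|[[x ix <-]]].
  by split; [exists x|rewrite chartK].
by rewrite chartK// => Ux; exists x.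
Qed.

Lemma msmoothP W U (f : M -> W) : msmooth U f <->
  forall g, plot g -> (forall t, U (g t)) -> smooth_curve (f \o g).
Proof.
split=> [H g [i [c [sc cd ->]]] Ug|H i c sc cU].
  by apply: (H i c sc) => t; apply/chart_imageP; split; [exact: cd|exact: Ug].
have cU' t := (@chart_imageP U i (c t)).1 (cU t).
by apply: (H (param i \o c)) => [|t]; [exists i, c; split => // t|]; case: (cU' t).
Qed.

Lemma msmooth2P W Z U (f : M -> W -> Z) : msmooth2 U f <->
  forall g v, plot g -> smooth_curve v -> (forall t, U (g t)) ->
  smooth_curve (fun t => f (g t) (v t) : Z).
Proof.
split=> [H g v [i [c [sc cd ->]]] sv Ug|H i c sc cU].
  apply: (H i (fun t => (c t, v t))); first exact: smooth_curve_pair.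
  by move=> t; split => //; apply/chart_imageP; split; [exact: cd|exact: Ug].
have cU' t := (@chart_imageP U i (c t).1).1 (cU t).1.
apply: (H (param i \o (fun t => (c t).1)) (fun t => (c t).2)).
- exists i, (fun t => (c t).1); split => //; first exact: smooth_curve_fst.
  by move=> t; case: (cU' t).
- exact: smooth_curve_snd.
- by move=> t; case: (cU' t).
Qed.

Lemma plot_comp g phi : plot g -> smooth_curve phi -> plot (g \o phi).
Proof.
move=> [i [c [sc cd ->]]] sp; exists i, (c \o phi); split => //.
- exact: smooth_curve_comp.
- by move=> t; exact: cd.
Qed.

Lemma plot_cst x : plot (fun=> x).
Proof.
exists (chart_at x), (fun=> chart (chart_at x) x); split.
- exact: smooth_curve_cst.
- by move=> t; exists x => //; exact: mdom_chart_at.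
- by apply/funext => t; rewrite /= chartK//; exact: mdom_chart_at.
Qed.

Lemma mopenI U V : mopen U -> mopen V -> mopen (U `&` V).
Proof.
move=> oU oV i c sc.
rewrite (_ : _ @^-1` _ = c @^-1` (chart i @` (U `&` mdom i)) `&`
   c @^-1` (chart i @` (V `&` mdom i))); first by apply: openI; [exact: oU|exact: oV].
apply/seteqP; split=> t; rewrite /preimage/=.
  by move=> [x [[Ux Vx] ix] <-]; split; exists x.
by move=> [/chart_imageP[[x ix <-]]]; rewrite chartK// => Ux /chart_imageP[_];
  rewrite chartK// => Vx; exists x.
Qed.

Lemma plot_open g U t0 : plot g -> mopen U -> U (g t0) ->
  exists2 e : R, 0 < e & forall t, `|t - t0| < e -> U (g t).
Proof.
move=> [i [c [sc cd ->]]] oU Ut0.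
have := oU i c sc; rewrite openE => /(_ t0).
have ct0 : (c @^-1` (chart i @` (U `&` mdom i))) t0.
  by apply/chart_imageP; split => //; exact: cd.
move=> /(_ ct0) [e /= e0 He]; exists e => // t te.
by have := He t; rewrite /= distrC => /(_ te)/chart_imageP[].
Qed.

(** This allows a trivialization to be chosen near each parameter: after reparametrization the curve
    stays in its domain for all times. *)
Lemma plot_local W (f : R -> W) g : hausdorff_space W -> plot g ->
  (forall t0, exists U, [/\ mopen U, U (g t0) &
    forall phi, smooth_curve phi -> (forall s, U (g (phi s))) ->
    smooth_curve (f \o phi)]) -> smooth_curve f.
Proof.
move=> hW pg H; apply: smooth_curve_localP => // t0.
have [U [oU Ut0 HU]] := H t0; have [e e0 He] := plot_open pg oU Ut0.
by exists e => // phi sphi phiP; apply: HU => // s; exact: He.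
Qed.

(** The coordinate line along which directional derivatives are taken. It is meaningful for small
    [h] only, since [param] is unconstrained outside the image of the chart. *)
Definition line (x : M) (w : model (chart_at x)) (h : R) : M :=
  param (chart_at x) (chart (chart_at x) x + h *: w).

Lemma line0 x (w : model (chart_at x)) : line w 0 = x.
Proof. by rewrite /line scale0r addr0 chartK//; exact: mdom_chart_at. Qed.

Lemma line_plot U x (w : model (chart_at x)) : mopen U -> U x ->
  exists2 e : R, 0 < e &
  (forall h, `|h| < e -> U (line w h)) /\
  forall phi, smooth_curve phi -> (forall s, `|phi s| < e) ->
    plot (fun s => line w (phi s)).
Proof.
move=> oU Ux; pose c (h : R) := chart (chart_at x) x + h *: w.
have sc : smooth_curve c.
  apply: smooth_curveD; first exact: smooth_curve_cst.
  apply: smooth_curve_scale; first exact: smooth_curve_id.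
  exact: smooth_curve_cst.
have := oU (chart_at x) c sc; rewrite openE => /(_ 0).
have c0 : (c @^-1` (chart (chart_at x) @` (U `&` mdom (chart_at x)))) 0.
  by exists x; [split => //; exact: mdom_chart_at|rewrite /c scale0r addr0].
move=> /(_ c0) [e /= e0 He]; exists e => //.
have {}He h : `|h| < e -> (chart (chart_at x) @` mdom (chart_at x)) (c h) /\ U (line w h).
  by move=> he; have := He h; rewrite /= sub0r normrN => /(_ he)/chart_imageP[].
split=> [h /He[]//|phi sphi phiP].
exists (chart_at x), (c \o phi); split => //.
  exact: smooth_curve_comp.
by move=> t; have [] := He _ (phiP t).
Qed.
End Plots.

(** * Vector bundles and the pairing along plots *)

Section Bundles.
Context (R : realType) (M : manifold R).
Implicit Types (E F G D : bundle_data M) (g : R -> M) (phi : R -> R^o) (U : set M).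

(** A plot need not stay in the domain of one trivialization, so the field is tested after every
    reparametrization that does. *)
Definition smooth_along E g (s : forall t, E (g t)) := forall phi i,
  smooth_curve phi -> (forall t, vdom E i (g (phi t))) ->
  smooth_curve (fun t => triv E i (g (phi t)) (s (phi t))).

Lemma smooth_along_triv E g (s : forall t, E (g t)) i :
  smooth_along s -> (forall t, vdom E i (g t)) ->
  smooth_curve (fun t => triv E i (g t) (s t)).
Proof. by move=> ss; apply: (ss id); exact: smooth_curve_id. Qed.

Lemma smooth_sectionP E U (s : section E) : smooth_section U s <->
  forall g, plot g -> (forall t, U (g t)) -> @smooth_along E g (fun t => s (g t)).
Proof.
split=> [ss g pg Ug phi i sphi ip|H i].
  have /msmoothP := ss i; apply; first exact: plot_comp.
  by move=> t; split; [exact: Ug|exact: ip].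
apply/msmoothP => g pg gU; apply: (@smooth_along_triv E g (fun t => s (g t))).
  by apply: H => // t; case: (gU t).
by move=> t; case: (gU t).
Qed.

Lemma is_morphism_plot F G (f : forall x, F x -> G x) : is_vbundle F ->
  (forall i, hausdorff_space (vfib G i)) -> is_morphism f ->
  forall g (s : forall t, F (g t)), plot g -> smooth_along s ->
  @smooth_along G g (fun t => f (g t) (s t)).
Proof.
move=> vF hG [lf sf] g s pg ss phi j sphi jp.
have pgp := plot_comp pg sphi.
apply: (plot_local (hG j) pgp) => t0.
have [i it0] := vdom_cover vF (g (phi t0)).
exists (vdom F i); split => //; first exact: vdom_open.
move=> psi spsi ip; have /msmooth2P := sf i j.
move=> /(_ (g \o phi \o psi) (fun t => triv F i _ (s (phi (psi t))))).
have -> : (fun t => triv G j ((g \o phi \o psi) t)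
   (f ((g \o phi \o psi) t) (untriv F i ((g \o phi \o psi) t)
      (triv F i (g (phi (psi t))) (s (phi (psi t))))))) =
   (fun t => triv G j (g (phi t)) (f (g (phi t)) (s (phi t)))) \o psi.
  by apply/funext => t; rewrite /= (trivK vF (ip t)).
apply.
- exact: plot_comp.
- by apply: (ss (phi \o psi)) => //; exact: smooth_curve_comp.
- by move=> t; split; [exact: ip|exact: jp].
Qed.

Lemma smooth_along_untriv E g i (v : R -> vfib E i) : is_vbundle E -> plot g ->
  smooth_curve v -> (forall t, vdom E i (g t)) ->
  @smooth_along E g (fun t => untriv E i (g t) (v t)).
Proof.
move=> vE pg sv ig phi j sphi jp; have /msmooth2P := @triv_smooth _ _ _ vE i j.
move=> /(_ (g \o phi) (v \o phi)); apply; [exact: plot_comp|exact: smooth_curve_comp|].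
by move=> t; split; [exact: ig|exact: jp].
Qed.

Lemma plot_is_morphism F G (f : forall x, F x -> G x) : is_vbundle F ->
  (forall x, linear (f x)) ->
  (forall g (s : forall t, F (g t)), plot g -> smooth_along s ->
     @smooth_along G g (fun t => f (g t) (s t))) -> is_morphism f.
Proof.
move=> vF lf H; split => // i j; apply/msmooth2P => g v pg sv gU.
apply: (@smooth_along_triv G g (fun t => f (g t) (untriv F i (g t) (v t)))).
  by apply: H => //; apply: smooth_along_untriv => // t; case: (gU t).
by move=> t; case: (gU t).
Qed.

Lemma vfib_hausdorff E : is_vbundle E -> forall i, hausdorff_space (vfib E i).
Proof. by move=> vE i; case: (vfib_convenient vE i). Qed.

Section WhitneyProjections.
Context E F D (kappa : forall x, D x -> whitney_sum E F x) (vE : is_vbundle E)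
  (vF : is_vbundle F) (vD : is_vbundle D) (mk : is_morphism kappa).

(** A trivialization of the sum is a pair of trivializations, so [F] has to be trivialized near each
    parameter as well, although only the component in [E] is read. *)
Lemma whitney_fst g (d : forall t, D (g t)) : plot g -> smooth_along d ->
  @smooth_along E g (fun t => (kappa (d t)).1).
Proof.
move=> pg sd phi j sphi jp; have pgp := plot_comp pg sphi.
apply: (plot_local (@vfib_hausdorff E vE j) pgp) => t0.
have [i it0] := vdom_cover vD (g (phi t0)).
have [k kt0] := vdom_cover vF (g (phi t0)).
exists (vdom D i `&` vdom F k); split => //.
  by apply: mopenI; [exact: (vdom_open vD)|exact: (vdom_open vF)].
move=> psi spsi ip; have /msmooth2P := mk.2 i (j, k).
move=> /(_ (g \o phi \o psi) (fun t => triv D i _ (d (phi (psi t))))) H.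
have {H}/smooth_curve_fst := H (plot_comp pgp spsi)
  (sd (phi \o psi) i (smooth_curve_comp sphi spsi) (fun t => (ip t).1))
  (fun t => conj (ip t).1 (conj (jp (psi t)) (ip t).2)).
congr smooth_curve; apply/funext => t /=; rewrite (trivK vD)//.
by case: (ip t).
Qed.

Lemma whitney_snd g (d : forall t, D (g t)) : plot g -> smooth_along d ->
  @smooth_along F g (fun t => (kappa (d t)).2).
Proof.
move=> pg sd phi j sphi jp; have pgp := plot_comp pg sphi.
apply: (plot_local (@vfib_hausdorff F vF j) pgp) => t0.
have [i it0] := vdom_cover vD (g (phi t0)).
have [k kt0] := vdom_cover vE (g (phi t0)).
exists (vdom D i `&` vdom E k); split => //.
  by apply: mopenI; [exact: (vdom_open vD)|exact: (vdom_open vE)].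
move=> psi spsi ip; have /msmooth2P := mk.2 i (k, j).
move=> /(_ (g \o phi \o psi) (fun t => triv D i _ (d (phi (psi t))))) H.
have {H}/smooth_curve_snd := H (plot_comp pgp spsi)
  (sd (phi \o psi) i (smooth_curve_comp sphi spsi) (fun t => (ip t).1))
  (fun t => conj (ip t).1 (conj (ip t).2 (jp (psi t)))).
congr smooth_curve; apply/funext => t /=; rewrite (trivK vD)//.
by case: (ip t).
Qed.
End WhitneyProjections.

Lemma untriv_linear E i x : is_vbundle E -> vdom E i x -> linear (untriv E i x).
Proof.
move=> vE ix a u v; apply: (can_inj (trivK vE ix)).
by rewrite (triv_linear vE ix) !(untrivK vE ix).
Qed.

(** A change of trivialization is linear and maps smooth curves to smooth curves, hence is bounded
    by [smooth_linear_bounded]. Boundedness in a fibre may therefore be checked in one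
    trivialization. *)
Lemma untriv_fibre_bounded E i x A : is_vbundle E -> vdom E i x ->
  tvs_bounded A -> fibre_bounded (untriv E i x @` A).
Proof.
move=> vE ix bA j jx; rewrite image_comp.
apply: smooth_linear_bounded => //.
  move=> a u v; rewrite /= (untriv_linear vE ix) (triv_linear vE jx) //.
move=> c sc; have /msmooth2P := @triv_smooth _ _ _ vE i j.
by move=> /(_ (fun=> x) c); apply; [exact: plot_cst| |].
Qed.

(** The transposed functional is bounded by the previous lemma, so [insubd] returns it and not the
    default 0. *)
Lemma triv_dual E i x (a : dual_bundle E x) (w : vfib E i) :
  is_vbundle E -> vdom E i x ->
  (triv (dual_bundle E) i x a : bdual (tvs_bornology (vfib E i))) w =
  (a : bdual (fibre_bornology E x)) (untriv E i x w).
Proof.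
move=> vE ix; rewrite /triv/=.
set f := (_ \o _); rewrite (_ : bdual_fun (insubd _ f) = f)//.
have := @insubdK _ _ (bdual (tvs_bornology (vfib E i))) 0 f.
apply; apply/bdual_predP; case: (a) @f => b /bdual_predP[lb bb] /=.
split=> [k u v|A bA] /=; first by rewrite (untriv_linear vE ix) lb.
have [C HC] := bb _ (untriv_fibre_bounded vE ix bA).
by exists C => w' Aw'; apply: HC; exists w'.
Qed.

Lemma pairing_smooth E F (iota : forall x, F x -> dual_bundle E x) g
    (a : forall t, F (g t)) (u : forall t, E (g t)) :
  is_vbundle E -> is_vbundle F -> is_morphism iota -> plot g ->
  smooth_along a -> smooth_along u ->
  smooth_curve (fun t => pairing iota (a t) (u t) : R^o).
Proof.
move=> vE vF mi pg sa su; apply: (plot_local (@norm_hausdorff _ _) pg) => t0.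
have [i it0] := vdom_cover vE (g t0).
have [k kt0] := vdom_cover vF (g t0).
exists (vdom E i `&` vdom F k); split => //.
  by apply: mopenI; [exact: (vdom_open vE)|exact: (vdom_open vF)].
move=> phi sphi ip; have /msmooth2P := mi.2 k i.
move=> /(_ (g \o phi) (fun t => triv F k _ (a (phi t)))) H.
have sl := H (plot_comp pg sphi) (sa phi k sphi (fun t => (ip t).2))
  (fun t => conj (ip t).2 (ip t).1).
have := smooth_curve_eval sl (su phi i sphi (fun t => (ip t).1)).
congr smooth_curve; apply/funext => t; have [i1 i2] := ip t.
by rewrite [LHS]triv_dual//= (trivK vF)// (trivK vE).
Qed.
End Bundles.

(** * Derivatives and 1-jets *)

Section Derivations.
Context (R : realType).
Implicit Types V W : tvsType R.

Lemma ddirP V W (f : V -> W) a v l : hausdorff_space W ->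
  deriv_at (fun h => f (a + h *: v)) 0 l -> ddir f a v = l.
Proof.
move=> hW H; have lim_l : h^-1 *: (f (a + h *: v) - f a) @[h --> (0 : R)^'] --> l.
  move/deriv_atP: H; rewrite scale0r addr0.
  by under eq_fun do rewrite add0r.
apply: (deriv_at_unique (c := fun h => f (a + h *: v)) (t := 0)) => //.
apply/deriv_atP; rewrite scale0r addr0; under eq_fun do rewrite add0r.
by have := @xgetPex _ 0 [set l | h^-1 *: (f (a + h *: v) - f a) @[h --> (0 : R)^'] --> l]
  (ex_intro _ l lim_l).
Qed.

Lemma ddir_near V W (f f' : V -> W) a v :
  (exists2 e : R, 0 < e & forall h, `|h| < e -> f (a + h *: v) = f' (a + h *: v)) ->
  ddir f a v = ddir f' a v.
Proof.
move=> [e e0 ff']; rewrite /ddir; congr xget; apply/seteqP; split=> l /=.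
  move=> H; apply: cvg_trans H; apply: near_eq_cvg; exists e => // h /=.
  rewrite sub0r normrN => he _; rewrite ff'//.
  by have := ff' 0; rewrite normr0 => /(_ e0); rewrite scale0r addr0 => ->.
move=> H; apply: cvg_trans H; apply: near_eq_cvg; exists e => // h /=.
rewrite sub0r normrN => he _; rewrite ff'//.
by have := ff' 0; rewrite normr0 => /(_ e0); rewrite scale0r addr0 => ->.
Qed.

(** Some continuous seminorm is positive at [w], so the difference quotients of [h] are Cauchy
    because their multiples by [w] converge. The derivative of the curve is then again a scalar
    curve times [w], and the class is stable. *)
Lemma smooth_curve_scalar V (w : V) (h : R -> R^o) : hausdorff_space V -> w != 0 ->
  smooth_curve (fun t => h t *: w) -> smooth_curve h.
Proof.
move=> hV w0 sh; have [p hp pw] : exists2 p, csn p & 0 < p w.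
  apply: contrapT => H; move/eqP: w0; apply; apply: csn_eq0 => // p hp.
  apply/eqP; rewrite eq_le csn_ge0// andbT leNgt; apply/negP => pw.
  by apply: H; exists p.
apply/smooth_curveE; apply: (@smooth_in_coind _ _ _
  [set h : R -> R^o | smooth_curve (fun t => h t *: w)]) sh => {}h /= sh.
have [c' sc' dc] := smooth_curve_deriv sh.
have ex t : {k : R^o | deriv_at h t k /\ c' t = k *: w}.
  apply/cid; pose Q s := s^-1 * (h (t + s) - h t).
  have cQ : cvg (Q s @[s --> (0 : R)^']).
    apply: cauchy_cvg; apply: cauchy_exP => e e0.
    have e30 : 0 < e / 3 * p w by rewrite mulr_gt0// divr_gt0.
    have [d d0 Hd] := dc t p hp _ e30.
    have key s : `|s| < d -> s != 0 -> p (Q s *: w - c' t) <= e / 3 * p w.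
      move=> sd s0; have := Hd s sd; rewrite -scalerBl.
      have -> : (h (t + s) - h t) *: w - s *: c' t = s *: (Q s *: w - c' t).
        by rewrite scalerBr scalerA /Q mulrA divff// mul1r.
      by rewrite (csnZ hp) mulrC ler_pM2r ?normr_gt0.
    have d20 : d / 2 != 0 by rewrite gt_eqF// divr_gt0.
    have dd : `|d / 2| < d by rewrite gtr0_norm ?divr_gt0//; lra.
    exists (Q (d / 2)); exists d => // s /=; rewrite sub0r normrN => sd s0.
    have k1 := key _ dd d20; have k2 := key _ sd s0.
    have := csn_tri hp (Q (d / 2) *: w) (c' t) (Q s *: w).
    have := csn_tri hp (c' t) (Q (d / 2) *: w) (Q s *: w).
    rewrite -scalerBl (csnZ hp) (csnBC hp (c' t) (Q s *: w)) => k3 _.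
    have : `|Q (d / 2) - Q s| * p w <= (e / 3 + e / 3) * p w by rewrite mulrDl; lra.
    rewrite ler_pM2r// => k4; rewrite -ball_normE /=; lra.
  have dk : deriv_at h t (lim (Q s @[s --> (0 : R)^']) : R^o) by apply/deriv_atP.
  exists (lim (Q s @[s --> (0 : R)^'])); split => //.
  apply: deriv_at_unique (dc t) _ => //.
  by have := deriv_at_scale dk (deriv_at_cst w t); rewrite scaler0 addr0.
exists (fun t => sval (ex t)); last by move=> t _; case: (svalP (ex t)).
rewrite /= (_ : (fun t => _) = c')//; apply/funext => t.
by case: (svalP (ex t)).
Qed.

Section OnManifold.
Context (M : manifold R).
Implicit Types (U : set M) (f : M -> R^o) (x : M).

Lemma line_deriv W U (f : M -> W) x (w : tangent M x) : mopen U -> U x ->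
  msmooth U f -> exists l, deriv_at (fun h => f (line (w : model (chart_at x)) h)) 0 l.
Proof.
move=> oU Ux /msmoothP sf; have [e e0 [eU ep]] := line_plot (w : model (chart_at x)) oU Ux.
have /smooth_in_deriv[c' _ dc] : smooth_in [set t : R | `|t - 0| < e]
    (fun h => f (line (w : model (chart_at x)) h)).
  apply: smooth_in_reparam => // phi sphi phiP.
  have phiP' s : `|phi s| < e by have := phiP s; rewrite subr0.
  by apply: (sf (fun s => line _ (phi s))); [exact: ep|move=> s; exact: eU].
by exists (c' 0); apply: dc; rewrite /= subrr normr0.
Qed.

Lemma ddir_line W U (f : M -> W) x (w : tangent M x) : hausdorff_space W ->
  mopen U -> U x -> msmooth U f ->
  deriv_at (fun h => f (line (w : model (chart_at x)) h)) 0
    (ddir (f \o param (chart_at x)) (chart (chart_at x) x) (w : model (chart_at x))).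
Proof.
move=> hW oU Ux sf; have [l dl] := line_deriv w oU Ux sf.
by rewrite (ddirP (l := l)).
Qed.

Lemma ddir_line_near W U (f f' : M -> W) x (w : tangent M x) :
  mopen U -> U x -> (forall y, U y -> f y = f' y) ->
  ddir (f \o param (chart_at x)) (chart (chart_at x) x) (w : model (chart_at x)) =
  ddir (f' \o param (chart_at x)) (chart (chart_at x) x) (w : model (chart_at x)).
Proof.
move=> oU Ux ff'; apply: ddir_near.
have [e e0 [eU _]] := line_plot (w : model (chart_at x)) oU Ux.
by exists e => // h he; apply: ff'; exact: eU.
Qed.

Section VectorDerivative.
Context (U : set M) (x : M) (oU : mopen U) (Ux : U x) (X : tangent M x).

Lemma vderP f : msmooth U f ->
  deriv_at (fun h => f (line (X : model (chart_at x)) h)) 0 (vder f X : R^o).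
Proof. by apply: ddir_line => //; exact: norm_hausdorff. Qed.

Lemma vder_unique f (l : R^o) : deriv_at (fun h => f (line (X : model (chart_at x)) h)) 0 l ->
  vder f X = l.
Proof. by apply: (@ddirP (model (chart_at x))); exact: norm_hausdorff. Qed.

Lemma vder_eq f f' : (forall y, U y -> f y = f' y) -> vder f X = vder f' X.
Proof. exact: ddir_line_near. Qed.

Lemma vderD f f' : msmooth U f -> msmooth U f' ->
  vder (fun y => f y + f' y) X = vder f X + vder f' X.
Proof. by move=> sf sf'; apply: vder_unique; apply: deriv_atD; exact: vderP. Qed.

Lemma vderM f f' : msmooth U f -> msmooth U f' ->
  vder (fun y => f y * f' y) X = vder f X * f' x + f x * vder f' X.
Proof.
move=> sf sf'; apply: vder_unique; have := deriv_at_scale (vderP sf) (vderP sf').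
by rewrite !line0.
Qed.

Lemma vderZ a f : msmooth U f -> vder (fun y => a * f y) X = a * vder f X.
Proof. by move=> sf; apply: vder_unique; apply: deriv_atZ; exact: vderP. Qed.

Lemma vderN f : msmooth U f -> vder (fun y => - f y) X = - vder f X.
Proof.
move=> sf; rewrite -mulN1r -vderZ//.
by congr (vder _ X); apply/funext => y; rewrite mulN1r.
Qed.

End VectorDerivative.

Lemma vder0 f x : vder f (0 : tangent M x) = 0.
Proof.
apply: vder_unique; rewrite /line.
have := deriv_at_cst (f (param (chart_at x) (chart (chart_at x) x))) 0.
by congr deriv_at; apply/funext => h; rewrite scaler0 addr0.
Qed.

Lemma msmoothD U f f' : msmooth U f -> msmooth U f' -> msmooth U (fun y => f y + f' y : R^o).
Proof.
move=> /msmoothP sf /msmoothP sf'; apply/msmoothP => g pg gU.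
by apply: smooth_curveD; [exact: sf|exact: sf'].
Qed.

Lemma msmoothM U f f' : msmooth U f -> msmooth U f' -> msmooth U (fun y => f y * f' y : R^o).
Proof.
move=> /msmoothP sf /msmoothP sf'; apply/msmoothP => g pg gU.
by apply: smooth_curveM; [exact: sf|exact: sf'].
Qed.

Lemma msmoothN U f : msmooth U f -> msmooth U (fun y => - f y : R^o).
Proof.
move=> /msmoothP sf; apply/msmoothP => g pg gU.
by apply: smooth_curveN; exact: sf.
Qed.

Lemma msmooth_subset W U U' (f : M -> W) : U' `<=` U -> msmooth U f -> msmooth U' f.
Proof. by move=> VU /msmoothP sf; apply/msmoothP => g pg gV; apply: sf => // t; exact: VU. Qed.

Lemma same_jet1_near (E : bundle_data M) U x (s s' : section E) : mopen U -> U x ->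
  (forall y, U y -> s y = s' y) -> same_jet1 x s s'.
Proof.
move=> oU Ux ss'; split=> [|i ix v]; first exact: ss'.
apply: (@ddir_line_near (vfib E i) U (fun y => triv E i y (s y)) (fun y => triv E i y (s' y)) x) => //.
by move=> y /ss' ->.
Qed.

(* By Hadamard's lemma a section with vanishing 1-jet is [h] times a smooth
   section vanishing at [h = 0] along every coordinate line, so that its image
   under a fibrewise linear smooth map has vanishing derivative. *)
Lemma same_jet1_linear (D : bundle_data M) W U x (Phi : forall y, D y -> W)
    (d d' : section D) (w : tangent M x) :
  is_vbundle D -> hausdorff_space W -> mopen U -> U x ->
  (forall y, U y -> linear (Phi y)) ->
  (forall g (s : forall t, D (g t)), plot g -> (forall t, U (g t)) ->
    smooth_along s -> smooth_curve (fun t => Phi (g t) (s t))) ->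
  smooth_section U d -> smooth_section U d' -> same_jet1 x d d' ->
  ddir ((fun y => Phi y (d y)) \o param (chart_at x)) (chart (chart_at x) x) (w : model (chart_at x)) =
  ddir ((fun y => Phi y (d' y)) \o param (chart_at x)) (chart (chart_at x) x) (w : model (chart_at x)).
Proof.
move=> vD hW oU Ux lPhi sPhi sd sd' [dx jets].
have [i ix] := vdom_cover vD x.
pose U' := U `&` vdom D i.
have oU' : mopen U' by apply: mopenI => //; exact: (vdom_open vD).
have Ux' : U' x by [].
have [e e0 [eU ep]] := line_plot (w : model (chart_at x)) oU' Ux'.
have [sigma [psi [tau [[ssigma _] sK _ s0 dsigma]]]] := smooth_diffeo R.
have [tau0 dsigma0] := dsigma 0.
pose phi s : R^o := e * sigma s.
have sphi : smooth_curve phi by apply: smooth_curveM => //; exact: smooth_curve_cst.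
have phi0 : phi 0 = 0 by rewrite /phi s0 mulr0.
(* The coordinate line is reparametrized by [phi] so as to stay in [U'] for all times; [k] is its
   speed at 0, cancelled at the end because it is nonzero. *)
pose k : R^o := e * (tau 0)^-1.
have k0 : k != 0 by rewrite gt_eqF// mulr_gt0// invr_gt0.
have dphi : deriv_at phi 0 k by exact: deriv_atZ.
have phiP s : `|phi s| < e.
  by rewrite /phi normrM gtr0_norm// gtr_pMr//; have [] := sK s.
pose g s := line (w : model (chart_at x)) (phi s).
have pg : plot g by exact: ep.
have gU s : U' (g s) by exact: eU.
have g0 : g 0 = x by rewrite /g phi0 line0.
have chain (Z : tvsType R) (f : M -> Z) l : deriv_at (fun h => f (line (w : model (chart_at x)) h)) 0 l ->
    deriv_at (f \o g) 0 (k *: l).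
  move=> H; apply: (@deriv_at_comp _ _ (fun h => f (line _ h)) phi) => //.
  by rewrite phi0.
have sub : U' `<=` U by move=> y [].
have al := (@smooth_sectionP _ _ D U d).1 sd g pg (fun t => (gU t).1).
have al' := (@smooth_sectionP _ _ D U d').1 sd' g pg (fun t => (gU t).1).
pose q s := triv D i (g s) (d (g s)) - triv D i (g s) (d' (g s)).
have sq : smooth_curve q.
  by apply: smooth_curveB; apply: smooth_along_triv => // t; exact: (gU t).2.
have q0 : q 0 = 0 by rewrite /q g0 dx subrr.
have hDi : hausdorff_space (vfib D i) by exact: vfib_hausdorff.
have dq : deriv_at q 0 0.
  have sm : msmooth U' (fun y => triv D i y (d y)) by exact: sd.
  have sm' : msmooth U' (fun y => triv D i y (d' y)) by exact: sd'.
  have H1 := chain _ _ _ (ddir_line w hDi oU' Ux' sm).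
  have H2 := chain _ _ _ (ddir_line w hDi oU' Ux' sm').
  have := deriv_atD H1 (deriv_atZ (-1) H2).
  rewrite (jets i ix w) scaleN1r subrr; congr deriv_at.
  by apply/funext => s; rewrite scaleN1r.
have [delta sdelta qE] := hadamard sq q0.
(* The value [delta 0] is the derivative of [q] at 0, and this vanishes since the 1-jets agree. *)
have delta0 : delta 0 = 0.
  apply: (deriv_at_unique (c := q) (t := 0)) => //.
  have [delta' _ ddelta] := smooth_curve_deriv sdelta.
  have := deriv_at_scale (deriv_at_id 0) (ddelta 0).
  rewrite scale1r scale0r addr0; congr deriv_at.
  by apply/funext => s; rewrite qE.
pose K s := Phi (g s) (untriv D i (g s) (delta s)).
have sK' : smooth_curve K.
  apply: (sPhi g (fun s => untriv D i (g s) (delta s))) => //.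
    by move=> t; exact: (gU t).1.
  by apply: smooth_along_untriv => // t; exact: (gU t).2.
have K0 : K 0 = 0.
  rewrite /K delta0 (linfun0 (untriv_linear vD _)); last exact: (gU 0).2.
  by rewrite (linfun0 (lPhi _ _))//; exact: (gU 0).1.
have KE s : Phi (g s) (d (g s)) - Phi (g s) (d' (g s)) = s *: K s.
  rewrite /K -(linfunZ (lPhi _ (gU s).1)) -(linfunZ (untriv_linear vD (gU s).2)).
  rewrite -qE /q -(linfunB (triv_linear vD (gU s).2)) (trivK vD (gU s).2).
  by rewrite (linfunB (lPhi _ (gU s).1)).
have smPhi s : smooth_section U s -> msmooth U (fun y => Phi y (s y)).
  move=> ss; apply/msmoothP => g' pg' gU'.
  by apply: sPhi => //; have /smooth_sectionP := ss; exact.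
have H1 := chain _ _ _ (ddir_line w hW oU Ux (smPhi _ sd)).
have H2 := chain _ _ _ (ddir_line w hW oU Ux (smPhi _ sd')).
move: H1 H2; set l1 := ddir _ _ _; set l2 := ddir _ _ _ => H1 H2.
have [K' _ dK] := smooth_curve_deriv sK'.
have H3 := deriv_at_scale (deriv_at_id 0) (dK 0).
have H4 := deriv_atD H1 (deriv_atZ (-1) H2).
have : k *: l1 + -1 *: (k *: l2) = 1 *: K 0 + 0 *: K' 0.
  apply: deriv_at_unique H4 _ => //; move: H3; congr deriv_at.
  by apply/funext => s; rewrite /= scaleN1r KE.
rewrite K0 scaler0 scale0r addr0 scaleN1r -scalerBr => /eqP.
by rewrite scaler_eq0 (negbTE k0) subr_eq0 => /eqP.
Qed.

End OnManifold.
End Derivations.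

(** * Lie algebroids *)

Section Sections.
Context (R : realType) (M : manifold R).
Implicit Types (E F : bundle_data M) (U V : set M).

Lemma smooth_section_subset E U V (s : section E) : V `<=` U ->
  smooth_section U s -> smooth_section V s.
Proof.
by move=> VU ss i; apply: msmooth_subset (ss i) => y [/VU].
Qed.

Lemma smooth_section_lin E U (f : M -> R^o) (r s : section E) : is_vbundle E ->
  msmooth U f -> smooth_section U r -> smooth_section U s ->
  smooth_section U (fun y => f y *: r y + s y).
Proof.
move=> vE /msmoothP sf sr ss i; apply/msmoothP => g pg gU.
have /msmoothP/(_ g pg gU) H1 := sr i; have /msmoothP/(_ g pg gU) H2 := ss i.
have /= := smooth_curveD (smooth_curve_scale (sf g pg (fun t => (gU t).1)) H1) H2.
congr smooth_curve; apply/funext => t /=.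
by rewrite (triv_linear vE (gU t).2).
Qed.

Lemma smooth_section0 E U : is_vbundle E -> @smooth_section R M E U (fun=> 0).
Proof.
move=> vE i; apply/msmoothP => g pg gU.
have := smooth_curve_cst (0 : vfib E i); congr smooth_curve; apply/funext => t /=.
by rewrite (linfun0 (triv_linear vE (gU t).2)).
Qed.

Lemma msmooth_cst (V : tvsType R) U (v : V) : @msmooth R M V U (fun=> v).
Proof. by apply/msmoothP => g _ _; exact: smooth_curve_cst. Qed.

Lemma smooth_sectionZ E U (f : M -> R^o) (s : section E) : is_vbundle E ->
  msmooth U f -> smooth_section U s -> smooth_section U (fun y => f y *: s y).
Proof.
move=> vE sf ss; have := smooth_section_lin vE sf ss (@smooth_section0 E U vE).
by congr smooth_section; apply/functional_extensionality_dep => y; rewrite addr0.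
Qed.

Lemma smooth_section_untriv E i (w : vfib E i) : is_vbundle E ->
  smooth_section (vdom E i) (fun y => untriv E i y w).
Proof.
move=> vE; apply/smooth_sectionP => g pg gU.
by apply: smooth_along_untriv => //; exact: smooth_curve_cst.
Qed.

(** The section is constant in a trivialization, hence only local: smooth bump functions extending
    it may fail to exist on a convenient manifold. This is why test sections live on smaller open
    sets [V]. *)
Lemma section_through E U x (u : E x) : is_vbundle E -> mopen U -> U x ->
  exists V (s : section E), [/\ mopen V, V `<=` U, V x, smooth_section V s & s x = u].
Proof.
move=> vE oU Ux; have [i ix] := vdom_cover vE x.
exists (U `&` vdom E i), (fun y => untriv E i y (triv E i x u)); split => //.
- by apply: mopenI => //; exact: (vdom_open vE).
- by apply: smooth_section_subset (smooth_section_untriv _ vE) => y [].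
- exact: (trivK vE ix).
Qed.
End Sections.

Section Algebroid.
Context (R : realType) (M : manifold R) (E : bundle_data M)
  (rho : forall x, E x -> tangent M x) (br : section_bracket E)
  (hE : is_lie_algebroid rho br).
Implicit Types (U V : set M) (r s t : section E) (f : M -> R^o).

Let vE : is_vbundle E := algebroid_vbundle hE.
Let lrho x : linear (@rho x) := (algebroid_anchor hE).1 x.

(** Local sections are represented by total families, and the bracket takes them as such; dependence
    on 1-jets alone makes it insensitive to values away from [x]. *)
Lemma bracket_local U V r r' s s' x : mopen U -> mopen V -> V `<=` U -> V x ->
  smooth_section U r -> smooth_section U r' -> smooth_section U s -> smooth_section U s' ->
  (forall y, V y -> r y = r' y) -> (forall y, V y -> s y = s' y) ->
  br U r s x = br U r' s' x.
Proof.
move=> oU oV VU Vx sr sr' ss ss' rr' ss'E; apply: (bracket_jet1 hE) => //.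
- exact: VU.
- exact: same_jet1_near rr'.
- exact: same_jet1_near ss'E.
Qed.

Lemma bracket0 U s x : mopen U -> smooth_section U s -> U x -> br U (fun=> 0) s x = 0.
Proof.
move=> oU ss Ux; have s0 := @smooth_section0 R M E U vE.
have := bracket_linear hE 1 oU s0 s0 ss Ux; rewrite scale1r.
rewrite (_ : (fun y => 1 *: 0 + 0) = (fun=> 0) :> section E); last first.
  by apply/functional_extensionality_dep => y; rewrite scale1r addr0.
by move=> /eqP; rewrite -subr_eq subrr eq_sym => /eqP.
Qed.

Lemma bracketN U r s x : mopen U -> smooth_section U r -> smooth_section U s -> U x ->
  br U (fun y => - r y) s x = - br U r s x.
Proof.
move=> oU sr ss Ux; have s0 := @smooth_section0 R M E U vE.
have := bracket_linear hE (-1) oU sr s0 ss Ux; rewrite bracket0// addr0 scaleN1r => <-.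
by congr (br U _ s x); apply/functional_extensionality_dep => y; rewrite scaleN1r addr0.
Qed.

(** The Jacobi identity arranged so that [v] is always the last argument, the form in which its
    terms occur under a pairing in the Jacobiator. *)
Lemma bracket_jacobiE U r s v x : mopen U -> smooth_section U r -> smooth_section U s ->
  smooth_section U v -> U x ->
  br U s (br U r v) x - br U r (br U s v) x + br U (br U r s) v x = 0.
Proof.
move=> oU sr ss sv Ux; have := bracket_jacobi hE oU sr ss sv Ux.
have bs := bracket_smooth hE oU.
rewrite [br U v (br U r s) x](bracket_antisym hE)//; last exact: bs.
have -> : br U s (br U v r) x = - br U s (br U r v) x.
  rewrite (bracket_antisym hE)//; last exact: bs.
  rewrite [br U s (br U r v) x](bracket_antisym hE)//; last exact: bs.
  rewrite opprK -bracketN//; last exact: bs.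
  apply: (@bracket_local U U) => //; try exact: bs.
    have := smooth_sectionZ vE (@msmooth_cst R M R^o U (-1)) (bs _ _ sv sr).
    by congr smooth_section; apply/functional_extensionality_dep => y; rewrite scaleN1r.
  by move=> y Uy; rewrite (bracket_antisym hE)// opprK.
move=> H; apply/eqP; rewrite -oppr_eq0 -H !opprD !opprK; apply/eqP; congr (_ - _).
by rewrite addrC.
Qed.

(* Linearity of the directional derivative in the direction would require the
   chain rule of convenient calculus; along the image of the anchor it follows
   from the Leibniz rule and the linearity of the bracket in its first argument. *)
Lemma vder_anchor_linear U f x a (u u' : E x) : mopen U -> U x -> msmooth U f ->
  vder f (rho (a *: u + u')) = a * vder f (rho u) + vder f (rho u').
Proof.
move=> oU Ux sf; have [i ix] := vdom_cover vE x.
(* Over a zero fibre the Leibniz rule carries no information, but there [u] and [u'] vanish as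
   well. *)
have [H|[w w0]] : (forall w : vfib E i, w = 0) \/ exists w : vfib E i, w != 0.
  have [|H] := pselect (exists w : vfib E i, w != 0); [by right|left => w].
  by apply: contrapT => /eqP w0; apply: H; exists w.
  have z (v : E x) : v = 0.
    by apply: (can_inj (trivK vE ix)); rewrite [LHS]H [RHS]H.
  rewrite (z u) (z u') scaler0 addr0 (linfun0 (lrho (x := x))) vder0; ring.
pose V := U `&` vdom E i.
have oV : mopen V by apply: mopenI => //; exact: (vdom_open vE).
have Vx : V x by [].
have VU : V `<=` U by move=> y [].
pose c w' : section E := fun y => untriv E i y w'.
have sc w' : smooth_section V (c w').
  by apply: smooth_section_subset (smooth_section_untriv _ vE) => y [].
have sfV : msmooth V f := msmooth_subset VU sf.
pose r := c (triv E i x u); pose r' := c (triv E i x u').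
have rx : r x = u by exact: (trivK vE ix).
have r'x : r' x = u' by exact: (trivK vE ix).
have sfc : smooth_section V (fun y => f y *: c w y) by exact: smooth_sectionZ.
have srr : smooth_section V (fun y => a *: r y + r' y).
  exact: (smooth_section_lin vE (@msmooth_cst R M R^o V a) (sc _) (sc _)).
have sr : smooth_section V r by exact: sc.
have sr' : smooth_section V r' by exact: sc.
(* Expanding both sides by the Leibniz rule, the bracket terms cancel and leave the claim multiplied
   by the nonzero vector [c w x]. *)
have := bracket_linear hE a oV sr sr' sfc Vx.
rewrite (bracket_leibniz hE oV sfV srr (sc w) Vx) (bracket_leibniz hE oV sfV sr (sc w) Vx).
rewrite (bracket_leibniz hE oV sfV sr' (sc w) Vx) (bracket_linear hE a oV sr sr' (sc w) Vx).
rewrite rx r'x.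
move: (vder f (rho u)) (vder f (rho u')) (vder f _) => A B C.
rewrite !scalerDr !scalerA [a * f x]mulrC [X in _ = X -> _]addrACA => /addrI.
rewrite -scalerDl => /eqP; rewrite -subr_eq0 -scalerBl scaler_eq0 subr_eq0.
case/orP => [/eqP//|/eqP cw]; case/eqP: w0.
by rewrite -[LHS](untrivK vE ix) -/(c w x) cw (linfun0 (triv_linear vE ix)).
Qed.

Lemma vder_anchorZ U f x a (u : E x) : mopen U -> U x -> msmooth U f ->
  vder f (rho (a *: u)) = a * vder f (rho u).
Proof.
move=> oU Ux sf; have := vder_anchor_linear a u 0 oU Ux sf.
by rewrite addr0 (linfun0 (lrho (x := x))) vder0 addr0.
Qed.

(* If [w] is a nonvanishing constant section, the difference of
   [br s (f w)] and [f (br s w)] is the smooth section [df(rho s) w]. *)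
Lemma vder_anchor_smooth U f s : mopen U -> msmooth U f -> smooth_section U s ->
  msmooth U (fun y => vder f (rho (s y)) : R^o).
Proof.
move=> oU sf ss; apply/msmoothP => g pg gU.
apply: (plot_local (@norm_hausdorff _ _) pg) => t0.
have [i ix] := vdom_cover vE (g t0).
exists (vdom E i); split => //; first exact: (vdom_open vE).
move=> phi sphi ip; have pgp := plot_comp pg sphi.
have [H|[w w0]] : (forall w : vfib E i, w = 0) \/ exists w : vfib E i, w != 0.
  have [|H] := pselect (exists w : vfib E i, w != 0); [by right|left => w].
  by apply: contrapT => /eqP w0; apply: H; exists w.
  have := smooth_curve_cst (0 : R^o); congr smooth_curve; apply/funext => t /=.
  rewrite (_ : s _ = 0) ?(linfun0 (lrho (x := _))) ?vder0//.
  by apply: (can_inj (trivK vE (ip t))); rewrite [LHS]H [RHS]H.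
pose V := U `&` vdom E i.
have oV : mopen V by apply: mopenI => //; exact: (vdom_open vE).
have VU : V `<=` U by move=> y [].
pose c : section E := fun y => untriv E i y w.
have sc : smooth_section V c.
  by apply: smooth_section_subset (smooth_section_untriv _ vE) => y [].
have sfV : msmooth V f := msmooth_subset VU sf.
have ssV : smooth_section V s := smooth_section_subset VU ss.
have sfc : smooth_section V (fun y => f y *: c y) by exact: smooth_sectionZ.
have gV (t : R) : V ((g \o phi) t) by split; [exact: gU|exact: ip].
have alg r : smooth_section V r -> smooth_curve (fun t : R => triv E i (g (phi t)) (r (g (phi t)))).
  by move=> /smooth_sectionP/(_ _ pgp gV)/smooth_along_triv; exact.
have A := alg _ (bracket_smooth hE oV ssV sfc).
have B := alg _ (bracket_smooth hE oV ssV sc).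
have /msmoothP/(_ _ pgp gV) fs := sfV.
apply: (smooth_curve_scalar (@vfib_hausdorff R M E vE i) w0).
have := smooth_curveB A (smooth_curve_scale fs B).
congr smooth_curve; apply/funext => t /=.
rewrite (bracket_leibniz hE)// (linfunD (triv_linear vE (ip t))).
rewrite !(linfunZ (triv_linear vE (ip t))) [_ *: _ + _]addrC addrK.
by rewrite /c (untrivK vE (ip t)).
Qed.
End Algebroid.

(** * The Courant bracket on an almost Dirac structure *)

Section CourantBracket.
Context (R : realType) (M : manifold R) (E : bundle_data M)
  (rho : forall x, E x -> tangent M x) (br : section_bracket E)
  (hE : is_lie_algebroid rho br)
  (F : bundle_data M) (iota : forall x, F x -> dual_bundle E x)
  (hF : is_weak_subbundle iota)
  (D : bundle_data M) (kappa : forall x, D x -> whitney_sum E F x)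
  (hD : is_partial_almost_dirac iota kappa).
Implicit Types (U V : set M) (s : section E) (a : section F) (e : section D).

Let vE : is_vbundle E := algebroid_vbundle hE.
Let vF : is_vbundle F. Proof. by case: hF. Qed.
Let mi : is_morphism iota. Proof. by case: hF. Qed.
Let vD : is_vbundle D. Proof. by case: hD => -[[]]. Qed.
Let mk : is_morphism kappa. Proof. by case: hD => -[[]]. Qed.
Let lk x : linear (@kappa x) := mk.1 x.

Let P x (p : F x) (u : E x) : R^o := pairing iota p u.
Let X s (f : M -> R^o) : M -> R^o := fun y => vder f (rho (s y)).
Let r e : section E := fun y => (kappa (e y)).1.
Let al e : section F := fun y => (kappa (e y)).2.
Let Q a s : M -> R^o := fun y => P (a y) (s y).

Let P_lin x (p : F x) : linear (P p).
Proof.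
move=> k u v; rewrite /P /pairing.
by case: (iota p) => f /= /bdual_predP[lf _]; exact: lf.
Qed.

Let P_linl x (u : E x) : linear ((@P x)^~ u).
Proof. by move=> k p q; rewrite /P /pairing (mi.1 x). Qed.

Let Q_smooth U a s : smooth_section U a -> smooth_section U s -> msmooth U (Q a s).
Proof.
move=> /smooth_sectionP sa /smooth_sectionP ss; apply/msmoothP => g pg gU.
by apply: (@pairing_smooth _ _ E F iota g (fun t => a (g t)) (fun t => s (g t))) => //;
  [exact: sa|exact: ss].
Qed.

Let X_smooth U s f : mopen U -> smooth_section U s -> msmooth U f -> msmooth U (X s f).
Proof. by move=> oU ss sf; exact: (vder_anchor_smooth hE). Qed.

Let r_smooth U e : smooth_section U e -> smooth_section U (r e).
Proof.
move=> /smooth_sectionP se; apply/smooth_sectionP => g pg gU.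
exact: (whitney_fst vE vF vD mk pg (se g pg gU)).
Qed.

Let al_smooth U e : smooth_section U e -> smooth_section U (al e).
Proof.
move=> /smooth_sectionP se; apply/smooth_sectionP => g pg gU.
exact: (whitney_snd vE vF vD mk pg (se g pg gU)).
Qed.

Lemma dirac_isotropic x (d d' : D x) :
  P (kappa d).2 (kappa d').1 = - P (kappa d').2 (kappa d).1.
Proof.
have : range (@kappa x) (kappa d') by exists d'.
rewrite (hD.2 x) => /(_ d); rewrite /sym_pairing => /eqP.
by rewrite addr_eq0 => /eqP.
Qed.

Let QN e e' : Q (al e) (r e') = fun y => - Q (al e') (r e) y.
Proof. by apply/funext => y; exact: dirac_isotropic. Qed.

Lemma dirac_ext U x (d d' : D x) : mopen U -> U x ->
  (kappa d).1 = (kappa d').1 ->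
  (forall V v, mopen V -> V `<=` U -> V x -> smooth_section V v ->
    P (kappa d).2 (v x) = P (kappa d').2 (v x)) -> d = d'.
Proof.
move=> oU Ux k1 k2; have [[[_ _ ik] _] _] := hD; apply: (ik x).
rewrite [LHS]surjective_pairing [RHS]surjective_pairing k1; congr pair.
have [_ _ ii] := hF; apply: (ii x); apply: val_inj; apply/funext => u.
have [V [v [oV VU Vx sv <-]]] := section_through u vE oU Ux.
exact: (k2 V v oV VU Vx sv).
Qed.

Let r_lin (f : M -> R^o) e e' :
  r (fun y => f y *: e y + e' y) = fun y => f y *: r e y + r e' y.
Proof. by apply/functional_extensionality_dep => y; rewrite /r (lk (x := y)). Qed.

Let al_lin (f : M -> R^o) e e' :
  al (fun y => f y *: e y + e' y) = fun y => f y *: al e y + al e' y.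
Proof. by apply/functional_extensionality_dep => y; rewrite /al (lk (x := y)). Qed.

Let Q_linl (f : M -> R^o) a a' s :
  Q (fun y => f y *: a y + a' y) s = fun y => f y * Q a s y + Q a' s y.
Proof. by apply/funext => y; rewrite /Q (P_linl (s y)). Qed.

(** The five functions stand for the summands of [courant_snd], whose right-hand side has to be
    differentiated for the Jacobi identity. *)
Let vder_courant U x (Z : tangent M x) (q1 q2 q3 q4 q5 : M -> R^o) :
  mopen U -> U x -> msmooth U q1 -> msmooth U q2 -> msmooth U q3 ->
  msmooth U q4 -> msmooth U q5 ->
  vder (fun y => q1 y - q2 y - (q3 y - q4 y) + q5 y) Z =
  vder q1 Z - vder q2 Z - (vder q3 Z - vder q4 Z) + vder q5 Z.
Proof.
move=> oU Ux s1 s2 s3 s4 s5.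
have s12 := msmoothD s1 (msmoothN s2); have s34 := msmoothD s3 (msmoothN s4).
rewrite (vderD oU Ux _ (msmoothD s12 (msmoothN s34)) s5).
rewrite (vderD oU Ux _ s12 (msmoothN s34)) (vderN oU Ux _ s34).
rewrite (vderD oU Ux _ s1 (msmoothN s2)) (vderD oU Ux _ s3 (msmoothN s4)).
by rewrite (vderN oU Ux _ s2) (vderN oU Ux _ s4).
Qed.

(** * Algebroid identities for a smooth bracket on [D] restricting the Courant bracket *)

Section Bracket.
Context (brD : section_bracket D)
  (sD : forall U e1 e2, mopen U -> smooth_section U e1 -> smooth_section U e2 ->
    smooth_section U (brD U e1 e2))
  (cD : restricts_courant rho br iota kappa brD).

Lemma courant_fst U e1 e2 x : mopen U -> smooth_section U e1 -> smooth_section U e2 ->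
  U x -> r (brD U e1 e2) x = br U (r e1) (r e2) x.
Proof. by move=> oU s1 s2 Ux; have [H _] := cD oU s1 s2; exact: H. Qed.

Lemma courant_snd U V e1 e2 v x : mopen U -> smooth_section U e1 -> smooth_section U e2 ->
  mopen V -> V `<=` U -> smooth_section V v -> V x ->
  Q (al (brD U e1 e2)) v x =
  X (r e1) (Q (al e2) v) x - Q (al e2) (br V (r e1) v) x
  - (X (r e2) (Q (al e1) v) x - Q (al e1) (br V (r e2) v) x)
  + X v (Q (al e1) (r e2)) x.
Proof.
move=> oU s1 s2 oV VU sv Vx; have [_ H] := cD oU s1 s2.
rewrite [LHS](H V v)//; congr (_ - _ + _).
have s1V := smooth_section_subset VU s1; have s2V := smooth_section_subset VU s2.
(* Isotropy makes the two pairings opposite; the resulting factor 2 cancels the one half of the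
   Courant bracket. *)
have -> : (fun y => pairing iota (al e1 y) (r e2 y) - pairing iota (al e2 y) (r e1 y)) =
    (fun y => 2 * Q (al e1) (r e2) y).
  apply/funext => y; rewrite -[pairing iota (al e2 y) _]/(Q (al e2) (r e1) y).
  by rewrite QN opprK -[pairing _ _ _]/(Q (al e1) (r e2) y) mulr_natl mulr2n.
have sQ : msmooth V (Q (al e1) (r e2)).
  by apply: Q_smooth; [exact: al_smooth|exact: r_smooth].
by rewrite (vderZ oV Vx)// mulrA mulVf ?mul1r// pnatr_eq0.
Qed.

(** Nothing relates [brD] on different open sets a priori; the agreement comes from [dirac_ext], as
    both values have the same components. *)
Lemma brD_restrict U V e1 e2 x : mopen U -> mopen V -> V `<=` U ->
  smooth_section U e1 -> smooth_section U e2 -> V x -> brD V e1 e2 x = brD U e1 e2 x.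
Proof.
move=> oU oV VU s1 s2 Vx.
have s1V := smooth_section_subset VU s1; have s2V := smooth_section_subset VU s2.
apply: (dirac_ext oV Vx) => [|W v oW WV Wx sv].
  have := courant_fst oV s1V s2V Vx; rewrite /r => ->.
  have := courant_fst oU s1 s2 (VU _ Vx); rewrite /r => ->.
  by apply: (bracket_restrict hE) => //; exact: r_smooth.
have := courant_snd oV s1V s2V oW WV sv Wx; rewrite /Q => ->.
by have := courant_snd oU s1 s2 oW (subset_trans WV VU) sv Wx; rewrite /Q => ->.
Qed.

Lemma brD_antisym U e1 e2 x : mopen U -> smooth_section U e1 -> smooth_section U e2 ->
  U x -> brD U e1 e2 x = - brD U e2 e1 x.
Proof.
move=> oU s1 s2 Ux; apply: (dirac_ext oU Ux) => [|V v oV VU Vx sv].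
  rewrite (linfunN (lk (x := x))) /=.
  have := courant_fst oU s1 s2 Ux; rewrite /r => ->.
  have := courant_fst oU s2 s1 Ux; rewrite /r => ->.
  by apply: (bracket_antisym hE) => //; exact: r_smooth.
rewrite (linfunN (lk (x := x))) /= (linfunN (P_linl _)).
have := courant_snd oU s1 s2 oV VU sv Vx; rewrite {1}/Q => ->.
have := courant_snd oU s2 s1 oV VU sv Vx; rewrite {1}/Q => ->.
have s1V := smooth_section_subset VU s1; have s2V := smooth_section_subset VU s2.
have sQ : msmooth V (Q (al e2) (r e1)).
  by apply: Q_smooth; [exact: al_smooth|exact: r_smooth].
have -> : X v (Q (al e1) (r e2)) x = - X v (Q (al e2) (r e1)) x.
  by rewrite QN; exact: (vderN oV Vx _ sQ).
by ring.
Qed.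

Lemma brD_linear U k e1 e1' e2 x : mopen U -> smooth_section U e1 ->
  smooth_section U e1' -> smooth_section U e2 -> U x ->
  brD U (fun y => k *: e1 y + e1' y) e2 x = k *: brD U e1 e2 x + brD U e1' e2 x.
Proof.
move=> oU s1 s1' s2 Ux.
have sl : smooth_section U (fun y => k *: e1 y + e1' y).
  exact: (smooth_section_lin vD (@msmooth_cst R M R^o U k) s1 s1').
apply: (dirac_ext oU Ux) => [|V v oV VU Vx sv]; rewrite (lk (x := x)) /=.
  have := courant_fst oU sl s2 Ux; rewrite /r => ->.
  have := courant_fst oU s1 s2 Ux; rewrite /r => ->.
  have := courant_fst oU s1' s2 Ux; rewrite /r => ->.
  rewrite -[RHS](bracket_linear hE k oU (r_smooth s1) (r_smooth s1') (r_smooth s2) Ux).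
  by rewrite -(r_lin (fun=> k)).
rewrite (P_linl (v x)).
have := courant_snd oU sl s2 oV VU sv Vx; rewrite {1}/Q => ->.
have := courant_snd oU s1 s2 oV VU sv Vx; rewrite {1}/Q => ->.
have := courant_snd oU s1' s2 oV VU sv Vx; rewrite {1}/Q => ->.
have r1 := r_smooth (smooth_section_subset VU s1).
have r1' := r_smooth (smooth_section_subset VU s1').
have r2 := r_smooth (smooth_section_subset VU s2).
have a1 := al_smooth (smooth_section_subset VU s1).
have a1' := al_smooth (smooth_section_subset VU s1').
have a2 := al_smooth (smooth_section_subset VU s2).
rewrite (r_lin (fun=> k)) (al_lin (fun=> k)) !(Q_linl (fun=> k)).
have XD s : X s (fun y => k * Q (al e1) v y + Q (al e1') v y) x =
    k * X s (Q (al e1) v) x + X s (Q (al e1') v) x.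
  have q1 := Q_smooth a1 sv; have q1' := Q_smooth a1' sv.
  rewrite /X (vderD oV Vx _ (msmoothM (@msmooth_cst R M R^o V k) q1) q1').
  by rewrite (vderZ oV Vx _ _ q1).
have XDr : X v (fun y => k * Q (al e1) (r e2) y + Q (al e1') (r e2) y) x =
    k * X v (Q (al e1) (r e2)) x + X v (Q (al e1') (r e2)) x.
  have q1 := Q_smooth a1 r2; have q1' := Q_smooth a1' r2.
  rewrite /X (vderD oV Vx _ (msmoothM (@msmooth_cst R M R^o V k) q1) q1').
  by rewrite (vderZ oV Vx _ _ q1).
rewrite XD XDr [X (fun y => _) _ x](vder_anchor_linear hE _ _ _ oV Vx (Q_smooth a2 sv)).
have -> : Q (al e2) (br V (fun y => k *: r e1 y + r e1' y) v) x =
    k * Q (al e2) (br V (r e1) v) x + Q (al e2) (br V (r e1') v) x.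
  by rewrite {1}/Q (bracket_linear hE k oV r1 r1' sv Vx) (P_lin (al e2 x)).
rewrite -/(X (r e1) _ x) -/(X (r e1') _ x) /GRing.scale/=; ring.
Qed.

(** The general Courant bracket violates this rule by a multiple of [df] times the symmetric pairing
    of [e1] and [e2], zero on [D]. Concretely, the derivative of [f] along [v] occurs twice with
    factor [Q (al e1) (r e2)], from the Lie derivative and from the exact term, with opposite
    signs. *)
Lemma brD_leibniz U (f : M -> R^o) e1 e2 x : mopen U -> msmooth U f -> smooth_section U e1 ->
  smooth_section U e2 -> U x ->
  brD U e1 (fun y => f y *: e2 y) x =
  f x *: brD U e1 e2 x + vder f (rho (r e1 x)) *: e2 x.
Proof.
move=> oU sf s1 s2 Ux.
have sl : smooth_section U (fun y => f y *: e2 y) by exact: smooth_sectionZ.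
have rZ : r (fun y => f y *: e2 y) = fun y => f y *: r e2 y.
  by apply/functional_extensionality_dep => y; rewrite /r (linfunZ (lk (x := y))).
have alZ : al (fun y => f y *: e2 y) = fun y => f y *: al e2 y.
  by apply/functional_extensionality_dep => y; rewrite /al (linfunZ (lk (x := y))).
have QZ s : Q (fun y => f y *: al e2 y) s = fun y => f y * Q (al e2) s y.
  by apply/funext => y; rewrite /Q (linfunZ (P_linl (s y))).
have QZr a : Q a (fun y => f y *: r e2 y) = fun y => f y * Q a (r e2) y.
  by apply/funext => y; rewrite /Q (linfunZ (P_lin (a y))).
apply: (dirac_ext oU Ux) => [|V v oV VU Vx sv]; rewrite (lk (x := x)) (linfunZ (lk (x := x))) /=.
  have := courant_fst oU s1 sl Ux; rewrite rZ {1}/r => ->.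
  have := courant_fst oU s1 s2 Ux; rewrite {1}/r => ->.
  exact: (bracket_leibniz hE oU sf (r_smooth s1) (r_smooth s2) Ux).
rewrite (P_linl (v x)) (linfunZ (P_linl (v x))).
have := courant_snd oU s1 sl oV VU sv Vx; rewrite {1}/Q => ->.
have := courant_snd oU s1 s2 oV VU sv Vx; rewrite {1}/Q => ->.
have r1 := r_smooth (smooth_section_subset VU s1).
have r2 := r_smooth (smooth_section_subset VU s2).
have a1 := al_smooth (smooth_section_subset VU s1).
have a2 := al_smooth (smooth_section_subset VU s2).
have sfV := msmooth_subset VU sf.
rewrite rZ alZ !QZ QZr.
have -> : X (r e1) (fun y => f y * Q (al e2) v y) x =
    X (r e1) f x * Q (al e2) v x + f x * X (r e1) (Q (al e2) v) x.
  exact: (vderM oV Vx _ sfV (Q_smooth a2 sv)).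
have -> : X v (fun y => f y * Q (al e1) (r e2) y) x =
    X v f x * Q (al e1) (r e2) x + f x * X v (Q (al e1) (r e2)) x.
  exact: (vderM oV Vx _ sfV (Q_smooth a1 r2)).
rewrite [X (fun y => _ *: _) _ x](vder_anchorZ hE _ _ oV Vx (Q_smooth a1 sv)).
rewrite -/(X (r e2) _ x).
have -> : Q (al e1) (br V (fun y => f y *: r e2 y) v) x =
    f x * Q (al e1) (br V (r e2) v) x - X v f x * Q (al e1) (r e2) x.
  rewrite /Q (bracket_antisym hE oV (smooth_sectionZ vE sfV r2) sv Vx).
  rewrite (bracket_leibniz hE oV sfV sv r2 Vx) (bracket_antisym hE oV sv r2 Vx).
  rewrite -/(X v f x) scalerN opprD opprK (linfunB (P_lin (al e1 x))).
  by rewrite !(linfunZ (P_lin (al e1 x))).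
rewrite -/(X (r e1) f x) -/(Q (al e2) v x) /GRing.scale/=; ring.
Qed.

(** Everything reduces to [same_jet1_linear] for two fibrewise linear maps on [D]: the component in
    [E] read in a trivialization ([jr]), and the pairing of the other component with a fixed section
    ([jv]). *)
Lemma brD_jet1 U e1 e1' e2 e2' x : mopen U -> smooth_section U e1 ->
  smooth_section U e1' -> smooth_section U e2 -> smooth_section U e2' -> U x ->
  same_jet1 x e1 e1' -> same_jet1 x e2 e2' -> brD U e1 e2 x = brD U e1' e2' x.
Proof.
move=> oU s1 s1' s2 s2' Ux j1 j2.
have jr e e' : smooth_section U e -> smooth_section U e' -> same_jet1 x e e' ->
    same_jet1 x (r e) (r e').
  move=> se se' jee'; split=> [|j jx w]; first by rewrite /r jee'.1.
  have oUj : mopen (U `&` vdom E j) by apply: mopenI => //; exact: (vdom_open vE).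
  have sub : U `&` vdom E j `<=` U by move=> y [].
  apply: (@same_jet1_linear _ _ D (vfib E j) (U `&` vdom E j) x
    (fun y d => triv E j y (kappa d).1) e e') => //.
  - exact: vfib_hausdorff.
  - by move=> y [_ jy] k d d'; rewrite (lk (x := y)) (triv_linear vE jy).
  - move=> g s pg gU ss; apply: (@smooth_along_triv _ _ E g (fun t => (kappa (s t)).1)).
      exact: (whitney_fst vE vF vD mk pg ss).
    by move=> t; case: (gU t).
  - exact: smooth_section_subset se.
  - exact: smooth_section_subset se'.
have jv V v (oV : mopen V) (VU : V `<=` U) (Vx : V x) e e' (Z : tangent M x) :
    smooth_section V v -> smooth_section U e -> smooth_section U e' -> same_jet1 x e e' ->
    vder (Q (al e) v) Z = vder (Q (al e') v) Z.
  move=> sv se se' jee'.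
  apply: (@same_jet1_linear _ _ D R^o V x (fun y d => P (kappa d).2 (v y)) e e') => //.
  - by move=> y _ k d d'; rewrite (lk (x := y)) (P_linl (v y)).
  - move=> g s pg gU ss.
    apply: (@pairing_smooth _ _ E F iota g (fun t => (kappa (s t)).2) (fun t => v (g t))) => //.
      exact: (whitney_snd vE vF vD mk pg ss).
    by move/smooth_sectionP: sv; exact.
  - exact: smooth_section_subset se.
  - exact: smooth_section_subset se'.
have rE1 : r e1 x = r e1' x by rewrite /r j1.1.
have rE2 : r e2 x = r e2' x by rewrite /r j2.1.
have aE1 : al e1 x = al e1' x by rewrite /al j1.1.
have aE2 : al e2 x = al e2' x by rewrite /al j2.1.
apply: (dirac_ext oU Ux) => [|V v oV VU Vx sv].
  have := courant_fst oU s1 s2 Ux; rewrite {1}/r => ->.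
  have := courant_fst oU s1' s2' Ux; rewrite {1}/r => ->.
  by apply: (bracket_jet1 hE) => //; [exact: r_smooth..|exact: jr|exact: jr].
have := courant_snd oU s1 s2 oV VU sv Vx; rewrite {1}/Q => ->.
have := courant_snd oU s1' s2' oV VU sv Vx; rewrite {1}/Q => ->.
have bE e e' : smooth_section U e -> smooth_section U e' -> same_jet1 x e e' ->
    br V (r e) v x = br V (r e') v x.
  move=> se se' jee'; apply: (bracket_jet1 hE) => //.
  - exact: r_smooth (smooth_section_subset VU se).
  - exact: r_smooth (smooth_section_subset VU se').
  - exact: jr.
have XE e e' w : smooth_section U e -> smooth_section U e' -> same_jet1 x e e' ->
    smooth_section V w -> X v (Q (al e) w) x = X v (Q (al e') w) x.
  by move=> se se' jee' sw; exact: (jv V w oV VU Vx e e').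
have -> : X (r e1) (Q (al e2) v) x = X (r e1') (Q (al e2') v) x.
  by rewrite /X rE1; exact: (jv V v oV VU Vx e2 e2').
have -> : X (r e2) (Q (al e1) v) x = X (r e2') (Q (al e1') v) x.
  by rewrite /X rE2; exact: (jv V v oV VU Vx e1 e1').
have -> : Q (al e2) (br V (r e1) v) x = Q (al e2') (br V (r e1') v) x.
  by rewrite /Q aE2 (bE e1 e1').
have -> : Q (al e1) (br V (r e2) v) x = Q (al e1') (br V (r e2') v) x.
  by rewrite /Q aE1 (bE e2 e2').
have r1' := r_smooth (smooth_section_subset VU s1').
have r2 := r_smooth (smooth_section_subset VU s2).
have a2 := al_smooth (smooth_section_subset VU s2).
have a2' := al_smooth (smooth_section_subset VU s2').
(* The last term involves both sections, so they are replaced one at a time: after [e1], isotropy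
   exchanges the roles and puts [e2] into the argument that [XE] can treat. *)
rewrite (XE e1 e1')// !(QN e1') /X (vderN oV Vx _ (Q_smooth a2 r1')).
by rewrite (vderN oV Vx _ (Q_smooth a2' r1')) -/(X v _ x) (XE e2 e2').
Qed.

(** * The Jacobi identity for the bracket on [D] *)

Let nested_sum (A B C G H I J K L N O S T U : R^o) :
  A - B - (C - G) + H - (I - J - (K - L) + (H - N)) - (O - S - T) + U =
  A - B - C + G + N - I + J + K - L - (O - S) + T + U.
Proof. by ring. Qed.

Let isotropy_sum (A B C G H I : R^o) :
  A - - B - (- C - G) + H = - I -> A + B + C + G + H + I = 0.
Proof. by move=> h; lra. Qed.

(** The capital letters, each occurring twice with opposite signs, stand for iterated derivatives
    along the [r e] and for derivatives of a pairing with one bracket. The [j], [k], [l] are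
    pairings with double brackets, eliminated by the Jacobi identity of [E]; the [t] and [u] are the
    derivatives along [v]. *)
Let cyclic_sum (A B C G H I J K L N O S : R^o)
    (t1 t2 t3 j1 j2 j3 k1 k2 k3 l1 l2 l3 u1 u2 u3 : R^o) :
  j1 - k2 + l3 = 0 -> j2 - k3 + l1 = 0 -> j3 - k1 + l2 = 0 ->
  t1 + u2 + t2 + u1 + t3 + u3 = 0 ->
  (A - B - C + G + t1 - H + j1 + I - k1 - (J - K) + l1 + u1) +
  (J - L - N + H + t2 - O + j2 + B - k2 - (S - C) + l2 + u2) +
  (S - I - K + O + t3 - G + j3 + L - k3 - (A - N) + l3 + u3) = 0.
Proof. by move=> h1 h2 h3 h4; lra. Qed.

(** The inner bracket is eliminated in favour of data of [E]. As the anchor is a Lie algebra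
    morphism, derivatives along brackets become commutators, and the mixed term in [X (r e1)] and
    [X v] cancels. The summands are in the order that [cyclic_sum] expects. *)
Let courant_nested U V e1 e2 e3 v x : mopen U -> smooth_section U e1 ->
  smooth_section U e2 -> smooth_section U e3 -> mopen V -> V `<=` U ->
  smooth_section V v -> V x ->
  Q (al (brD U e1 (brD U e2 e3))) v x =
  X (r e1) (X (r e2) (Q (al e3) v)) x - X (r e1) (Q (al e3) (br V (r e2) v)) x
  - X (r e1) (X (r e3) (Q (al e2) v)) x + X (r e1) (Q (al e2) (br V (r e3) v)) x
  + X v (X (r e1) (Q (al e2) (r e3))) x
  - X (r e2) (Q (al e3) (br V (r e1) v)) x + Q (al e3) (br V (r e2) (br V (r e1) v)) x
  + X (r e3) (Q (al e2) (br V (r e1) v)) x - Q (al e2) (br V (r e3) (br V (r e1) v)) x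
  - (X (r e2) (X (r e3) (Q (al e1) v)) x - X (r e3) (X (r e2) (Q (al e1) v)) x)
  + Q (al e1) (br V (br V (r e2) (r e3)) v) x + X v (Q (al e1) (br V (r e2) (r e3))) x.
Proof.
move=> oU s1 s2 s3 oV VU sv Vx.
have s23 := sD oU s2 s3.
have r1 := r_smooth (smooth_section_subset VU s1).
have r2 := r_smooth (smooth_section_subset VU s2).
have r3 := r_smooth (smooth_section_subset VU s3).
have a1 := al_smooth (smooth_section_subset VU s1).
have a2 := al_smooth (smooth_section_subset VU s2).
have a3 := al_smooth (smooth_section_subset VU s3).
have r23 := r_smooth (smooth_section_subset VU s23).
have r23E y : V y -> r (brD U e2 e3) y = br V (r e2) (r e3) y.
  move=> Vy; rewrite (courant_fst oU s2 s3 (VU _ Vy)).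
  by rewrite (bracket_restrict hE oU oV VU (r_smooth s2) (r_smooth s3) Vy).
have bs := bracket_smooth hE oV.
have anchorE s s' q : smooth_section V s -> smooth_section V s' -> msmooth V q ->
    X (br V s s') q x = X s (X s' q) x - X s' (X s q) x.
  by move=> ss ss' sq; exact: (bracket_anchor hE oV ss ss' oV _ sq Vx).
rewrite (courant_snd oU s1 s23 oV VU sv Vx).
have -> : X (r e1) (Q (al (brD U e2 e3)) v) x =
    X (r e1) (X (r e2) (Q (al e3) v)) x - X (r e1) (Q (al e3) (br V (r e2) v)) x
    - (X (r e1) (X (r e3) (Q (al e2) v)) x - X (r e1) (Q (al e2) (br V (r e3) v)) x)
    + X (r e1) (X v (Q (al e2) (r e3))) x.
  rewrite {1}/X (vder_eq oV Vx _ (fun y Vy => courant_snd oU s2 s3 oV VU sv Vy)).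
  apply: (vder_courant _ oV Vx).
  - by apply: X_smooth => //; exact: Q_smooth.
  - by apply: Q_smooth => //; exact: bs.
  - by apply: X_smooth => //; exact: Q_smooth.
  - by apply: Q_smooth => //; exact: bs.
  - by apply: X_smooth => //; exact: Q_smooth.
rewrite (courant_snd oU s2 s3 oV VU (bs _ _ r1 sv) Vx).
rewrite (anchorE _ _ _ r1 sv (Q_smooth a2 r3)).
have -> : X (r (brD U e2 e3)) (Q (al e1) v) x =
    X (r e2) (X (r e3) (Q (al e1) v)) x - X (r e3) (X (r e2) (Q (al e1) v)) x.
  by rewrite -(anchorE _ _ _ r2 r3 (Q_smooth a1 sv)) /X r23E.
have -> : Q (al e1) (br V (r (brD U e2 e3)) v) x = Q (al e1) (br V (br V (r e2) (r e3)) v) x.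
  by rewrite /Q (bracket_local hE oV oV _ Vx r23 (bs _ _ r2 r3) sv sv r23E).
have -> : X v (Q (al e1) (r (brD U e2 e3))) x = X v (Q (al e1) (br V (r e2) (r e3))) x.
  by apply: (vder_eq oV Vx) => y Vy; rewrite /Q r23E.
exact: nested_sum.
Qed.

Lemma brD_jacobi U e1 e2 e3 x : mopen U -> smooth_section U e1 ->
  smooth_section U e2 -> smooth_section U e3 -> U x ->
  brD U e1 (brD U e2 e3) x + brD U e2 (brD U e3 e1) x + brD U e3 (brD U e1 e2) x = 0.
Proof.
move=> oU s1 s2 s3 Ux.
have s12 := sD oU s1 s2; have s23 := sD oU s2 s3; have s31 := sD oU s3 s1.
apply: (dirac_ext oU Ux) => [|V v oV VU Vx sv].
  rewrite (linfun0 (lk (x := x))) !(linfunD (lk (x := x))) /=.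
  have nested e e' e'' : smooth_section U e -> smooth_section U e' -> smooth_section U e'' ->
      (kappa (brD U e (brD U e' e'') x)).1 = br U (r e) (br U (r e') (r e'')) x.
    move=> se se' se''; have s' := sD oU se' se''.
    have := courant_fst oU se s' Ux; rewrite {1}/r => ->.
    apply: (bracket_local hE oU oU _ Ux) => //; try exact: r_smooth.
      by apply: (bracket_smooth hE oU); exact: r_smooth.
    by move=> y Uy; rewrite courant_fst.
  rewrite !nested//; apply: (bracket_jacobi hE) => //; exact: r_smooth.
rewrite (linfun0 (lk (x := x))) !(linfunD (lk (x := x))) /=.
rewrite (linfun0 (P_linl (v x))) !(linfunD (P_linl (v x))).
have := courant_nested oU s1 s2 s3 oV VU sv Vx; rewrite {1}/Q => ->.
have := courant_nested oU s2 s3 s1 oV VU sv Vx; rewrite {1}/Q => ->.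
have := courant_nested oU s3 s1 s2 oV VU sv Vx; rewrite {1}/Q => ->.
have r1 := r_smooth (smooth_section_subset VU s1).
have r2 := r_smooth (smooth_section_subset VU s2).
have r3 := r_smooth (smooth_section_subset VU s3).
have a1 := al_smooth (smooth_section_subset VU s1).
have a2 := al_smooth (smooth_section_subset VU s2).
have a3 := al_smooth (smooth_section_subset VU s3).
have bs := bracket_smooth hE oV.
have jac w w' a : smooth_section V w -> smooth_section V w' ->
    Q a (br V w' (br V w v)) x - Q a (br V w (br V w' v)) x + Q a (br V (br V w w') v) x = 0.
  move=> sw sw'; have := bracket_jacobiE hE oV sw sw' sv Vx.
  rewrite /Q -(linfunB (P_lin (a x))) -(linfunD (P_lin (a x))) => ->.
  by rewrite (linfun0 (P_lin (a x))).
have J3 := jac _ _ (al e3) r1 r2; have J1 := jac _ _ (al e1) r2 r3.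
have J2 := jac _ _ (al e2) r3 r1.
(* Isotropy for the pair [brD U e1 e2], [e3], both sections of [D]: the left pairing is expanded by
   [courant_snd] with [r e3] as test section, the result is differentiated along [v], and
   antisymmetry brings it into cyclic form. *)
have G : X v (X (r e1) (Q (al e2) (r e3))) x + X v (Q (al e2) (br V (r e3) (r e1))) x
    + X v (X (r e2) (Q (al e3) (r e1))) x + X v (Q (al e1) (br V (r e2) (r e3))) x
    + X v (X (r e3) (Q (al e1) (r e2))) x + X v (Q (al e3) (br V (r e1) (r e2))) x = 0.
  have E1 : X v (Q (al (brD U e1 e2)) (r e3)) x = - X v (Q (al e3) (br V (r e1) (r e2))) x.
    rewrite -[RHS](vderN oV Vx _ (Q_smooth a3 (bs _ _ r1 r2))).
    apply: (vder_eq oV Vx) => y Vy; rewrite QN /Q (courant_fst oU s1 s2 (VU _ Vy)).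
    by rewrite (bracket_restrict hE oU oV VU (r_smooth s1) (r_smooth s2) Vy).
  move: E1; rewrite {1}/X (vder_eq oV Vx _ (fun y Vy => courant_snd oU s1 s2 oV VU r3 Vy)).
  rewrite (vder_courant _ oV Vx (X_smooth oV r1 (Q_smooth a2 r3))
    (Q_smooth a2 (bs _ _ r1 r3)) (X_smooth oV r2 (Q_smooth a1 r3))
    (Q_smooth a1 (bs _ _ r2 r3)) (X_smooth oV r3 (Q_smooth a1 r2))).
  rewrite -!/(X v _ x).
  have -> : X v (X (r e2) (Q (al e1) (r e3))) x = - X v (X (r e2) (Q (al e3) (r e1))) x.
    rewrite -[RHS](vderN oV Vx _ (X_smooth oV r2 (Q_smooth a3 r1))).
    apply: (vder_eq oV Vx) => y Vy; rewrite QN.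
    exact: (vderN oV Vy _ (Q_smooth a3 r1)).
  have -> : X v (Q (al e2) (br V (r e1) (r e3))) x = - X v (Q (al e2) (br V (r e3) (r e1))) x.
    rewrite -[RHS](vderN oV Vx _ (Q_smooth a2 (bs _ _ r3 r1))).
    apply: (vder_eq oV Vx) => y Vy.
    by rewrite /Q (bracket_antisym hE oV r1 r3 Vy) (linfunN (P_lin _)).
  exact: isotropy_sum.
exact: cyclic_sum J3 J1 J2 G.
Qed.

Lemma brD_anchor U e1 e2 : mopen U -> smooth_section U e1 -> smooth_section U e2 ->
  is_vfield_bracket U (fun x => dirac_anchor rho kappa (e1 x))
    (fun x => dirac_anchor rho kappa (e2 x))
    (fun x => dirac_anchor rho kappa (brD U e1 e2 x)).
Proof.
move=> oU s1 s2 V f oV VU sf x Vx.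
rewrite /dirac_anchor; have := courant_fst oU s1 s2 (VU _ Vx); rewrite {1}/r => ->.
exact: (bracket_anchor hE oU (r_smooth s1) (r_smooth s2) oV VU sf Vx).
Qed.

Lemma dirac_anchor_morphism : is_anchor (dirac_anchor rho kappa).
Proof.
apply: plot_is_morphism => //.
  move=> x k d d'; rewrite /dirac_anchor (lk (x := x)).
  exact: (algebroid_anchor hE).1.
move=> g s pg ss; apply: (@is_morphism_plot _ _ E (tangent M) rho) => //.
- by move=> i; case: (model_convenient i).
- exact: algebroid_anchor hE.
- exact: (whitney_fst vE vF vD mk pg ss).
Qed.

Lemma dirac_lie_algebroid : is_lie_algebroid (dirac_anchor rho kappa) brD.
Proof.
split => //.
- exact: dirac_anchor_morphism.
- by move=> U k e1 e1' e2 oU s1 s1' s2 x Ux; exact: brD_linear.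
- by move=> U e1 e2 oU s1 s2 x Ux; exact: brD_antisym.
- by move=> U e1 e2 e3 oU s1 s2 s3 x Ux; exact: brD_jacobi.
- by move=> U V e1 e2 oU oV VU s1 s2 x Vx; exact: brD_restrict.
- by move=> U e1 e1' e2 e2' oU s1 s1' s2 s2' x Ux; exact: brD_jet1.
- by move=> U f e1 e2 oU sf s1 s2 x Ux; exact: brD_leibniz.
- by move=> U e1 e2 oU s1 s2; exact: brD_anchor.
Qed.

End Bracket.
End CourantBracket.

Theorem theorem2p25 (R : realType) (M : manifold R) (E : bundle_data M)
    (rho : forall x, E x -> tangent M x) (br : section_bracket E)
    (hE : is_lie_algebroid rho br)
    (F : bundle_data M) (iota : forall x, F x -> dual_bundle E x)
    (hF : is_weak_subbundle iota)
    (D : bundle_data M) (kappa : forall x, D x -> whitney_sum E F x)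
    (hD : is_partial_almost_dirac iota kappa) :
  is_partial_dirac rho br iota kappa <->
  exists brD : section_bracket D,
    [/\ restricts_courant rho br iota kappa brD,
        is_anchor (dirac_anchor rho kappa) &
        is_lie_algebroid (dirac_anchor rho kappa) brD].
Proof.
split=> [[_ inv]|[brD [cD _ lD]]]; last first.
  (* The converse is immediate: smoothness of the algebroid bracket as a section of [D] is
     involutivity. *)
  split=> // U e1 e2 oU s1 s2; exists (brD U e1 e2); last exact: cD.
  exact: (bracket_smooth lD).
(* Involutivity gives a section for each admissible [U], [e1], [e2], and choice turns these into an
   operation; [e1] is a dummy value where the hypotheses fail. *)
have ex U e1 e2 : {e : section D | mopen U -> smooth_section U e1 -> smooth_section U e2 ->
    smooth_section U e /\ is_courant_bracket rho br iota U (fun x => kappa _ (e1 x))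
      (fun x => kappa _ (e2 x)) (fun x => kappa _ (e x))}.
  apply/cid; have [[oU [s1 s2]]|H] :=
    pselect (mopen U /\ smooth_section U e1 /\ smooth_section U e2).
    by have [e se ce] := inv U e1 e2 oU s1 s2; exists e.
  by exists e1 => oU s1 s2; exfalso; apply: H.
pose brD U e1 e2 := sval (ex U e1 e2).
have sD U e1 e2 : mopen U -> smooth_section U e1 -> smooth_section U e2 ->
    smooth_section U (brD U e1 e2).
  by move=> oU s1 s2; case: (svalP (ex U e1 e2) oU s1 s2).
have cD : restricts_courant rho br iota kappa brD.
  by move=> U e1 e2 oU s1 s2; case: (svalP (ex U e1 e2) oU s1 s2).
exists brD; split => //; first exact: (dirac_anchor_morphism hE hF hD).
exact: (dirac_lie_algebroid hE hF hD sD cD).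
Qed.
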